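(* The Hunter–Saxton equation $$v_{txx}=-2v_xv_{xx}-vv_{xxx}$$ is a well-defined equation on the equivalence classes of periodic functions $$\{v(x)\sim v(x+p)+q\ \text{ for any } p,q\in\mathbb{R}\}.$$ It describes the geodesic flow on the homogeneous space $Vir/\mathrm{Rot}(S^1)$ of the Virasoro group modulo rotations with respect to the right-invariant homogeneous $\dot H^1$-metric.
   Context: Functions are smooth, $S^1=\mathbb{R}/2\pi\mathbb{Z}$ with coordinate $x$. The Virasoro algebra is $vir=vect(S^1)\oplus\mathbb{R}$ with commutator $[(v\partial_x,b),(w\partial_x,c)]=((-vw_x+v_xw)\partial_x,\int_{S^1}vw_{xxx}\,dx)$. The Virasoro group is $Vir=\mathrm{Diff}(S^1)\times\mathbb{R}$ ($\mathrm{Diff}(S^1)$ being the orientation-preserving diffeomorphisms) with multiplication $(\psi,a)\circ(\phi,b)=(\psi\circ\phi,\ a+b+\int_{S^1}\log((\psi\circ\phi)_x)\,d\log(\phi_x))$. The subgroup $K=\mathrm{Rot}(S^1)$ of rotations has as Lie algebra the constant vector fields, and $Vir/\mathrm{Rot}(S^1)$ is the space of right cosets $Kg$. The $\dot H^1$-form on $vir$ is $\langle(v\partial_x,b),(w\partial_x,c)\rangle_{\dot H^1}=\int_{S^1}v_xw_x\,dx+bc$. It is degenerate exactly along constant vector fields and invariant under rotations; its right-invariant extension to $Vir$ descends to a right-invariant metric on $Vir/\mathrm{Rot}(S^1)$, the homogeneous $\dot H^1$-metric. The smooth dual is $vir^*=\{(u(dx)^2,a)\}$ with pairing $\langle(u(dx)^2,a),(w\partial_x,c)\rangle=\int_{S^1}uw\,dx+ac$.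 The inertia operator is $A:vir\to vir^*$, $A(v\partial_x,b)=(-v_{xx}(dx)^2,b)$, with image $L=\{(u(dx)^2,a):\int_{S^1}u\,dx=0\}$, on which $K$ acts by $u(x)\mapsto u(x+p)$. The geodesic flow on $Vir/\mathrm{Rot}(S^1)$ is described by its Euler equation, i.e. by the evolution of the velocity of a geodesic transported to the identity coset by right translation: for a lift $g(t)\in Vir$ of a geodesic, the right-translated velocity $(v\partial_x,b)\in vir$ gives $m=A(v\partial_x,b)\in L$, whose class in $L/K$ evolves by the quotient of the equation $\frac{dm}{dt}=-\mathrm{ad}^*_{A^{-1}m}m$, where $\langle\mathrm{ad}^*_Xm,Y\rangle=\langle m,[X,Y]\rangle$. An equation on the equivalence classes means that $v_t$ is prescribed up to addition of constants and of multiples of $v_x$ (the directions tangent to the class of $v$), compatibly with the equivalence relation; the parameters $p,q$ may depend on $t$. In particular, a term $bv_{xxx}$ with constant $b$ in the equation for $v_{txx}$ is absorbed by passing to equivalence classes. *)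

(* Defs.v *)
From Stdlib Require Import Reals List.
From Coquelicot Require Import Coquelicot.
Open Scope R_scope.

(** * Smooth functions *)

Definition smooth (f : R -> R) : Prop := forall n x, ex_derive_n f n x.

Definition time_interval (alpha beta : Rbar) (t : R) : Prop :=
  Rbar_lt alpha t /\ Rbar_lt t beta.

Definition smooth_on_interval (alpha beta : Rbar) (f : R -> R) : Prop :=
  forall n t, time_interval alpha beta t -> ex_derive_n f n t.

Fixpoint dir_derive {V : NormedModule R_AbsRing} (hs : list V) (f : V -> R)
  : V -> R :=
  match hs with
  | nil => f
  | cons h hs' =>
      fun x => Derive (fun s => dir_derive hs' f (plus x (scal s h))) 0
  end.

(** Only used with [V] a power of [R] and [U] open: a function is [C^infinity]
    iff all its iterated directional derivatives exist and are continuous. *)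
Definition smooth_on {V : NormedModule R_AbsRing} (U : V -> Prop) (f : V -> R)
  : Prop :=
  forall (hs : list V) (x : V), U x ->
    continuous (dir_derive hs f) x /\
    forall h : V, ex_derive (fun s => dir_derive hs f (plus x (scal s h))) 0.

(** Functions on [S^1 = R / 2 PI Z] are [2 PI]-periodic functions on [R]. *)
Definition periodic (f : R -> R) : Prop := forall x, f (x + 2 * PI) = f x.

Definition circle_function (f : R -> R) : Prop := smooth f /\ periodic f.

Definition circle_int (f : R -> R) : R := RInt f 0 (2 * PI).

(** Time-dependent smooth functions on the circle, [v t x]. *)
Definition smooth_circle_curve (alpha beta : Rbar) (v : R -> R -> R) : Prop :=
  smooth_on (fun tx : R * R => time_interval alpha beta (fst tx))
            (fun tx : R * R => v (fst tx) (snd tx)) /\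
  forall t, time_interval alpha beta t -> periodic (v t).

(** * The Virasoro algebra and its dual *)

(** [(v, b)] stands for [(v d/dx, b)]; the elements of [vir] are the pairs
    satisfying [in_vir]. The same pairs represent the smooth dual, [(u, a)]
    standing for [(u (dx)^2, a)]. *)
Definition pre_vir : Type := ((R -> R) * R)%type.

Definition in_vir (X : pre_vir) : Prop := circle_function (fst X).

Definition vir_bracket (X Y : pre_vir) : pre_vir :=
  let (v, _) := X in
  let (w, _) := Y in
  (fun x => - v x * Derive w x + Derive v x * w x,
   circle_int (fun x => v x * Derive_n w 3 x)).

Definition vir_pairing (m X : pre_vir) : R :=
  let (u, a) := m in
  let (w, c) := X in
  circle_int (fun x => u x * w x) + a * c.

Definition H1dot (X Y : pre_vir) : R :=
  let (v, b) := X in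
  let (w, c) := Y in
  circle_int (fun x => Derive v x * Derive w x) + b * c.

Definition inertia (X : pre_vir) : pre_vir :=
  let (v, b) := X in (fun x => - Derive_n v 2 x, b).

(** [n = ad^*_X m]. *)
Definition is_ad_star (X m n : pre_vir) : Prop :=
  in_vir n /\
  forall Y, in_vir Y -> vir_pairing n Y = vir_pairing m (vir_bracket X Y).

(** The quotient on [L / K] of [dm/dt = - ad^*_{A^{-1} m} m]: the velocity of
    [m] is prescribed up to vectors tangent to the [K]-orbit of [m], which are
    the multiples of [(u_x, 0)]. The preimage [A^{-1} m] is any [X] with
    [A X = m]; it is unique up to constant vector fields. *)
Definition euler_on_L_mod_K (alpha beta : Rbar) (m : R -> pre_vir) : Prop :=
  forall t, time_interval alpha beta t ->
    exists (X n : pre_vir) (d : R),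
      in_vir X /\ inertia X = m t /\ is_ad_star X (m t) n /\
      (forall x, is_derive (fun s => fst (m s) x) t
                   (- fst n x + d * Derive (fst (m t)) x)) /\
      is_derive (fun s => snd (m s)) t (- snd n).

(** * The Virasoro group *)

(** A diffeomorphism of the circle is represented by a lift to [R], which is
    determined up to the addition of a multiple of [2 PI]. *)
Definition diffeo (phi : R -> R) : Prop :=
  smooth phi /\
  (forall x, phi (x + 2 * PI) = phi x + 2 * PI) /\
  (forall x, 0 < Derive phi x).

Definition pre_Vir : Type := ((R -> R) * R)%type.

(** The Lie algebra cocycle of this group law is [-2] times that of
    [vir_bracket]. Only the coefficient of [b v_xxx] in the equation for
    [v_txx] is affected, and it is absorbed by passing to classes. *)
Definition Vir_mul (g h : pre_Vir) : pre_Vir :=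
  let (psi, a) := g in
  let (phi, b) := h in
  (fun x => psi (phi x),
   a + b +
   circle_int (fun x => ln (Derive (fun y => psi (phi y)) x) *
                        Derive (fun y => ln (Derive phi y)) x)).

(** The inverse of an increasing bijection of [R]. *)
Definition diffeo_inv (phi : R -> R) : R -> R :=
  fun y => real (Lub_Rbar (fun x => phi x <= y)).

(** No cocycle term appears, since [log ((phi o phi^-1)_x) = 0]. *)
Definition Vir_inv (g : pre_Vir) : pre_Vir :=
  let (phi, a) := g in (diffeo_inv phi, - a).

Definition rotation (theta : R) : pre_Vir := (fun x => x + theta, 0).

(** [K g = K h]; the indeterminacy of the lifts is absorbed by [theta]. *)
Definition same_right_coset (g h : pre_Vir) : Prop :=
  exists theta : R,
    (forall x, fst h x = fst (Vir_mul (rotation theta) g) x) /\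
    snd h = snd (Vir_mul (rotation theta) g).

Definition smooth_Vir_curve (alpha beta : Rbar) (g : R -> pre_Vir) : Prop :=
  (forall t, time_interval alpha beta t -> diffeo (fst (g t))) /\
  smooth_on (fun tx : R * R => time_interval alpha beta (fst tx))
            (fun tx : R * R => fst (g (fst tx)) (snd tx)) /\
  smooth_on_interval alpha beta (fun t => snd (g t)).

(** The derivative of [s |-> g(s) g(t)^{-1}] at [s = t]. *)
Definition right_velocity (g : R -> pre_Vir) (t : R) : pre_vir :=
  (fun x => Derive (fun s => fst (Vir_mul (g s) (Vir_inv (g t))) x) t,
   Derive (fun s => snd (Vir_mul (g s) (Vir_inv (g t)))) t).

Definition has_right_velocity (alpha beta : Rbar) (g : R -> pre_Vir)
  (v : R -> R -> R) (b : R -> R) : Prop :=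
  forall t, time_interval alpha beta t ->
    (forall x, fst (right_velocity g t) x = v t x) /\
    snd (right_velocity g t) = b t.

(** * Geodesics of [Vir / Rot] *)

(** The energy of the projection to [Vir / Rot] of the curve [g]; it does not
    depend on the lift. *)
Definition energy (g : R -> pre_Vir) (t0 t1 : R) : R :=
  RInt (fun t => / 2 * H1dot (right_velocity g t) (right_velocity g t)) t0 t1.

(** [gamma s t], with [s] the deformation parameter. *)
Definition smooth_Vir_family (eps t0 t1 : R) (gamma : R -> R -> pre_Vir)
  : Prop :=
  let D (s t : R) := Rabs s < eps /\ t0 - eps < t < t1 + eps in
  (forall s t, D s t -> diffeo (fst (gamma s t))) /\
  smooth_on (fun z : R * R * R => D (fst (fst z)) (snd (fst z)))
            (fun z : R * R * R =>
               fst (gamma (fst (fst z)) (snd (fst z))) (snd z)) /\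
  smooth_on (fun z : R * R => D (fst z) (snd z))
            (fun z : R * R => snd (gamma (fst z) (snd z))).

(** [g] lifts a geodesic of [Vir / Rot]: on each compact subinterval its
    projection is a critical point of the energy among the curves of cosets
    with the same endpoints. *)
Definition lifts_geodesic (alpha beta : Rbar) (g : R -> pre_Vir) : Prop :=
  forall t0 t1, time_interval alpha beta t0 -> time_interval alpha beta t1 ->
  t0 < t1 ->
  forall (eps : R) (gamma : R -> R -> pre_Vir), 0 < eps ->
    smooth_Vir_family eps t0 t1 gamma ->
    (forall t, t0 <= t <= t1 -> same_right_coset (g t) (gamma 0 t)) ->
    (forall s, Rabs s < eps ->
       same_right_coset (g t0) (gamma s t0) /\
       same_right_coset (g t1) (gamma s t1)) ->
    is_derive (fun s => energy (gamma s) t0 t1) 0 0.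

(** * Equivalence classes of periodic functions *)

(** The directions tangent to the class of [v]. *)
Definition tangent_to_class (v z : R -> R) : Prop :=
  exists c d : R, forall x, z x = c + d * Derive v x.

(** The velocities [w] at [v] and [w'] at [v'] represent the same tangent
    vector of the space of classes. *)
Definition same_class_velocity (v w v' w' : R -> R) : Prop :=
  exists p q : R,
    (forall x, v' x = v (x + p) + q) /\
    tangent_to_class v' (fun x => w' x - w (x + p)).

(** The Hunter--Saxton equation for a velocity [w = v_t] at [v]. *)
Definition HS_velocity (v w : R -> R) : Prop :=
  circle_function w /\
  forall x, Derive_n w 2 x =
            - 2 * Derive v x * Derive_n v 2 x - v x * Derive_n v 3 x.

Definition HS_class_velocity (v w : R -> R) : Prop :=
  exists w0, HS_velocity v w0 /\ tangent_to_class v (fun x => w x - w0 x).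

Definition HS_class_solution (alpha beta : Rbar) (v : R -> R -> R) : Prop :=
  forall t, time_interval alpha beta t ->
    HS_class_velocity (v t) (fun x => Derive (fun s => v s x) t).

(* Main.v *)
Require Import Defs.
From Stdlib Require Import Reals Lra Lia List ClassicalEpsilon.
From Coquelicot Require Import Coquelicot.
Open Scope R_scope.

(** The equation prescribes [v_txx], and its right hand side is minus the
    derivative of [v v_xx + v_x^2 / 2]. Hence it has a periodic solution [v_t],
    unique up to a constant, and replacing [v] by [v(x + p) + q] changes it by
    [- q v_x] only. This is the statement on classes
    ([HS_velocity_exists], [HS_class_velocity_unique], [HS_class_velocity_iff]).

    Integrating by parts, [ad^*_{(v, b)} (u, a) = (u_x v + 2 u v_x - a v_xxx, 0)]
    ([is_ad_star_formula]). For [u = - v_xx] the Euler equation is therefore the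
    Hunter--Saxton equation with an additional multiple of [v_xxx], which a
    multiple of [v_x] in [v_t] absorbs, together with [b_t = 0]
    ([euler_iff_HS]).

    For the geodesics one passes to the Lagrangian coordinate [y]. Let
    [phi(t, y)] be a curve of diffeomorphisms, [rho = phi_y], [L = ln rho], and
    let [a(t)] be the central coordinate. Since [v_x o phi = L_t], the energy is
    half the integral over time of [int rho L_t^2 dy + b^2], where
    [b = a_t - int L_t L_y dy] ([H1dot_right_velocity]). It depends on [phi] only
    through [L], so it is an energy on the space of cosets. For a variation
    [xi] of [L] and [al] of [a], differentiation under the integral and
    integration by parts ([first_variation], [first_variation_by_parts]) give the
    derivative of the energy as boundary terms minus the integral over time of
    [int rho H xi dy + b_t (al - int L_y xi dy)], where
    [H = L_tt + L_t^2 / 2 - 2 b L_ty / rho]. Moreover [int rho xi dy = 0], because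
    the length of the circle is fixed. So a curve lifts a geodesic if and only if
    [b_t = 0] and [H_y = 0]: in one direction by inspection
    ([lifts_geodesic_of_residual]), in the other by varying [phi] along [- H_y]
    and [a] so that the integrand becomes a sum of squares
    ([geodesic_gradient_zero]). Finally [H] is the composition with [phi] of
    [v_tx + v v_xx + v_x^2 / 2 - 2 b v_xx] ([residual_eulerian]), whose derivative
    in [x] is the Hunter--Saxton equation up to the term [2 b v_xxx].

    Conversely, a solution on classes satisfies
    [v_txx = - 2 v_x v_xx - v v_xxx + d v_xxx] with some [d(t)], and
    [v + 2 b - d] is the velocity of geodesics. What has to be seen is that [d]
    can be chosen smooth, and this follows from the conservation of the energy
    ([HS_coefficient], [solutions_lift]). *)

Notation R1 := R_NormedModule.
Notation R2 := (prod_NormedModule R_AbsRing R1 R1).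
Notation R3 := (prod_NormedModule R_AbsRing R2 R1).

(** * Calculus on the real line *)

Lemma is_derive_comp_R (f g : R -> R) (x df dg : R) :
  is_derive f (g x) df -> is_derive g x dg -> is_derive (fun y => f (g y)) x (dg * df).
Proof. exact (is_derive_comp (K := R_AbsRing) (V := R1) f g x df dg). Qed.

Lemma continuous_mult_R {T : UniformSpace} (f g : T -> R) x :
  continuous f x -> continuous g x -> continuous (fun y => f y * g y) x.
Proof. exact (continuous_mult (K := R_AbsRing) f g x). Qed.

Lemma ex_derive_continuous_R (f : R -> R) x : ex_derive f x -> continuous f x.
Proof. exact (ex_derive_continuous (V := R1) f x). Qed.

Lemma continuous_pair {T A B : UniformSpace} (f : T -> A) (g : T -> B) x :
  continuous f x -> continuous g x ->
  continuous (U := prod_UniformSpace A B) (fun y => (f y, g y)) x.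
Proof.
intros Hf Hg. apply (continuous_comp_2 (X := prod_UniformSpace A B) f g (fun u v => (u, v))); auto.
apply continuous_ext with (fun z => z); [now intros []|apply continuous_id].
Qed.

(** * Smooth functions of several variables *)

Section SmoothOn.

Context {V : NormedModule R_AbsRing}.
Implicit Types (U : V -> Prop) (f g : V -> R) (x h : V).

Definition ddir h f x : R := Derive (fun s => f (plus x (scal s h))) 0.

Lemma line_0 x h : plus x (scal (0 : R) h) = x.
Proof.
assert (E : scal (0 : R) h = zero) by exact (scal_zero_l h).
now rewrite E, plus_zero_r.
Qed.

Lemma scal_plus (a b : R) h : scal (a + b) h = plus (scal a h) (scal b h).
Proof. exact (scal_distr_r a b h). Qed.

Lemma locally_line U x h : locally x U ->
  locally (0 : R) (fun s => U (plus x (scal s h))).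
Proof.
intros Hx.
assert (Hc : continuous (fun s : R_AbsRing => plus x (scal s h)) zero).
{ apply (continuous_plus (U := R_UniformSpace) (fun _ : R => x) (fun s : R => scal s h)).
  - apply continuous_const.
  - apply (continuous_scal_l (U:=R_UniformSpace) (K:=R_AbsRing) (fun s : R => s)). apply continuous_id. }
apply Hc. change (locally (plus x (scal (0 : R) h)) U). rewrite line_0. exact Hx.
Qed.

Lemma smooth_on_continuous U f x : smooth_on U f -> U x -> continuous f x.
Proof. intros Hf Hx. apply (Hf nil x Hx). Qed.

Lemma smooth_on_is_derive U f x h : smooth_on U f -> U x ->
  is_derive (fun s => f (plus x (scal s h))) 0 (ddir h f x).
Proof. intros Hf Hx. apply Derive_correct. apply (Hf nil x Hx). Qed.

Lemma smooth_on_ddir U f h : smooth_on U f -> smooth_on U (ddir h f).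
Proof.
intros Hf hs.
assert (E : forall hs, dir_derive hs (ddir h f) = dir_derive (hs ++ h :: nil) f).
{ clear. induction hs as [|k hs IH]; simpl; [reflexivity|now rewrite IH]. }
rewrite E. apply Hf.
Qed.

Lemma smooth_on_sub U W f : (forall x, W x -> U x) -> smooth_on U f -> smooth_on W f.
Proof. intros H Hf hs x Hx. apply Hf; auto. Qed.

(** [smooth_on] quantifies over iterated derivatives, so it is a greatest fixed
    point: a class of continuous functions stable under directional derivatives
    (up to equality on [U]) can only contain smooth functions. Closure under
    products, compositions or integrals then needs no Leibniz-type formula for
    higher derivatives: it suffices to exhibit a stable class. *)
Lemma smooth_on_coind U (S : (V -> R) -> Prop) : open U ->
  (forall f x, S f -> U x -> continuous f x) ->
  (forall f h, S f -> exists g, S g /\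
     forall x, U x -> is_derive (fun s => f (plus x (scal s h))) 0 (g x)) ->
  forall f, S f -> smooth_on U f.
Proof.
intros HU Hc Hd f Hf.
assert (K : forall hs, exists g, S g /\ forall x, U x -> dir_derive hs f x = g x).
{ induction hs as [|h hs [g [Hg Eg]]].
  - exists f; split; [exact Hf|reflexivity].
  - destruct (Hd g h Hg) as [g' [Hg' Eg']].
    exists g'; split; [exact Hg'|]. intros x Hx. simpl.
    rewrite (Derive_ext_loc _ (fun s => g (plus x (scal s h)))).
    + apply is_derive_unique. now apply Eg'.
    + generalize (locally_line U x h (HU x Hx)). apply filter_imp.
      intros s Hs. now apply Eg. }
intros hs x Hx. destruct (K hs) as [g [Hg Eg]]. split.
- apply continuous_ext_loc with g; [|now apply Hc].
  generalize (HU x Hx). apply filter_imp. intros y Hy. symmetry. now apply Eg.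
- intros h. destruct (Hd g h Hg) as [g' [Hg' Eg']].
  apply ex_derive_ext_loc with (fun s : R_AbsRing => g (plus x (scal s h))).
  + generalize (locally_line U x h (HU x Hx)). apply filter_imp.
    intros s Hs. symmetry. now apply Eg.
  + exists (g' x). now apply Eg'.
Qed.

(** One stable class for all the algebraic closure properties: the derivative
    of each constructor is again an expression in the same constructors. *)
Inductive smooth_alg U : (V -> R) -> Prop :=
| sa_smooth f g : smooth_on U f -> (forall x, U x -> g x = f x) -> smooth_alg U g
| sa_const c : smooth_alg U (fun _ => c)
| sa_plus f g : smooth_alg U f -> smooth_alg U g -> smooth_alg U (fun x => f x + g x)
| sa_mult f g : smooth_alg U f -> smooth_alg U g -> smooth_alg U (fun x => f x * g x)
| sa_inv f : smooth_alg U f -> (forall x, U x -> f x <> 0) -> smooth_alg U (fun x => / f x)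
| sa_ln f : smooth_alg U f -> (forall x, U x -> 0 < f x) -> smooth_alg U (fun x => ln (f x)).

Lemma smooth_alg_smooth U f : open U -> smooth_alg U f -> smooth_on U f.
Proof.
intros HU. apply smooth_on_coind; [exact HU| |].
- clear f. intros f x Hf Hx.
  induction Hf as [f g Hf E|c|f g Hf IHf Hg IHg|f g Hf IHf Hg IHg|f Hf IHf N|f Hf IHf N].
  + apply continuous_ext_loc with f; [|now apply smooth_on_continuous with U].
    generalize (HU x Hx). apply filter_imp. intros y Hy. symmetry. now apply E.
  + apply continuous_const.
  + now apply (continuous_plus (V := R1) f g).
  + now apply (continuous_mult_R f g).
  + apply (continuous_comp f Rinv); [exact IHf|]. apply continuous_Rinv. now apply N.
  + apply (continuous_comp f ln); [exact IHf|]. apply continuous_ln. now apply N.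
- clear f. intros f h Hf.
  assert (Z : forall (f : V -> R) x, f (plus x (scal (0 : R) h)) = f x).
  { intros k x. now rewrite line_0. }
  induction Hf as [f g Hf E|c|f g Hf [f' [Sf Df]] Hg [g' [Sg Dg]]|f g Hf [f' [Sf Df]] Hg [g' [Sg Dg]]|f Hf [f' [Sf Df]] N|f Hf [f' [Sf Df]] N].
  + exists (ddir h f). split.
    * apply sa_smooth with (ddir h f); [now apply smooth_on_ddir|reflexivity].
    * intros x Hx. apply is_derive_ext_loc with (fun s : R_AbsRing => f (plus x (scal s h))).
      -- generalize (locally_line U x h (HU x Hx)). apply filter_imp.
         intros s Hs. symmetry. now apply E.
      -- now apply smooth_on_is_derive with U.
  + exists (fun _ => 0). split; [apply sa_const|]. intros. apply (is_derive_const (V := R1)).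
  + exists (fun x => f' x + g' x). split; [now apply sa_plus|]. intros x Hx.
    apply (is_derive_plus (V := R1) (fun s : R => f (plus x (scal s h)))); auto.
  + exists (fun x => f' x * g x + f x * g' x). split.
    * apply sa_plus; now apply sa_mult.
    * intros x Hx.
      generalize (is_derive_mult (fun s : R => f (plus x (scal s h)))
        (fun s : R => g (plus x (scal s h))) 0 _ _ (Df x Hx) (Dg x Hx) Rmult_comm).
      now rewrite !Z.
  + exists (fun x => - 1 * (f' x * (/ f x * / f x))). split.
    * apply sa_mult; [apply sa_const|]. apply sa_mult; [exact Sf|].
      apply sa_mult; now apply sa_inv.
    * intros x Hx.
      assert (N' : f (plus x (scal (0 : R) h)) <> 0) by (rewrite Z; now apply N).
      generalize (is_derive_inv (fun s : R => f (plus x (scal s h))) 0 _ (Df x Hx) N').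
      rewrite Z. intros D. replace (-1 * _) with (- f' x / f x ^ 2); [exact D|].
      field. now apply N.
  + exists (fun x => f' x * / f x). split.
    * apply sa_mult; [exact Sf|]. apply sa_inv; [exact Hf|].
      intros x Hx. apply Rgt_not_eq. now apply N.
    * intros x Hx.
      apply (is_derive_comp_R ln (fun s : R => f (plus x (scal s h)))).
      -- rewrite Z. apply is_derive_ln. now apply N.
      -- now apply Df.
Qed.

Lemma smooth_on_alg U f : smooth_on U f -> smooth_alg U f.
Proof. intros Hf. now apply sa_smooth with f. Qed.

Lemma smooth_on_ext U f g : open U -> (forall x, U x -> g x = f x) ->
  smooth_on U f -> smooth_on U g.
Proof. intros HU E Hf. apply smooth_alg_smooth; [exact HU|]. now apply sa_smooth with f. Qed.

(** Restricted to the plane through [x] spanned by [h] and [k], this is the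
    theorem of Schwarz. *)
Lemma ddir_comm U f h k x : open U -> smooth_on U f -> U x ->
  ddir h (ddir k f) x = ddir k (ddir h f) x.
Proof.
intros HU Hf Hx.
set (P := fun u v : R => plus (plus x (scal u h)) (scal v k)).
assert (HP : forall u v s, plus (P u v) (scal s h) = P (u + s) v).
{ intros u v s. unfold P.
  rewrite (scal_plus u s h).
  rewrite <- plus_assoc, (plus_comm (scal v k)), !plus_assoc. reflexivity. }
assert (HP' : forall u v s, plus (P u v) (scal s k) = P u (v + s)).
{ intros u v s. unfold P. now rewrite (scal_plus v s k), !plus_assoc. }
assert (P0 : P 0 0 = x).
{ unfold P. now rewrite !line_0. }
assert (PC : forall u v, continuous (fun z : R * R => P (fst z) (snd z)) (u, v)).
{ intros u v. apply (continuous_plus (U := prod_UniformSpace R_UniformSpace R_UniformSpace)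
      (fun z : R * R => plus x (scal (fst z) h)) (fun z : R * R => scal (snd z) k)).
  - apply (continuous_plus (U := prod_UniformSpace R_UniformSpace R_UniformSpace)
      (fun z : R * R => x) (fun z : R * R => scal (fst z) h)); [apply continuous_const|].
    apply (continuous_scal_l (U := prod_UniformSpace R_UniformSpace R_UniformSpace) (K := R_AbsRing) (fun z : R * R => fst z)).
    apply continuous_fst.
  - apply (continuous_scal_l (U := prod_UniformSpace R_UniformSpace R_UniformSpace) (K := R_AbsRing) (fun z : R * R => snd z)).
    apply continuous_snd. }
assert (C : forall g : V -> R, smooth_on U g -> forall u v, U (P u v) ->
   continuity_2d_pt (fun u v => g (P u v)) u v).
{ intros g Hg u v Huv. apply continuity_2d_pt_filterlim.
  change (continuous (fun z : R * R => g (P (fst z) (snd z))) (u, v)).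
  apply (continuous_comp (fun z : R * R => P (fst z) (snd z)) g); [apply PC|].
  now apply smooth_on_continuous with U. }
assert (L : locally_2d (fun u v => U (P u v)) 0 0).
{ apply locally_2d_locally. apply (PC 0 0). simpl. rewrite P0. now apply HU. }
assert (D1 : forall g u v, Derive (fun z => g (P z v)) u = ddir h g (P u v)).
{ intros g u v. unfold ddir, Derive. f_equal. apply Lim_ext. intros s.
  rewrite !HP. now rewrite !Rplus_0_l, Rplus_0_r. }
assert (D2 : forall g u v, Derive (fun z => g (P u z)) v = ddir k g (P u v)).
{ intros g u v. unfold ddir, Derive. f_equal. apply Lim_ext. intros s.
  rewrite !HP'. now rewrite !Rplus_0_l, Rplus_0_r. }
assert (X1 : forall g u v, smooth_on U g -> U (P u v) -> ex_derive (fun z => g (P z v)) u).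
{ intros g u v Hg Huv. exists (ddir h g (P u v)).
  pose proof (smooth_on_is_derive U g (P u v) h Hg Huv) as D.
  apply (is_derive_ext (fun s => g (plus (P u v) (scal (s - u) h)))).
  { intros s. rewrite HP. do 2 f_equal. ring. }
  assert (E : is_derive (fun s : R => s - u) u 1) by (auto_derive; auto; ring).
  replace (ddir h g (P u v)) with (scal 1 (ddir h g (P u v))) by (apply (scal_one (V := R1))).
  apply (is_derive_comp_R (fun s : R => g (plus (P u v) (scal s h))) (fun s => s - u)); [|exact E].
  now replace (u - u) with 0 by ring. }
assert (X2 : forall g u v, smooth_on U g -> U (P u v) -> ex_derive (fun z => g (P u z)) v).
{ intros g u v Hg Huv. exists (ddir k g (P u v)).
  pose proof (smooth_on_is_derive U g (P u v) k Hg Huv) as D.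
  apply (is_derive_ext (fun s => g (plus (P u v) (scal (s - v) k)))).
  { intros s. rewrite HP'. do 2 f_equal. ring. }
  assert (E : is_derive (fun s : R => s - v) v 1) by (auto_derive; auto; ring).
  replace (ddir k g (P u v)) with (scal 1 (ddir k g (P u v))) by (apply (scal_one (V := R1))).
  apply (is_derive_comp_R (fun s : R => g (plus (P u v) (scal s k))) (fun s => s - v)); [|exact E].
  now replace (v - v) with 0 by ring. }
assert (E1 : forall u v, Derive (fun z => Derive (fun t => f (P z t)) v) u = ddir h (ddir k f) (P u v)).
{ intros u v. rewrite <- D1. apply Derive_ext. intros s. apply D2. }
assert (E2 : forall u v, Derive (fun z => Derive (fun t => f (P t z)) u) v = ddir k (ddir h f) (P u v)).
{ intros u v. rewrite <- D2. apply Derive_ext. intros s. apply D1. }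
rewrite <- P0, <- E1, <- E2.
apply (Schwarz (fun u v => f (P u v)) 0 0).
- revert L. apply locally_2d_impl, locally_2d_forall. intros u v Huv.
  split; [|split; [|split]].
  + exact (X1 f u v Hf Huv).
  + exact (X2 f u v Hf Huv).
  + apply ex_derive_ext with (fun z => ddir k f (P z v)).
    * intros t. symmetry. apply D2.
    * exact (X1 (ddir k f) u v (smooth_on_ddir U f k Hf) Huv).
  + apply ex_derive_ext with (fun z => ddir h f (P u z)).
    * intros t. symmetry. apply D1.
    * exact (X2 (ddir h f) u v (smooth_on_ddir U f h Hf) Huv).
- apply continuity_2d_pt_ext with (fun u v => ddir h (ddir k f) (P u v)).
  { intros u v. symmetry. apply E1. }
  apply (C (ddir h (ddir k f))); [now apply smooth_on_ddir, smooth_on_ddir|now rewrite P0].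
- apply continuity_2d_pt_ext with (fun u v => ddir k (ddir h f) (P u v)).
  { intros u v. symmetry. apply E2. }
  apply (C (ddir k (ddir h f))); [now apply smooth_on_ddir, smooth_on_ddir|now rewrite P0].
Qed.
End SmoothOn.

(** The derivative along any affinely parametrized line is a directional
    derivative; this is how partial derivatives enter. *)
Lemma line_Derive {V : NormedModule R_AbsRing} (f : V -> R) (c : R -> V) h r :
  (forall s, plus (c r) (scal s h) = c (r + s)) ->
  Derive (fun s => f (c s)) r = ddir h f (c r).
Proof.
intros Hc. unfold ddir, Derive. f_equal. apply Lim_ext. intros s.
rewrite !Hc. now rewrite !Rplus_0_l, Rplus_0_r.
Qed.

Lemma line_is_derive {V : NormedModule R_AbsRing} U (f : V -> R) (c : R -> V) h r :
  (forall s, plus (c r) (scal s h) = c (r + s)) -> smooth_on U f -> U (c r) ->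
  is_derive (fun s => f (c s)) r (ddir h f (c r)).
Proof.
intros Hc Hf Hr.
pose proof (smooth_on_is_derive U f (c r) h Hf Hr) as D.
apply (is_derive_ext (fun s => f (plus (c r) (scal (s - r) h)))).
{ intros s. rewrite Hc. do 2 f_equal. ring. }
assert (E : is_derive (fun s : R => s - r) r 1) by (auto_derive; auto; ring).
replace (ddir h f (c r)) with (scal 1 (ddir h f (c r))) by (apply (scal_one (V := R1))).
apply (is_derive_comp_R
  (fun s : R => f (plus (c r) (scal s h))) (fun s => s - r)); [|exact E].
now replace (r - r) with 0 by ring.
Qed.

Lemma smooth_on_affine {V W : NormedModule R_AbsRing} (U : W -> Prop) (f : W -> R)
  (A A0 : V -> W) :
  open U -> (forall x, continuous A x) ->
  (forall x h (s : R), A (plus x (scal s h)) = plus (A x) (scal s (A0 h))) ->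
  smooth_on U f -> smooth_on (fun x => U (A x)) (fun x => f (A x)).
Proof.
intros HU HA HA0 Hf.
apply (smooth_on_coind _ (fun g => exists f, smooth_on U f /\ g = fun x => f (A x))).
- intros x Hx. apply HA. now apply HU.
- intros g x [k [Hk ->]] Hx.
  apply (continuous_comp A k); [apply HA|now apply smooth_on_continuous with U].
- intros g h [k [Hk ->]]. exists (fun x => ddir (A0 h) k (A x)). split.
  + exists (ddir (A0 h) k). split; [now apply smooth_on_ddir|reflexivity].
  + intros x Hx. apply (is_derive_ext (fun s => k (plus (A x) (scal s (A0 h))))).
    * intros s. now rewrite HA0.
    * now apply smooth_on_is_derive with U.
- now exists f.
Qed.

Section Products.

Context {V W : NormedModule R_AbsRing}.
Notation VW := (prod_NormedModule R_AbsRing V W).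

Lemma smooth_on_fst (U : V -> Prop) (f : V -> R) : open U -> smooth_on U f ->
  smooth_on (V := VW) (fun z => U (fst z)) (fun z => f (fst z)).
Proof.
intros HU Hf. apply (smooth_on_affine (V := VW) U f fst fst); auto.
intros z. apply (continuous_fst (U := V)).
Qed.

Lemma smooth_on_snd (U : W -> Prop) (f : W -> R) : open U -> smooth_on U f ->
  smooth_on (V := VW) (fun z => U (snd z)) (fun z => f (snd z)).
Proof.
intros HU Hf. apply (smooth_on_affine (V := VW) U f snd snd); auto.
intros z. apply (continuous_snd (U := V)).
Qed.

Lemma smooth_on_slice (U : VW -> Prop) (f : VW -> R) (p : V) : open U ->
  smooth_on (V := VW) U f -> smooth_on (fun w => U (p, w)) (fun w => f (p, w)).
Proof.
intros HU Hf.
apply (smooth_on_affine (W := VW) U f (fun w : W => (p, w)) (fun h : W => (zero, h))); auto.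
- intros w. apply (continuous_pair (T := W) (A := V) (B := W) (fun _ => p) (fun w => w)).
  + apply continuous_const.
  + apply continuous_id.
- intros w h r. apply (f_equal2 pair); [|reflexivity].
  change (p = plus p (scal r zero)). now rewrite (scal_zero_r r), plus_zero_r.
Qed.

End Products.

(** * Integrals depending on parameters *)

(** The tube lemma, from the compactness of [[a, b]]. It gives both the
    uniformity needed for integrals with parameters and, applied twice, the
    uniform smallness of perturbations of a curve of diffeomorphisms. *)
Lemma tube {V : UniformSpace} (W : V * R -> Prop) (x : V) (a b : R) :
  (forall y, a <= y <= b -> locally (x, y) W) ->
  locally x (fun x' => forall y, a <= y <= b -> W (x', y)).
Proof.
intros H.
set (P := fun (y : R) (d : posreal) => forall z, ball (x, y) d z -> W z).
set (delta := fun y : R => match excluded_middle_informative (exists d, P y d) with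
  | left h => proj1_sig (constructive_indefinite_description _ h)
  | right _ => mkposreal 1 Rlt_0_1 end).
assert (Hd : forall y, a <= y <= b -> P y (delta y)).
{ intros y Hy. unfold delta. destruct (excluded_middle_informative _) as [h|h].
  - exact (proj2_sig (constructive_indefinite_description _ h)).
  - exfalso. apply h. destruct (H y Hy) as [d Hd']. now exists d. }
destruct (compactness_value_1d a b delta) as [d D].
exists d. intros x' Hx' y Hy.
apply Classical_Prop.NNPP. intros N. apply (D y Hy). intros [t [Ht [Hyt Hdt]]].
apply N. apply (Hd t Ht). split; simpl.
- apply ball_le with d; [exact Hdt|exact Hx'].
- change (Rabs (y - t) < delta t). exact Hyt.
Qed.

Section Param.

Context {V : NormedModule R_AbsRing}.
Notation VR := (prod_NormedModule R_AbsRing V R1).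
Variables (W : VR -> Prop) (a b : R).
Hypothesis HW : open W.
Hypothesis Hab : a <= b.

Lemma ex_RInt_param (F : VR -> R) x :
  (forall p, W p -> continuous F p) ->
  (forall y, a <= y <= b -> W (x, y)) -> ex_RInt (fun y => F (x, y)) a b.
Proof.
intros HF Hx. apply (ex_RInt_continuous (V := R_CompleteNormedModule)).
intros y Hy. rewrite Rmin_left, Rmax_right in Hy by exact Hab.
apply (continuous_comp_2 (V := V) (fun _ : R => x) (fun y : R => y) (fun u v => F (u, v))).
- apply continuous_const.
- apply continuous_id.
- apply continuous_ext with F; [now intros []|]. now apply HF, Hx.
Qed.

Lemma continuous_RInt_param (F : VR -> R) x :
  (forall p, W p -> continuous F p) ->
  (forall y, a <= y <= b -> W (x, y)) ->
  continuous (fun z => RInt (fun y => F (z, y)) a b) x.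
Proof.
intros HF Hx.
apply filterlim_locally. intros eps.
assert (He : 0 < eps / (2 * (b - a + 1))).
{ apply Rdiv_lt_0_compat; [apply eps|lra]. }
set (e := mkposreal _ He).
set (Q := fun p : VR => W p /\ Rabs (F p - F (x, snd p)) < 2 * e).
assert (T : locally x (fun x' => forall y, a <= y <= b -> Q (x', y))).
{ apply (tube (V := V) Q). intros y Hy. apply filter_and; [now apply HW, Hx|].
  assert (Hc : locally (x, y) (fun p => ball (F (x, y)) e (F p))).
  { apply (HF _ (Hx y Hy)). apply locally_ball. }
  assert (Hc' : locally (x, y) (fun p => ball (F (x, y)) e (F (x, snd p)))).
  { assert (C : continuous (T := VR) (U := VR) (fun p : VR => (x, snd p)) (x, y)).
    { apply (continuous_pair (T := VR) (A := V) (B := R_UniformSpace) (fun _ => x) snd).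
      - apply continuous_const.
      - apply (continuous_snd (U := V)). }
    exact (C _ Hc). }
  assert (tri : forall u v w : R, Rabs (u - w) < e -> Rabs (v - w) < e -> Rabs (u - v) < 2 * e).
  { intros u v w H1 H2. apply Rabs_def2 in H1. apply Rabs_def2 in H2. apply Rabs_def1; lra. }
  generalize (filter_and _ _ Hc Hc'). apply filter_imp. intros p [H1 H2].
  exact (tri _ _ _ H1 H2). }
revert T. apply filter_imp. intros x' Hx'.
change (Rabs (RInt (fun y => F (x', y)) a b - RInt (fun y => F (x, y)) a b) < eps).
assert (I1 : ex_RInt (fun y => F (x, y)) a b) by now apply ex_RInt_param.
assert (I2 : ex_RInt (fun y => F (x', y)) a b).
{ apply ex_RInt_param; [exact HF|]. intros y Hy. now apply Hx'. }
rewrite <- (RInt_minus (V := R_CompleteNormedModule)) by assumption.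
apply Rle_lt_trans with ((b - a) * (2 * e)).
- apply abs_RInt_le_const; [exact Hab|now apply (ex_RInt_minus (V := R1))|].
  intros y Hy. left. apply (Hx' y Hy).
- simpl. replace ((b - a) * (2 * (eps / (2 * (b - a + 1))))) with (eps * ((b - a) / (b - a + 1))) by (field; lra).
  rewrite <- (Rmult_1_r eps) at 2. apply Rmult_lt_compat_l; [apply eps|].
  apply Rmult_lt_reg_r with (b - a + 1); [lra|]. unfold Rdiv.
  rewrite Rmult_assoc, Rinv_l by lra. lra.
Qed.

Lemma is_derive_RInt_line (F : VR -> R) x h :
  smooth_on (V := VR) W F ->
  (forall y, a <= y <= b -> W (x, y)) ->
  is_derive (fun s => RInt (fun y => F (plus x (scal s h), y)) a b) 0
    (RInt (fun y => ddir (V := VR) (h, 0) F (x, y)) a b).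
Proof.
intros HF Hx.
assert (T : locally x (fun x' => forall y, a <= y <= b -> W (x', y))).
{ apply (tube (V := V) W). intros y Hy. now apply HW, Hx. }
assert (T' := locally_line _ x h T).
assert (C : forall u y s, plus (G := VR) (plus x (scal u h), y) (scal (V := VR) s (h, 0)) = (plus x (scal (u + s) h), y)).
{ intros u y s. apply (f_equal2 pair).
  - simpl. rewrite scal_plus. symmetry. apply plus_assoc.
  - simpl. change (y + s * 0 = y). ring. }
assert (E : forall u y, Derive (fun z => F (plus x (scal z h), y)) u =
   ddir (V := VR) (h, 0) F (plus x (scal u h), y)).
{ intros u y. apply (line_Derive (V := VR) F (fun z => (plus x (scal z h), y))). intros s. apply C. }
replace (RInt (fun y => ddir (V := VR) (h, 0) F (x, y)) a b) with (RInt (fun y => Derive (fun u => F (plus x (scal u h), y)) 0) a b).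
2:{ apply RInt_ext. intros y _. rewrite E. now rewrite line_0. }
apply (is_derive_RInt_param (fun s y => F (plus x (scal s h), y))).
- rewrite Rmin_left, Rmax_right by exact Hab. revert T'. apply filter_imp. intros s Hs y Hy.
  eexists.
  apply (line_is_derive (V := VR) W F (fun z => (plus x (scal z h), y)) (h, 0)); [intros; apply C|exact HF|].
  now apply Hs.
- rewrite Rmin_left, Rmax_right by exact Hab. intros y Hy.
  apply continuity_2d_pt_filterlim.
  change (continuous (fun z : R * R => Derive (fun z0 => F (plus x (scal z0 h), snd z)) (fst z)) (0, y)).
  apply continuous_ext with (fun z : R * R => ddir (V := VR) (h, 0) F (plus x (scal (fst z) h), snd z)).
  { intros z. symmetry. apply E. }
  apply (continuous_comp_2 (U := prod_UniformSpace R_UniformSpace R_UniformSpace) (V := V) (W := R_UniformSpace) (X := R_UniformSpace)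
     (fun z : R * R => plus x (scal (fst z) h)) (fun z => snd z)
     (fun u v => ddir (V := VR) (h, 0) F (u, v))).
  + apply (continuous_plus (U := prod_UniformSpace R_UniformSpace R_UniformSpace)
      (fun z : R * R => x) (fun z : R * R => scal (fst z) h)); [apply continuous_const|].
    apply (continuous_scal_l (U := prod_UniformSpace R_UniformSpace R_UniformSpace) (K := R_AbsRing) (fun z : R * R => fst z)).
    apply continuous_fst.
  + apply continuous_snd.
  + simpl. rewrite line_0.
    apply continuous_ext with (ddir (V := VR) (h, 0) F); [now intros []|].
    apply (smooth_on_continuous (V := VR) W); [now apply smooth_on_ddir|now apply Hx].
- revert T'. apply filter_imp. intros s Hs. apply ex_RInt_param; [|exact Hs].
  intros p Hp. now apply (smooth_on_continuous (V := VR) W).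
Qed.

(** The integrals of smooth functions form a stable class, by differentiation
    under the integral sign. *)
Lemma smooth_on_RInt (U : V -> Prop) (F : VR -> R) :
  open U -> (forall x y, U x -> a <= y <= b -> W (x, y)) ->
  smooth_on (V := VR) W F ->
  smooth_on U (fun x => RInt (fun y => F (x, y)) a b).
Proof.
intros HU Hx HF.
apply (smooth_on_coind U (fun g => exists G, smooth_on (V := VR) W G /\
   g = fun x => RInt (fun y => G (x, y)) a b)); [exact HU| | |now exists F].
- intros g x [G [HG ->]] Ux. apply continuous_RInt_param; [|auto].
  intros p Hp. now apply (smooth_on_continuous (V := VR) W).
- intros g h [G [HG ->]]. eexists. split.
  + exists (ddir (V := VR) (h, 0) G).
    split; [now apply smooth_on_ddir|reflexivity].
  + intros x Ux. apply is_derive_RInt_line; auto.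
Qed.

End Param.

(** * Partial derivatives *)

(** [D1] and [D2] are the derivatives in time and space of functions of [(t, x)];
    [P1], [P2], [P3] are those of functions of [(s, t, x)], where [s] is a
    deformation parameter. *)
Definition D1 (F : R * R -> R) (z : R * R) : R := Derive (fun s => F (s, snd z)) (fst z).
Definition D2 (F : R * R -> R) (z : R * R) : R := Derive (fun s => F (fst z, s)) (snd z).

Definition P1 (F : R * R * R -> R) (z : R * R * R) : R :=
  Derive (fun s => F (s, snd (fst z), snd z)) (fst (fst z)).
Definition P2 (F : R * R * R -> R) (z : R * R * R) : R :=
  Derive (fun s => F (fst (fst z), s, snd z)) (snd (fst z)).
Definition P3 (F : R * R * R -> R) (z : R * R * R) : R :=
  Derive (fun s => F (fst z, s)) (snd z).

Lemma pair_eq {A B : Type} (a a' : A) (b b' : B) : a = a' -> b = b' -> (a, b) = (a', b').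
Proof. now intros -> ->. Qed.

Lemma line_D1 (t x s : R) : plus (G := R2) (t, x) (scal (V := R2) s (1, 0)) = (t + s, x).
Proof. apply pair_eq; simpl; [change (t + s * 1 = t + s)|change (x + s * 0 = x)]; ring. Qed.

Lemma line_D2 (t x s : R) : plus (G := R2) (t, x) (scal (V := R2) s (0, 1)) = (t, x + s).
Proof. apply pair_eq; simpl; [change (t + s * 0 = t)|change (x + s * 1 = x + s)]; ring. Qed.

Lemma line_P1 (r t x s : R) : plus (G := R3) (r, t, x) (scal (V := R3) s (1, 0, 0)) = (r + s, t, x).
Proof. apply pair_eq; [apply line_D1|change (x + s * 0 = x); ring]. Qed.

Lemma line_P2 (r t x s : R) : plus (G := R3) (r, t, x) (scal (V := R3) s (0, 1, 0)) = (r, t + s, x).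
Proof. apply pair_eq; [apply line_D2|change (x + s * 0 = x); ring]. Qed.

Lemma line_P3 (r t x s : R) : plus (G := R3) (r, t, x) (scal (V := R3) s (0, 0, 1)) = (r, t, x + s).
Proof. apply pair_eq; [apply pair_eq|]; 
  [change (r + s * 0 = r)|change (t + s * 0 = t)|change (x + s * 1 = x + s)]; ring. Qed.

Lemma D1_ddir F z : D1 F z = ddir (V := R2) (1, 0) F z.
Proof. destruct z as [t x]. apply (line_Derive (V := R2) F (fun s => (s, x))). intros s. apply line_D1. Qed.

Lemma D2_ddir F z : D2 F z = ddir (V := R2) (0, 1) F z.
Proof. destruct z as [t x]. apply (line_Derive (V := R2) F (fun s => (t, s))). intros s. apply line_D2. Qed.

Lemma P1_ddir F z : P1 F z = ddir (V := R3) (1, 0, 0) F z.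
Proof. destruct z as [[r t] x]. apply (line_Derive (V := R3) F (fun s => (s, t, x))). intros s. apply line_P1. Qed.

Lemma P2_ddir F z : P2 F z = ddir (V := R3) (0, 1, 0) F z.
Proof. destruct z as [[r t] x]. apply (line_Derive (V := R3) F (fun s => (r, s, x))). intros s. apply line_P2. Qed.

Lemma P3_ddir F z : P3 F z = ddir (V := R3) (0, 0, 1) F z.
Proof. destruct z as [[r t] x]. apply (line_Derive (V := R3) F (fun s => (r, t, s))). intros s. apply line_P3. Qed.

Section Partial2.

Variable U : R2 -> Prop.
Hypothesis HU : open U.

Lemma smooth_on_D1 F : smooth_on (V := R2) U F -> smooth_on (V := R2) U (D1 F).
Proof.
intros HF. apply (smooth_on_ext (V := R2) U (ddir (V := R2) (1, 0) F)); [exact HU| |now apply smooth_on_ddir].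
intros z _. apply D1_ddir.
Qed.

Lemma smooth_on_D2 F : smooth_on (V := R2) U F -> smooth_on (V := R2) U (D2 F).
Proof.
intros HF. apply (smooth_on_ext (V := R2) U (ddir (V := R2) (0, 1) F)); [exact HU| |now apply smooth_on_ddir].
intros z _. apply D2_ddir.
Qed.

Lemma is_derive_D1 (F : R * R -> R) (t x : R) : smooth_on (V := R2) U F -> U (t, x) ->
  is_derive (fun s => F (s, x)) t (D1 F (t, x)).
Proof.
intros HF Hz. rewrite D1_ddir. apply (line_is_derive (V := R2) U F (fun s => (s, x))); auto.
intros s. apply line_D1.
Qed.

Lemma is_derive_D2 (F : R * R -> R) (t x : R) : smooth_on (V := R2) U F -> U (t, x) ->
  is_derive (fun s => F (t, s)) x (D2 F (t, x)).
Proof.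
intros HF Hz. rewrite D2_ddir. apply (line_is_derive (V := R2) U F (fun s => (t, s))); auto.
intros s. apply line_D2.
Qed.

Lemma ddir_ext h (F G : R * R -> R) z : (forall z, U z -> F z = G z) -> U z ->
  ddir (V := R2) h F z = ddir (V := R2) h G z.
Proof.
intros E Hz. unfold ddir. apply Derive_ext_loc.
generalize (locally_line (V := R2) U z h (HU z Hz)). apply filter_imp. intros s Hs. now apply E.
Qed.

Lemma D1_ext (F G : R * R -> R) z : (forall z, U z -> F z = G z) -> U z -> D1 F z = D1 G z.
Proof. intros E Hz. rewrite !D1_ddir. now apply ddir_ext. Qed.

Lemma D2_ext (F G : R * R -> R) z : (forall z, U z -> F z = G z) -> U z -> D2 F z = D2 G z.
Proof. intros E Hz. rewrite !D2_ddir. now apply ddir_ext. Qed.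

Lemma D1_D2 F z : smooth_on (V := R2) U F -> U z -> D1 (D2 F) z = D2 (D1 F) z.
Proof.
intros HF Hz. rewrite D1_ddir, D2_ddir.
rewrite (ddir_ext (1, 0) (D2 F) (ddir (V := R2) (0, 1) F)); [|intros; apply D2_ddir|exact Hz].
rewrite (ddir_ext (0, 1) (D1 F) (ddir (V := R2) (1, 0) F)); [|intros; apply D1_ddir|exact Hz].
now apply (ddir_comm (V := R2) U).
Qed.

Lemma is_derive_curve (F : R * R -> R) (c1 c2 : R -> R) (t d1 d2 : R) :
  smooth_on (V := R2) U F -> U (c1 t, c2 t) -> is_derive c1 t d1 -> is_derive c2 t d2 ->
  is_derive (fun s => F (c1 s, c2 s)) t (D1 F (c1 t, c2 t) * d1 + D2 F (c1 t, c2 t) * d2).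
Proof.
intros HF Hz H1 H2. apply is_derive_Reals.
apply (derivable_pt_lim_comp_2d (fun a b => F (a, b))).
2, 3: now apply is_derive_Reals.
apply filterdiff_differentiable_pt_lim.
apply (is_derive_filterdiff (fun a b => F (a, b)) (c1 t) (c2 t) (fun a b => D1 F (a, b))).
- generalize (HU _ Hz). apply filter_imp. intros [a b] Hab. now apply is_derive_D1.
- now apply is_derive_D2.
- apply continuous_ext with (D1 F); [now intros []|].
  apply (smooth_on_continuous (V := R2) U); [now apply smooth_on_D1|exact Hz].
Qed.

End Partial2.

Section Partial3.

Variable U : R3 -> Prop.
Hypothesis HU : open U.

Lemma smooth_on_slice3 (F : R * R * R -> R) (s : R) : smooth_on (V := R3) U F ->
  smooth_on (V := R2) (fun z => U (s, fst z, snd z)) (fun z => F (s, fst z, snd z)).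
Proof.
intros HF.
apply (smooth_on_affine (V := R2) (W := R3) U F (fun z => (s, fst z, snd z)) (fun h => (0, fst h, snd h))); auto.
- intros z. apply (continuous_pair (T := R2) (A := R2) (B := R1) (fun z => (s, fst z)) snd).
  + apply (continuous_pair (T := R2) (A := R1) (B := R1) (fun _ => s) fst).
    * apply continuous_const.
    * apply (continuous_fst (U := R1)).
  + apply (continuous_snd (U := R1)).
- intros z h r. apply pair_eq; [apply pair_eq|]; try reflexivity.
  change (s = s + r * 0). now rewrite Rmult_0_r, Rplus_0_r.
Qed.

Lemma smooth_on_P3 F : smooth_on (V := R3) U F -> smooth_on (V := R3) U (P3 F).
Proof.
intros HF. apply (smooth_on_ext (V := R3) U (ddir (V := R3) (0, 0, 1) F)); [exact HU| |now apply smooth_on_ddir].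
intros z _. apply P3_ddir.
Qed.

Lemma is_derive_P1 (F : R * R * R -> R) (r t x : R) : smooth_on (V := R3) U F -> U (r, t, x) ->
  is_derive (fun s => F (s, t, x)) r (P1 F (r, t, x)).
Proof.
intros HF Hz. rewrite P1_ddir. apply (line_is_derive (V := R3) U F (fun s => (s, t, x))); auto.
intros s. apply line_P1.
Qed.

Lemma ddir3_ext h (F G : R * R * R -> R) z : (forall z, U z -> F z = G z) -> U z ->
  ddir (V := R3) h F z = ddir (V := R3) h G z.
Proof.
intros E Hz. unfold ddir. apply Derive_ext_loc.
generalize (locally_line (V := R3) U z h (HU z Hz)). apply filter_imp. intros s Hs. now apply E.
Qed.

Lemma P1_P2 F z : smooth_on (V := R3) U F -> U z -> P1 (P2 F) z = P2 (P1 F) z.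
Proof.
intros HF Hz. rewrite P1_ddir, P2_ddir.
rewrite (ddir3_ext (1, 0, 0) (P2 F) (ddir (V := R3) (0, 1, 0) F)); [|intros; apply P2_ddir|exact Hz].
rewrite (ddir3_ext (0, 1, 0) (P1 F) (ddir (V := R3) (1, 0, 0) F)); [|intros; apply P1_ddir|exact Hz].
now apply (ddir_comm (V := R3) U).
Qed.

Lemma P1_P3 F z : smooth_on (V := R3) U F -> U z -> P1 (P3 F) z = P3 (P1 F) z.
Proof.
intros HF Hz. rewrite P1_ddir, P3_ddir.
rewrite (ddir3_ext (1, 0, 0) (P3 F) (ddir (V := R3) (0, 0, 1) F)); [|intros; apply P3_ddir|exact Hz].
rewrite (ddir3_ext (0, 0, 1) (P1 F) (ddir (V := R3) (1, 0, 0) F)); [|intros; apply P1_ddir|exact Hz].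
now apply (ddir_comm (V := R3) U).
Qed.

End Partial3.

(** * Smooth functions of one variable *)

Lemma ddir_1 (f : R -> R) (x : R) : ddir (V := R1) 1 f x = Derive f x.
Proof.
symmetry. apply (line_Derive (V := R1) f (fun s => s)).
intros s. simpl. change (x + s * 1 = x + s :> R). apply (f_equal (Rplus x)), Rmult_1_r.
Qed.

Lemma smooth_on_Derive (U : R -> Prop) f : open U -> smooth_on (V := R1) U f ->
  smooth_on (V := R1) U (Derive f).
Proof.
intros HU Hf. apply (smooth_on_ext (V := R1) U (ddir (V := R1) 1 f)); [exact HU| |now apply smooth_on_ddir].
intros x _. now rewrite ddir_1.
Qed.

Lemma smooth_on_Derive_n (U : R -> Prop) f n : open U -> smooth_on (V := R1) U f ->
  smooth_on (V := R1) U (Derive_n f n).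
Proof. intros HU Hf. induction n as [|n IH]; [exact Hf|now apply (smooth_on_Derive U)]. Qed.

Lemma smooth_on_ex_derive (U : R -> Prop) (f : R -> R) x : smooth_on (V := R1) U f -> U x ->
  ex_derive f x.
Proof.
intros Hf Hx. exists (ddir (V := R1) 1 f x).
apply (line_is_derive (V := R1) U f (fun s => s)); auto.
intros s. simpl. change (x + s * 1 = x + s :> R). apply (f_equal (Rplus x)), Rmult_1_r.
Qed.

Lemma smooth_on_ex_derive_n (U : R -> Prop) (f : R -> R) n x : open U ->
  smooth_on (V := R1) U f -> U x -> ex_derive_n f n x.
Proof.
intros HU Hf Hx. destruct n as [|n]; [exact I|].
apply (smooth_on_ex_derive U); [now apply smooth_on_Derive_n|exact Hx].
Qed.

Lemma ex_derive_n_smooth_on (U : R -> Prop) (f : R -> R) : open U ->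
  (forall n x, U x -> ex_derive_n f n x) -> smooth_on (V := R1) U f.
Proof.
intros HU Hf.
apply (smooth_on_coind (V := R1) U
  (fun g => exists n c, forall x, g x = c * Derive_n f n x)); [exact HU| | |].
- intros g x [n [c E]] Hx. apply continuous_ext with (fun x => c * Derive_n f n x); [now intros; rewrite E|].
  apply (continuous_scal_r (V := R1) c (Derive_n f n)).
  apply (ex_derive_continuous_R). now apply (Hf (S n)).
- intros g h [n [c E]]. exists (fun x => (c * h) * Derive_n f (S n) x). split; [now exists (S n), (c * h)|].
  intros x Hx. pose proof (Derive_correct _ _ (Hf (S n) x Hx)) as D.
  apply (is_derive_ext (fun s => c * Derive_n f n (x + s * h))); [now intros; rewrite E|].
  assert (L : is_derive (fun s : R => x + s * h) 0 h) by (auto_derive; auto; apply Rmult_1_l).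
  assert (D' : is_derive (Derive_n f n) (x + 0 * h) (Derive_n f (S n) x)) by now rewrite Rmult_0_l, Rplus_0_r.
  pose proof (is_derive_scal _ _ c _ (is_derive_comp_R _ _ 0 _ _ D' L)) as K.
  rewrite Rmult_assoc. exact K.
- exists 0%nat, 1. intros x. simpl. now rewrite Rmult_1_l.
Qed.

Lemma open_time_interval alpha beta : open (time_interval alpha beta).
Proof.
apply (open_and (fun t : R => Rbar_lt alpha t) (fun t : R => Rbar_lt t beta)).
- destruct alpha as [a| |]; simpl; [apply open_gt|apply open_false|apply open_true].
- destruct beta as [b| |]; simpl; [apply open_lt|apply open_true|apply open_false].
Qed.

Lemma smooth_on_interval_iff alpha beta f : smooth_on_interval alpha beta f <->
  smooth_on (V := R1) (time_interval alpha beta) f.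
Proof.
split; intros Hf.
- apply ex_derive_n_smooth_on; [apply open_time_interval|exact Hf].
- intros n t Ht. apply (smooth_on_ex_derive_n (time_interval alpha beta)); auto. apply open_time_interval.
Qed.

Lemma smooth_iff f : smooth f <-> smooth_on (V := R1) (fun _ => True) f.
Proof.
split; intros Hf.
- apply ex_derive_n_smooth_on; [apply open_true|]. intros; apply Hf.
- intros n t. apply (smooth_on_ex_derive_n (fun _ => True)); auto. apply open_true.
Qed.

(** * Families of functions on the circle *)

Definition cyl {P : Type} (U : P -> Prop) (z : P * R) : Prop := U (fst z).

Lemma open_cyl {P : NormedModule R_AbsRing} (U : P -> Prop) : open U ->
  open (T := prod_NormedModule R_AbsRing P R1) (cyl U).
Proof.
intros HU. apply (open_comp (T := prod_NormedModule R_AbsRing P R1) fst U); [|exact HU].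
intros z _. apply (continuous_fst (U := P) (V := R_UniformSpace)).
Qed.

(** Joint smoothness in the parameter and the space variable, so that
    parameters can be differentiated under integrals over the circle. *)
Definition circle_family {P : NormedModule R_AbsRing} (U : P -> Prop) (F : P * R -> R) : Prop :=
  smooth_on (V := prod_NormedModule R_AbsRing P R1) (cyl U) F /\
  forall p x, U p -> F (p, x + 2 * PI) = F (p, x).

Section Family.

Context {P : NormedModule R_AbsRing}.
Notation PR := (prod_NormedModule R_AbsRing P R1).
Variable U : P -> Prop.
Hypothesis HU : open U.

Lemma circle_family_ddir (F : P * R -> R) h : circle_family U F -> circle_family U (ddir (V := PR) h F).
Proof.
intros [HF PF]. split; [now apply smooth_on_ddir|].
intros p x Hp. unfold ddir. apply Derive_ext_loc.
generalize (locally_line (V := P) U p (fst h) (HU p Hp)). apply filter_imp. intros s Hs.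
destruct h as [h k].
change (F (plus p (scal s h), (x + 2 * PI) + s * k) = F (plus p (scal s h), x + s * k)).
rewrite <- (PF _ (x + s * k)) by exact Hs. f_equal. apply pair_eq; [reflexivity|].
rewrite !Rplus_assoc. f_equal. apply Rplus_comm.
Qed.

Lemma circle_family_ext F G : (forall p x, U p -> G (p, x) = F (p, x)) ->
  circle_family U F -> circle_family U G.
Proof.
intros E [HF PF]. split.
- apply (smooth_on_ext (V := PR) (cyl U) F); [now apply open_cyl| |exact HF].
  intros [p x] Hp. now apply E.
- intros p x Hp. now rewrite !E, PF.
Qed.

Lemma circle_family_alg F : smooth_alg (V := PR) (cyl U) F ->
  (forall p x, U p -> F (p, x + 2 * PI) = F (p, x)) -> circle_family U F.
Proof. intros HF PF. split; [|exact PF]. apply (smooth_alg_smooth (V := PR)); [now apply open_cyl|exact HF]. Qed.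

Lemma circle_family_int F : circle_family U F ->
  smooth_on U (fun p => circle_int (fun x => F (p, x))).
Proof.
intros [HF _]. apply (smooth_on_RInt (V := P) (cyl U)); [now apply open_cyl| |exact HU| |exact HF].
- generalize PI_RGT_0. lra.
- intros p x Hp _. exact Hp.
Qed.

End Family.

(** * Integrals over the circle *)

Lemma ex_RInt_cont (f : R -> R) a b : (forall x, continuous f x) -> ex_RInt f a b.
Proof. intros Hf. apply (ex_RInt_continuous (V := R_CompleteNormedModule)). auto. Qed.

Lemma derive_0_const (f : R -> R) : (forall x, is_derive f x 0) -> forall x y, f x = f y.
Proof.
intros Hf x y. destruct (Rtotal_order x y) as [H|[->|H]]; [|reflexivity|symmetry];
  apply (eq_is_derive f); auto; intros; apply Hf.
Qed.

Lemma circle_int_ext f g : (forall x, f x = g x) -> circle_int f = circle_int g.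
Proof. intros E. apply RInt_ext. auto. Qed.

Lemma circle_int_plus f g : (forall x, continuous f x) -> (forall x, continuous g x) ->
  circle_int (fun x => f x + g x) = circle_int f + circle_int g.
Proof. intros Hf Hg. apply (RInt_plus (V := R_CompleteNormedModule)); now apply ex_RInt_cont. Qed.

Lemma circle_int_scal c f : (forall x, continuous f x) ->
  circle_int (fun x => c * f x) = c * circle_int f.
Proof. intros Hf. apply (RInt_scal (V := R_CompleteNormedModule)). now apply ex_RInt_cont. Qed.

Lemma circle_int_shift f c : periodic f -> (forall x, continuous f x) ->
  RInt f c (c + 2 * PI) = circle_int f.
Proof.
intros Pf Cf.
assert (D : forall c, is_derive (fun c => RInt f c (c + 2 * PI)) c 0).
{ clear c. intros c.
  assert (K : is_derive (fun c => RInt f c (c + 2 * PI)) c (minus (scal 1 (f (c + 2 * PI))) (scal 1 (f c)))).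
  { apply (is_derive_RInt_bound_comp f (RInt f) (fun c => c) (fun c => c + 2 * PI)); auto.
    - apply filter_forall. intros [u w]. simpl. apply (RInt_correct (V := R_CompleteNormedModule)). now apply ex_RInt_cont.
    - apply (is_derive_id (K := R_AbsRing)).
    - auto_derive; auto. }
  rewrite Pf in K. now rewrite minus_eq_zero in K. }
generalize (derive_0_const _ D c 0). unfold circle_int. now rewrite Rplus_0_l.
Qed.

Lemma circle_int_derive f f' : periodic f -> (forall x, is_derive f x (f' x)) ->
  (forall x, continuous f' x) -> circle_int f' = 0.
Proof.
intros Pf Df Cf. unfold circle_int.
rewrite (is_RInt_unique (V := R_CompleteNormedModule) f' 0 (2 * PI) (minus (f (2 * PI)) (f 0))).
- generalize (Pf 0). rewrite Rplus_0_l. intros ->. apply (minus_eq_zero (G := R_AbelianGroup)).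
- apply (is_RInt_derive (V := R_CompleteNormedModule)); auto.
Qed.

Lemma circle_int_by_parts f f' g g' : periodic f -> periodic g ->
  (forall x, is_derive f x (f' x)) -> (forall x, is_derive g x (g' x)) ->
  (forall x, continuous f' x) -> (forall x, continuous g' x) ->
  circle_int (fun x => f' x * g x) = - circle_int (fun x => f x * g' x).
Proof.
intros Pf Pg Df Dg Cf' Cg'.
assert (Cf : forall x, continuous f x) by (intros x; apply (ex_derive_continuous_R); eexists; apply Df).
assert (Cg : forall x, continuous g x) by (intros x; apply (ex_derive_continuous_R); eexists; apply Dg).
assert (K : circle_int (fun x => f' x * g x + f x * g' x) = 0).
{ apply (circle_int_derive (fun x => f x * g x)).
  - intros x. now rewrite Pf, Pg.
  - intros x. apply (is_derive_mult (K := R_AbsRing) f g); auto. exact Rmult_comm.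
  - intros x. apply (continuous_plus (V := R1)); now apply (continuous_mult_R). }
rewrite circle_int_plus in K.
- lra.
- intros x. now apply (continuous_mult_R).
- intros x. now apply (continuous_mult_R).
Qed.

(** A positive value at [x] would make the integral over a small interval
    around [x] positive. *)
Lemma RInt_nonneg_zero f a b : (forall x, a <= x <= b -> continuous f x) -> (forall x, a < x < b -> 0 <= f x) ->
  RInt f a b = 0 -> forall x, a < x < b -> f x = 0.
Proof.
intros Cf Pf If x Hx.
destruct (Rle_lt_or_eq_dec 0 (f x) (Pf x Hx)) as [Hp|E]; [exfalso|now symmetry].
assert (L : locally x (fun y => 0 < f y)).
{ apply (Cf x); [lra|]. apply (open_gt 0). exact Hp. }
destruct L as [d Hd].
set (e := Rmin (d / 2) (Rmin ((x - a) / 2) ((b - x) / 2))).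
assert (He : 0 < e) by (unfold e; repeat apply Rmin_glb_lt; [generalize (cond_pos d)| |]; lra).
assert (E1 : e <= d / 2) by apply Rmin_l.
assert (E2 : e <= (x - a) / 2) by (eapply Rle_trans; [apply Rmin_r|apply Rmin_l]).
assert (E3 : e <= (b - x) / 2) by (eapply Rle_trans; [apply Rmin_r|apply Rmin_r]).
assert (X : forall u w, a <= u -> u <= w -> w <= b -> ex_RInt f u w).
{ intros u w Hu Huw Hw. apply (ex_RInt_continuous (V := R_CompleteNormedModule)). intros y.
  rewrite Rmin_left, Rmax_right by lra. intros. apply Cf. lra. }
assert (C1 : RInt f a (x - e) + RInt f (x - e) (x + e) = RInt f a (x + e))
  by (apply (RInt_Chasles (V := R_CompleteNormedModule)); apply X; lra).
assert (C2 : RInt f a (x + e) + RInt f (x + e) b = RInt f a b)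
  by (apply (RInt_Chasles (V := R_CompleteNormedModule)); apply X; lra).
assert (P1 : 0 <= RInt f a (x - e)) by (apply RInt_ge_0; [lra|apply X; lra|intros; apply Pf; lra]).
assert (P3 : 0 <= RInt f (x + e) b) by (apply RInt_ge_0; [lra|apply X; lra|intros; apply Pf; lra]).
assert (P2 : 0 < RInt f (x - e) (x + e)).
{ apply RInt_gt_0; [lra| |intros; apply Cf; lra].
  intros y Hy. apply Hd. change (Rabs (y - x) < d). apply Rabs_def1; generalize (cond_pos d); lra. }
lra.
Qed.

(** The fundamental lemma of the calculus of variations, for a smooth residue
    that can be used as its own test function. Shifting the period makes [x] an
    interior point. *)
Lemma circle_sq_zero f : periodic f -> (forall x, continuous f x) ->
  circle_int (fun x => f x * f x) = 0 -> forall x, f x = 0.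
Proof.
intros Pf Cf If x. generalize PI_RGT_0; intros Hpi.
assert (C2 : forall x, continuous (fun x => f x * f x) x) by (intros; now apply (continuous_mult_R)).
assert (K : f x * f x = 0).
{ apply (RInt_nonneg_zero (fun x => f x * f x) (x - PI) (x - PI + 2 * PI)).
  - auto.
  - intros. apply Rle_0_sqr.
  - rewrite circle_int_shift; auto. intros y. now rewrite Pf.
  - lra. }
now apply Rsqr_0_uniq.
Qed.

Lemma periodic_derive_const f c : periodic f -> (forall x, is_derive f x c) -> c = 0.
Proof.
intros Pf Df.
assert (K : circle_int (fun _ => c) = 0) by (apply (circle_int_derive f); auto; intros; apply continuous_const).
unfold circle_int in K. rewrite RInt_const in K. change ((2 * PI - 0) * c = 0) in K.
generalize PI_RGT_0; intros Hpi. apply Rmult_integral in K. destruct K; [lra|assumption].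
Qed.

(** * Diffeomorphisms of the circle *)

Section Diffeo.

Variable phi : R -> R.
Hypothesis Hphi : diffeo phi.

Let psi := diffeo_inv phi.

Lemma diffeo_is_derive x : is_derive phi x (Derive phi x).
Proof. apply Derive_correct. apply (proj1 Hphi 1%nat x). Qed.

Lemma diffeo_continuous x : continuous phi x.
Proof. apply (ex_derive_continuous_R). eexists. apply diffeo_is_derive. Qed.

Lemma diffeo_increasing x y : x < y -> phi x < phi y.
Proof.
intros H. apply (incr_function phi m_infty p_infty (Derive phi)); simpl; auto.
- intros z _ _. apply diffeo_is_derive.
- intros z _ _. apply (proj2 (proj2 Hphi)).
Qed.

Lemma diffeo_le x y : phi x <= phi y -> x <= y.
Proof. intros H. apply Rnot_lt_le. intros N. apply diffeo_increasing in N. lra. Qed.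

Lemma diffeo_inv_l x : psi (phi x) = x.
Proof.
unfold psi, diffeo_inv. rewrite (is_lub_Rbar_unique _ (Finite x)); [reflexivity|].
split.
- intros y Hy. now apply diffeo_le.
- intros b Hb. apply Hb. apply Rle_refl.
Qed.

Lemma diffeo_iter n x : phi (x + 2 * PI * INR n) = phi x + 2 * PI * INR n.
Proof.
induction n as [|n IH].
- simpl. now rewrite Rmult_0_r, !Rplus_0_r.
- rewrite S_INR. replace (x + 2 * PI * (INR n + 1)) with (x + 2 * PI * INR n + 2 * PI) by ring.
  rewrite (proj1 (proj2 Hphi)), IH. ring.
Qed.

(** The displacement [phi x - x] is bounded, so the intermediate value theorem
    applies on a long enough interval. *)
Lemma diffeo_surjective y : exists x, phi x = y.
Proof.
generalize PI_RGT_0; intros Hpi.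
assert (H2 : 0 < 2 * PI) by lra.
destruct (nfloor_ex (Rabs (y - phi 0) / (2 * PI))) as [n [_ Hn]].
{ apply Rdiv_le_0_compat; [apply Rabs_pos|exact H2]. }
set (m := S n).
assert (Hm : Rabs (y - phi 0) < 2 * PI * INR m).
{ unfold m. rewrite S_INR. apply (Rmult_lt_compat_l (2 * PI)) in Hn; [|exact H2].
  replace (2 * PI * (Rabs (y - phi 0) / (2 * PI))) with (Rabs (y - phi 0)) in Hn by (field; lra).
  exact Hn. }
pose proof (diffeo_iter m 0) as E1. rewrite Rplus_0_l in E1.
pose proof (diffeo_iter m (- (2 * PI * INR m))) as E2. rewrite Rplus_opp_l in E2.
apply Rabs_def2 in Hm.
destruct (IVT_gen phi (- (2 * PI * INR m)) (2 * PI * INR m) y) as [x [_ Hx]].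
- intros x. apply continuity_pt_filterlim. apply diffeo_continuous.
- split.
  + eapply Rle_trans; [apply Rmin_l|]. lra.
  + eapply Rle_trans; [|apply Rmax_r]. lra.
- now exists x.
Qed.

Lemma diffeo_inv_r y : phi (psi y) = y.
Proof. destruct (diffeo_surjective y) as [x <-]. now rewrite diffeo_inv_l. Qed.

Lemma diffeo_inv_shift y : psi (y + 2 * PI) = psi y + 2 * PI.
Proof.
rewrite <- (diffeo_inv_r y) at 1. rewrite <- (proj1 (proj2 Hphi)). apply diffeo_inv_l.
Qed.

Lemma diffeo_inv_continuous y : continuous psi y.
Proof.
apply filterlim_locally. intros eps.
set (x := psi y).
assert (L1 : phi (x - eps) < y).
{ rewrite <- (diffeo_inv_r y). apply diffeo_increasing. fold x. generalize (cond_pos eps). lra. }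
assert (L2 : y < phi (x + eps)).
{ rewrite <- (diffeo_inv_r y) at 1. apply diffeo_increasing. fold x. generalize (cond_pos eps). lra. }
assert (H : locally y (fun z => phi (x - eps) < z /\ z < phi (x + eps))).
{ apply filter_and; [apply (open_gt _ y L1)|apply (open_lt _ y L2)]. }
revert H. apply filter_imp. intros z [H1 H2].
change (Rabs (psi z - x) < eps).
rewrite <- (diffeo_inv_r z) in H1, H2.
assert (x - eps < psi z) by (apply Rnot_le_lt; intros [N|N]; [apply diffeo_increasing in N|rewrite N in *]; lra).
assert (psi z < x + eps) by (apply Rnot_le_lt; intros [N|N]; [apply diffeo_increasing in N|rewrite N in *]; lra).
apply Rabs_def1; lra.
Qed.

Lemma diffeo_inv_is_derive y : is_derive psi y (/ Derive phi (psi y)).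
Proof.
assert (Prf : forall a, psi (y - 1) <= a <= psi (y + 1) -> derivable_pt phi a).
{ intros a _. exists (Derive phi a). apply is_derive_Reals. apply diffeo_is_derive. }
assert (I : psi (y - 1) <= psi y <= psi (y + 1)).
{ split; apply diffeo_le; rewrite !diffeo_inv_r; lra. }
assert (E : derive_pt phi (psi y) (Prf (psi y) I) = Derive phi (psi y)).
{ apply derive_pt_eq. apply is_derive_Reals. apply diffeo_is_derive. }
apply is_derive_Reals. rewrite <- E.
replace (/ _) with (1 / derive_pt phi (psi y) (Prf (psi y) I)) by (unfold Rdiv; ring).
apply Ranalysis5.derivable_pt_lim_recip_interv with (lb := y - 1) (ub := y + 1).
- apply continuity_pt_filterlim. apply diffeo_inv_continuous.
- lra.
- lra.
- intros z _. unfold comp, id. apply diffeo_inv_r.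
- rewrite E. apply Rgt_not_eq. apply (proj2 (proj2 Hphi)).
Qed.

Lemma diffeo_Derive_continuous x : continuous (Derive phi) x.
Proof. apply (ex_derive_continuous_R). apply (proj1 Hphi 2%nat x). Qed.

Lemma circle_int_change_of_variables h : periodic h -> (forall x, continuous h x) ->
  circle_int (fun x => h (psi x)) = circle_int (fun y => h y * Derive phi y).
Proof.
intros Ph Ch.
assert (P' : periodic (Derive phi)).
{ intros x. rewrite <- (Derive_ext (fun s => phi (s + 2 * PI) - 2 * PI) phi x).
  2:{ intros s. rewrite (proj1 (proj2 Hphi)). ring. }
  symmetry. apply is_derive_unique.
  assert (D : is_derive (fun s => s + 2 * PI) x 1) by (auto_derive; auto).
  pose proof (is_derive_comp_R phi _ x _ _ (diffeo_is_derive (x + 2 * PI)) D) as D'.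
  pose proof (is_derive_minus (V := R1) _ (fun _ : R => 2 * PI) _ _ _ D' (is_derive_const _ _)) as D2.
  replace (Derive phi (x + 2 * PI)) with (minus (scal 1 (Derive phi (x + 2 * PI))) zero); [exact D2|].
  rewrite minus_zero_r. apply (scal_one (V := R1)). }
assert (C : forall y, continuous (fun y => h y * Derive phi y) y).
{ intros y. apply (continuous_mult_R); [apply Ch|apply diffeo_Derive_continuous]. }
rewrite <- (circle_int_shift (fun y => h y * Derive phi y) (psi 0)); [|intros y; now rewrite Ph, P'|exact C].
rewrite <- diffeo_inv_shift, Rplus_0_l. unfold circle_int.
transitivity (RInt (fun x => h (psi x)) (phi (psi 0)) (phi (psi (2 * PI)))); [now rewrite !diffeo_inv_r|].
rewrite <- (RInt_comp (V := R_CompleteNormedModule) (fun x => h (psi x)) phi (Derive phi)).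
- apply RInt_ext. intros y _. rewrite diffeo_inv_l. apply Rmult_comm.
- intros y _. apply (continuous_comp psi h); [apply diffeo_inv_continuous|apply Ch].
- intros y _. split; [apply diffeo_is_derive|apply diffeo_Derive_continuous].
Qed.

End Diffeo.

(** * Operations on families of functions *)

Section FamilyAlgebra.

Context {P : NormedModule R_AbsRing}.
Notation PR := (prod_NormedModule R_AbsRing P R1).
Variable U : P -> Prop.
Hypothesis HU : open U.

Lemma circle_family_plus F G : circle_family U F -> circle_family U G ->
  circle_family U (fun z => F z + G z).
Proof.
intros [HF PF] [HG PG]. apply circle_family_alg; [exact HU| |].
- apply (sa_plus (V := PR)); now apply (smooth_on_alg (V := PR)).
- intros p x Hp. now rewrite PF, PG.
Qed.

Lemma circle_family_mult F G : circle_family U F -> circle_family U G ->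
  circle_family U (fun z => F z * G z).
Proof.
intros [HF PF] [HG PG]. apply circle_family_alg; [exact HU| |].
- apply (sa_mult (V := PR)); now apply (smooth_on_alg (V := PR)).
- intros p x Hp. now rewrite PF, PG.
Qed.

Lemma circle_family_const c : circle_family U (fun _ => c).
Proof.
apply circle_family_alg; [exact HU| |reflexivity]. apply (sa_const (V := PR)).
Qed.

Lemma circle_family_inv F : circle_family U F -> (forall p x, U p -> F (p, x) <> 0) ->
  circle_family U (fun z => / F z).
Proof.
intros [HF PF] N. apply circle_family_alg; [exact HU| |].
- apply (sa_inv (V := PR)); [now apply (smooth_on_alg (V := PR))|]. intros [p x] Hp. now apply N.
- intros p x Hp. now rewrite PF.
Qed.

Lemma circle_family_ln F : circle_family U F -> (forall p x, U p -> 0 < F (p, x)) ->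
  circle_family U (fun z => ln (F z)).
Proof.
intros [HF PF] N. apply circle_family_alg; [exact HU| |].
- apply (sa_ln (V := PR)); [now apply (smooth_on_alg (V := PR))|]. intros [p x] Hp. now apply N.
- intros p x Hp. now rewrite PF.
Qed.

Lemma circle_family_param f : smooth_on U f -> circle_family U (fun z => f (fst z)).
Proof.
intros Hf. split; [|reflexivity].
now apply (smooth_on_fst (V := P) (W := R1)).
Qed.

Lemma circle_family_slice F p : circle_family U F -> U p ->
  smooth_on (V := R1) (fun _ => True) (fun x => F (p, x)).
Proof.
intros [HF _] Hp.
apply (smooth_on_sub (V := R1) (fun x => cyl U (p, x))); [now intros|].
apply (smooth_on_slice (V := P) (W := R1)); [now apply open_cyl|exact HF].
Qed.

Lemma circle_family_continuous F p x : circle_family U F -> U p -> continuous (fun x => F (p, x)) x.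
Proof.
intros HF Hp. apply (smooth_on_continuous (V := R1) (fun _ => True) (fun x => F (p, x))); [|exact I].
now apply circle_family_slice.
Qed.

Lemma circle_family_periodic F p : circle_family U F -> U p -> periodic (fun x => F (p, x)).
Proof. intros [_ PF] Hp x. now apply PF. Qed.

End FamilyAlgebra.

Lemma RInt_is_derive_D1 (W : R2 -> Prop) (F : R * R -> R) (a b t : R) :
  open W -> a <= b -> smooth_on (V := R2) W F -> (forall y, a <= y <= b -> W (t, y)) ->
  is_derive (fun s => RInt (fun y => F (s, y)) a b) t (RInt (fun y => D1 F (t, y)) a b).
Proof.
intros HW Hab HF Ht.
pose proof (is_derive_RInt_line (V := R1) W a b HW Hab F t 1 HF Ht) as K.
rewrite (RInt_ext _ (fun y => ddir (V := R2) (1, 0) F (t, y))) by (intros; apply D1_ddir).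
apply (is_derive_ext (fun s => RInt (fun y => F (t + (s - t) * 1, y)) a b)).
{ intros s. apply RInt_ext. intros y _. now rewrite Rmult_1_r, Rplus_minus. }
set (G := fun s : R => RInt (fun y => F (t + s * 1, y)) a b).
assert (E : is_derive (fun s : R => s - t) t 1) by (auto_derive; auto; ring).
rewrite <- (scal_one (V := R1) (RInt _ _ _)).
apply (is_derive_comp_R G (fun s => s - t)); [|exact E].
rewrite Rminus_diag. exact K.
Qed.

Section Family1.

Variable J : R -> Prop.
Hypothesis HJ : open J.
Implicit Types F G : R * R -> R.
Notation fam := (circle_family (P := R1) J).

Lemma fam_D1 F : fam F -> fam (D1 F).
Proof.
intros HF. apply (circle_family_ext (P := R1) J HJ (ddir (V := R2) (1, 0) F)).
- intros. apply D1_ddir.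
- now apply (circle_family_ddir (P := R1)).
Qed.

Lemma fam_D2 F : fam F -> fam (D2 F).
Proof.
intros HF. apply (circle_family_ext (P := R1) J HJ (ddir (V := R2) (0, 1) F)).
- intros. apply D2_ddir.
- now apply (circle_family_ddir (P := R1)).
Qed.

Lemma fam_is_D1 F t x : fam F -> J t -> is_derive (fun s => F (s, x)) t (D1 F (t, x)).
Proof. intros [HF _] Ht. now apply (is_derive_D1 (cyl J)). Qed.

Lemma fam_is_D2 F t x : fam F -> J t -> is_derive (fun s => F (t, s)) x (D2 F (t, x)).
Proof. intros [HF _] Ht. now apply (is_derive_D2 (cyl J)). Qed.

Lemma fam_D1_D2 F z : fam F -> J (fst z) -> D1 (D2 F) z = D2 (D1 F) z.
Proof. intros [HF _] Ht. apply (D1_D2 (cyl J)); auto. now apply (open_cyl (P := R1)). Qed.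

Lemma fam_int_is_derive F t : fam F -> J t ->
  is_derive (fun s => circle_int (fun y => F (s, y))) t (circle_int (fun y => D1 F (t, y))).
Proof.
intros [HF _] Ht.
apply (RInt_is_derive_D1 (cyl J) F 0 (2 * PI) t).
- now apply (open_cyl (P := R1)).
- generalize PI_RGT_0; lra.
- exact HF.
- intros y _. exact Ht.
Qed.

Lemma fam_int_smooth F : fam F -> smooth_on (V := R1) J (fun t => circle_int (fun y => F (t, y))).
Proof. intros HF. now apply (circle_family_int (P := R1)). Qed.

Lemma fam_by_parts F G t : fam F -> fam G -> J t ->
  circle_int (fun y => D2 F (t, y) * G (t, y)) = - circle_int (fun y => F (t, y) * D2 G (t, y)).
Proof.
intros HF HG Ht. apply (circle_int_by_parts (fun y => F (t, y)) _ (fun y => G (t, y))).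
- now apply (circle_family_periodic (P := R1) J).
- now apply (circle_family_periodic (P := R1) J).
- intros; now apply fam_is_D2.
- intros; now apply fam_is_D2.
- intros. apply (circle_family_continuous (P := R1) J); auto. now apply fam_D2.
- intros. apply (circle_family_continuous (P := R1) J); auto. now apply fam_D2.
Qed.

End Family1.

(** * The energy in Lagrangian coordinates *)

Definition flow (g : R -> pre_Vir) (z : R * R) : R := fst (g (fst z)) (snd z).
Definition density (g : R -> pre_Vir) : R * R -> R := D2 (flow g).
Definition log_density (g : R -> pre_Vir) (z : R * R) : R := ln (density g z).

(** The central component of the right velocity, written in the Lagrangian
    coordinate; see [right_velocity_snd]. *)
Definition central_velocity (g : R -> pre_Vir) (t : R) : R :=
  Derive (fun s => snd (g s)) t -
  circle_int (fun y => D1 (log_density g) (t, y) * D2 (log_density g) (t, y)).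

Lemma Vir_mul_fst g h : fst (Vir_mul g h) = fun x => fst g (fst h x).
Proof. now destruct g, h. Qed.

Lemma Vir_mul_snd g h : snd (Vir_mul g h) = snd g + snd h +
   circle_int (fun x => ln (Derive (fun y => fst g (fst h y)) x) * Derive (fun y => ln (Derive (fst h) y)) x).
Proof. now destruct g, h. Qed.

Lemma Vir_inv_fst g : fst (Vir_inv g) = diffeo_inv (fst g).
Proof. now destruct g. Qed.

Lemma Vir_inv_snd g : snd (Vir_inv g) = - snd g.
Proof. now destruct g. Qed.

Section Velocity.

Variables (J : R -> Prop) (g : R -> pre_Vir).
Hypothesis HJ : open J.
Hypothesis Hg : forall t, J t -> diffeo (fst (g t)).
Hypothesis Hs : smooth_on (V := R2) (cyl J) (flow g).
Hypothesis Ha : forall t, J t -> ex_derive (fun s => snd (g s)) t.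
Notation fam := (circle_family (P := R1) J).

Let HcJ : open (T := R2) (cyl J) := open_cyl (P := R1) J HJ.

Lemma flow_shift t x : J t -> flow g (t, x + 2 * PI) = flow g (t, x) + 2 * PI.
Proof. intros Ht. apply (Hg t Ht). Qed.

Lemma density_pos t x : J t -> 0 < density g (t, x).
Proof. intros Ht. apply (Hg t Ht). Qed.

Lemma density_fam : fam (density g).
Proof.
split; [now apply (smooth_on_D2 (cyl J))|].
intros t x Ht.
change (Derive (fun s => flow g (t, s)) (x + 2 * PI) = Derive (fun s => flow g (t, s)) x).
rewrite <- (Derive_ext (fun s => flow g (t, s + 2 * PI) - 2 * PI) (fun s => flow g (t, s)) x).
2:{ intros s. rewrite flow_shift by exact Ht. apply Rplus_minus_r. }
symmetry. apply is_derive_unique.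
pose proof (is_derive_D2 (cyl J) (flow g) t (x + 2 * PI) Hs Ht) as D0.
assert (D : is_derive (fun s => s + 2 * PI) x 1) by (auto_derive; auto).
pose proof (is_derive_comp_R (fun s => flow g (t, s)) _ x _ _ D0 D) as D'.
pose proof (is_derive_minus (V := R1) _ (fun _ : R => 2 * PI) _ _ _ D' (is_derive_const _ _)) as D''.
change (Derive (fun s => flow g (t, s)) (x + 2 * PI)) with (D2 (flow g) (t, x + 2 * PI)).
replace (D2 (flow g) (t, x + 2 * PI)) with (minus (scal 1 (D2 (flow g) (t, x + 2 * PI))) zero); [exact D''|].
rewrite minus_zero_r. apply (scal_one (V := R1)).
Qed.

Lemma velocity_fam : fam (D1 (flow g)).
Proof.
split; [now apply (smooth_on_D1 (cyl J))|].
intros t x Ht.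
change (Derive (fun s => flow g (s, x + 2 * PI)) t = Derive (fun s => flow g (s, x)) t).
rewrite (Derive_ext_loc (fun s => flow g (s, x + 2 * PI)) (fun s => flow g (s, x) + 2 * PI)).
2:{ generalize (HJ t Ht). apply filter_imp. intros s Hs'. now apply flow_shift. }
rewrite Derive_plus, Derive_const.
- apply Rplus_0_r.
- eexists. now apply (is_derive_D1 (cyl J)).
- apply ex_derive_const.
Qed.

Lemma log_density_fam : fam (log_density g).
Proof.
apply (circle_family_ln (P := R1)); [exact HJ|exact density_fam|].
intros. now apply density_pos.
Qed.

Lemma D1_log_density t x : J t -> D1 (log_density g) (t, x) = D1 (density g) (t, x) / density g (t, x).
Proof.
intros Ht. apply is_derive_unique. simpl.
pose proof (fam_is_D1 J _ t x density_fam Ht) as D.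
apply (is_derive_comp_R ln (fun s => density g (s, x))); [|exact D].
apply is_derive_ln. now apply density_pos.
Qed.

Lemma D1_density t x : J t -> D1 (density g) (t, x) = density g (t, x) * D1 (log_density g) (t, x).
Proof. intros Ht. rewrite D1_log_density by exact Ht. field. apply Rgt_not_eq. now apply density_pos. Qed.

Lemma D1_density_velocity t x : J t -> D1 (density g) (t, x) = D2 (D1 (flow g)) (t, x).
Proof. intros Ht. now apply (D1_D2 (cyl J)). Qed.

Lemma circle_int_density t : J t -> circle_int (fun y => density g (t, y)) = 2 * PI.
Proof.
intros Ht. unfold circle_int.
rewrite (is_RInt_unique (V := R_CompleteNormedModule) _ 0 (2 * PI) (minus (flow g (t, 2 * PI)) (flow g (t, 0)))).
- rewrite <- (Rplus_0_l (2 * PI)) at 1. rewrite flow_shift by exact Ht.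
  unfold minus, plus, opp; simpl. ring.
- apply (is_RInt_derive (V := R_CompleteNormedModule) (fun y => flow g (t, y))).
  + intros y _. now apply (is_derive_D2 (cyl J)).
  + intros y _. apply (circle_family_continuous (P := R1) J); auto. exact density_fam.
Qed.

Let psi t := diffeo_inv (fst (g t)).

Lemma right_velocity_fst t x : fst (right_velocity g t) x = D1 (flow g) (t, psi t x).
Proof.
unfold right_velocity, D1, psi. simpl. apply Derive_ext. intros s.
rewrite Vir_mul_fst, Vir_inv_fst. reflexivity.
Qed.

(** Differentiating [phi_t = v o phi] in space gives [v_x o phi = (ln phi_x)_t]. *)
Lemma Derive_right_velocity t x : J t ->
  Derive (fst (right_velocity g t)) x = D1 (log_density g) (t, psi t x).
Proof.
intros Ht. rewrite (Derive_ext _ (fun x => D1 (flow g) (t, psi t x))) by (intros; apply right_velocity_fst).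
apply is_derive_unique.
pose proof (diffeo_inv_is_derive _ (Hg t Ht) x) as Dp.
pose proof (fam_is_D2 J _ t (psi t x) velocity_fam Ht) as Dv.
pose proof (is_derive_comp_R (fun y => D1 (flow g) (t, y)) (psi t) x _ _ Dv Dp) as D.
rewrite D1_log_density, D1_density_velocity by exact Ht.
replace (D2 (D1 (flow g)) (t, psi t x) / density g (t, psi t x)) with (scal (/ Derive (fst (g t)) (diffeo_inv (fst (g t)) x)) (D2 (D1 (flow g)) (t, psi t x))); [exact D|].
apply Rmult_comm.
Qed.

(** After the change of variables [x = phi(t, y)] the cocycle of
    [g(s) g(t)^-1] is the integral of [(L(t) - L(s)) L_y(t)] with [L = ln phi_y];
    differentiate at [s = t]. *)
Lemma right_velocity_snd t : J t -> snd (right_velocity g t) = central_velocity g t.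
Proof.
intros Ht. unfold right_velocity, central_velocity. simpl.
set (L := log_density g).
pose proof log_density_fam as HL. fold L in HL.
assert (HL2 := fam_D2 J HJ _ HL).
set (F := fun z : R * R => (L (t, snd z) + -1 * L z) * D2 L (t, snd z)).
assert (Hsnd : forall f, smooth_on (V := R1) (fun _ => True) f -> smooth_on (V := R2) (cyl J) (fun z => f (snd z))).
{ intros f Hf. apply (smooth_on_sub (V := R2) (fun z => True)); [now intros|].
  apply (smooth_on_snd (V := R1) (W := R1) (fun _ => True)); [apply open_true|exact Hf]. }
assert (HF : fam F).
{ apply (circle_family_alg (P := R1)); [exact HJ| |].
  - apply (sa_mult (V := R2) (cyl J) (fun z => L (t, snd z) + -1 * L z) (fun z => D2 L (t, snd z))).
    + apply (sa_plus (V := R2) (cyl J) (fun z => L (t, snd z)) (fun z => -1 * L z)).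
      * apply (smooth_on_alg (V := R2)). apply (Hsnd (fun y => L (t, y))).
        now apply (circle_family_slice (P := R1) J).
      * apply (sa_mult (V := R2)); [apply (sa_const (V := R2))|]. apply (smooth_on_alg (V := R2)). apply HL.
    + apply (smooth_on_alg (V := R2)). apply (Hsnd (fun y => D2 L (t, y))).
      now apply (circle_family_slice (P := R1) J).
  - intros s x Hs'. unfold F. simpl. now rewrite !(proj2 HL), (proj2 HL2). }
apply is_derive_unique.
assert (E : locally t (fun s => snd (g s) + - snd (g t) + circle_int (fun y => F (s, y)) =
   snd (Vir_mul (g s) (Vir_inv (g t))))).
{ generalize (HJ t Ht). apply filter_imp. intros s Hs'.
  rewrite Vir_mul_snd, Vir_inv_snd, Vir_inv_fst. f_equal. symmetry.
  set (h := fun y => F (s, y) / density g (t, y)).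
  transitivity (circle_int (fun x => h (psi t x))).
  - apply circle_int_ext. intros x.
    assert (Dp : forall x, is_derive (psi t) x (/ density g (t, psi t x))) by (intros; apply (diffeo_inv_is_derive _ (Hg t Ht))).
    assert (Q : forall y, 0 < density g (t, y)) by (intros; now apply density_pos).
    assert (E1 : Derive (fun y => fst (g s) (psi t y)) x = density g (s, psi t x) * / density g (t, psi t x)).
    { apply is_derive_unique. rewrite Rmult_comm.
      apply (is_derive_comp_R (fst (g s)) (psi t)); [|apply Dp].
      apply diffeo_is_derive. now apply Hg. }
    fold (psi t). rewrite E1.
    rewrite ln_mult; [|now apply density_pos|now apply Rinv_0_lt_compat].
    rewrite ln_Rinv by apply Q.
    rewrite (Derive_ext (fun y => ln (Derive (psi t) y)) (fun y => - L (t, psi t y))).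
    2:{ intros y. rewrite (is_derive_unique _ _ _ (Dp y)). now apply ln_Rinv. }
    assert (E2 : Derive (fun y => - L (t, psi t y)) x = - (D2 L (t, psi t x) * / density g (t, psi t x))).
    { apply is_derive_unique. apply (is_derive_opp (V := R1) (fun y => L (t, psi t y))).
      rewrite Rmult_comm.
      apply (is_derive_comp_R (fun y => L (t, y)) (psi t)); [|apply Dp].
      now apply (fam_is_D2 J). }
    rewrite E2. unfold h, F. simpl. unfold L, log_density. unfold Rdiv. ring.
  - assert (Q : forall y, density g (t, y) <> 0) by (intros; apply Rgt_not_eq; now apply density_pos).
    unfold psi. rewrite (circle_int_change_of_variables _ (Hg t Ht) h).
    + apply circle_int_ext. intros y. unfold h. change (Derive (fst (g t)) y) with (density g (t, y)).
      field. apply Q.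
    + intros y. unfold h. now rewrite (proj2 HF), (proj2 density_fam).
    + intros y. apply (continuous_mult_R (fun y => F (s, y)) (fun y => / density g (t, y))).
      * now apply (circle_family_continuous (P := R1) J).
      * apply (continuous_comp (fun y => density g (t, y)) Rinv).
        -- apply (circle_family_continuous (P := R1) J); auto. apply density_fam.
        -- apply continuous_Rinv. apply Q. }
apply (is_derive_ext_loc (fun s => snd (g s) + - snd (g t) + circle_int (fun y => F (s, y)))); [exact E|].
replace (Derive (fun s => snd (g s)) t - circle_int (fun y => D1 L (t, y) * D2 L (t, y))) with
  (Derive (fun s => snd (g s)) t + 0 + circle_int (fun y => D1 F (t, y))).
- apply (is_derive_plus (V := R1) (fun s => snd (g s) + - snd (g t))).
  + apply (is_derive_plus (V := R1) (fun s => snd (g s))).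
    * apply Derive_correct. now apply Ha.
    * apply (is_derive_const (V := R1)).
  + now apply (fam_int_is_derive J HJ).
- rewrite Rplus_0_r. unfold Rminus. f_equal.
  rewrite <- (Rmult_1_l (circle_int (fun y => D1 L (t, y) * _))), Ropp_mult_distr_l, <- circle_int_scal.
  + apply circle_int_ext. intros y. apply is_derive_unique. unfold F. simpl.
    pose proof (fam_is_D1 J L t y HL Ht) as D.
    assert (A : forall (f : R -> R) c d l, is_derive f t l ->
      is_derive (fun s => (c + -1 * f s) * d) t (- (1) * (l * d))).
    { intros f c d l Df. auto_derive; [now exists l|]. replace (Derive (fun x => f x) t) with l by (symmetry; now apply is_derive_unique). ring. }
    exact (A _ _ _ _ D).
  + intros y. apply (continuous_mult_R (fun y => D1 L (t, y)) (fun y => D2 L (t, y)));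
      apply (circle_family_continuous (P := R1) J); auto. now apply fam_D1.
Qed.

(** The energy density in the Lagrangian coordinate. It depends on [phi] only
    through [phi_y], which is why the energy descends to right cosets of the
    rotations. *)
Lemma H1dot_right_velocity t : J t -> H1dot (right_velocity g t) (right_velocity g t) =
  circle_int (fun y => density g (t, y) * (D1 (log_density g) (t, y) * D1 (log_density g) (t, y))) +
  central_velocity g t * central_velocity g t.
Proof.
intros Ht. rewrite <- right_velocity_snd by exact Ht.
destruct (right_velocity g t) as [v b] eqn:E. simpl. f_equal.
assert (Ev : forall x, Derive v x = D1 (log_density g) (t, psi t x)).
{ intros x. rewrite <- Derive_right_velocity by exact Ht. now rewrite E. }
pose proof (fam_D1 J HJ _ log_density_fam) as HL.
set (h := fun y => D1 (log_density g) (t, y) * D1 (log_density g) (t, y)).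
transitivity (circle_int (fun x => h (psi t x))).
- apply circle_int_ext. intros x. now rewrite Ev.
- unfold psi. rewrite (circle_int_change_of_variables _ (Hg t Ht) h).
  + apply circle_int_ext. intros y. apply Rmult_comm.
  + intros y. unfold h. now rewrite (proj2 HL).
  + intros y. apply (continuous_mult_R); now apply (circle_family_continuous (P := R1) J).
Qed.

End Velocity.

(** A rotation contributes the integral of [L L_x] to the cocycle, where
    [L = ln phi_x]; it vanishes because [L] is periodic. *)
Lemma same_right_coset_iff g h : diffeo (fst g) ->
  same_right_coset g h <-> (exists theta, forall x, fst h x = fst g x + theta) /\ snd h = snd g.
Proof.
intros Hg.
assert (K : forall theta, snd (Vir_mul (rotation theta) g) = snd g).
{ intros theta. rewrite Vir_mul_snd. simpl. rewrite Rplus_0_l.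
  rewrite <- (Rplus_0_r (snd g)) at 2. f_equal.
  set (phi := fst g) in *.
  set (J := fun _ : R => True).
  set (L := log_density (fun _ : R => g)).
  assert (HJ : open J) by apply open_true.
  assert (HL : circle_family (P := R1) J L).
  { apply (log_density_fam J (fun _ => g) HJ); [now intros|].
    apply (smooth_on_sub (V := R2) (fun z => True)); [now intros|].
    apply (smooth_on_snd (V := R1) (W := R1) (fun _ => True) phi); [apply open_true|].
    apply (proj1 (smooth_iff phi)), Hg. }
  transitivity (circle_int (fun x => L (0, x) * D2 L (0, x))).
  - apply circle_int_ext. intros x. f_equal. unfold L, log_density, density, D2, flow. simpl.
    fold phi. f_equal. rewrite Derive_plus, Derive_const; [apply Rplus_0_r| |apply ex_derive_const].
    eexists. now apply diffeo_is_derive.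
  - assert (E := fam_by_parts J HJ L L 0 HL HL I).
    rewrite (circle_int_ext _ (fun y => L (0, y) * D2 L (0, y))) in E by (intros; apply Rmult_comm).
    unfold J in E. lra. }
unfold same_right_coset. split.
- intros [theta [H1 H2]]. rewrite K in H2. split; [|exact H2]. exists theta.
  intros x. now rewrite H1, Vir_mul_fst.
- intros [[theta H1] H2]. exists theta. rewrite K. split; [|exact H2].
  intros x. now rewrite H1, Vir_mul_fst.
Qed.

(** * The Hunter--Saxton equation on classes *)

Lemma smooth_of_derive f f' : (forall x, is_derive f x (f' x)) -> smooth f' -> smooth f.
Proof.
intros Df Hf' n x. destruct n as [|[|n]]; [exact I|eexists; apply Df|].
apply (ex_derive_ext (Derive_n f' n)).
- intros y. rewrite <- (Derive_n_ext (Derive_n f 1) f').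
  + rewrite Derive_n_comp. f_equal. lia.
  + intros z. apply is_derive_unique, Df.
- apply (Hf' (S n)).
Qed.

Lemma smooth_ex_derive f x : smooth f -> ex_derive f x.
Proof. intros Hf. apply (Hf 1%nat). Qed.

Lemma smooth_Derive f : smooth f -> smooth (Derive f).
Proof.
intros Hf. apply smooth_iff. apply (smooth_on_Derive (fun _ => True)); [apply open_true|].
now apply smooth_iff.
Qed.

Lemma smooth_continuous f x : smooth f -> continuous f x.
Proof. intros Hf. apply (ex_derive_continuous_R). now apply smooth_ex_derive. Qed.

Lemma smooth_lin f g c : smooth f -> smooth g -> smooth (fun x => f x + c * g x).
Proof.
intros Hf Hg. apply smooth_iff. apply (smooth_alg_smooth (V := R1)); [apply open_true|].
apply (sa_plus (V := R1)); [now apply (smooth_on_alg (V := R1)), smooth_iff|].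
apply (sa_mult (V := R1)); [apply (sa_const (V := R1))|].
now apply (smooth_on_alg (V := R1)), smooth_iff.
Qed.

Lemma smooth_mult f g : smooth f -> smooth g -> smooth (fun x => f x * g x).
Proof.
intros Hf Hg. apply smooth_iff. apply (smooth_alg_smooth (V := R1)); [apply open_true|].
apply (sa_mult (V := R1)); now apply (smooth_on_alg (V := R1)), smooth_iff.
Qed.

Lemma smooth_const c : smooth (fun _ => c).
Proof.
apply smooth_iff. apply (smooth_alg_smooth (V := R1)); [apply open_true|].
apply (sa_const (V := R1)).
Qed.

Lemma smooth_ext f g : (forall x, g x = f x) -> smooth f -> smooth g.
Proof.
intros E Hf. apply smooth_iff. apply (smooth_on_ext (V := R1) _ f); [apply open_true|auto|].
now apply smooth_iff.
Qed.

Lemma circle_function_Derive f : circle_function f -> circle_function (Derive f).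
Proof.
intros [Hf Pf]. split; [now apply smooth_Derive|].
intros x. transitivity (Derive (fun y => f (y + 2 * PI)) x).
- symmetry. change (Derive_n (fun y => f (y + 2 * PI)) 1 x = Derive_n f 1 (x + 2 * PI)).
  apply Derive_n_comp_trans.
- now apply Derive_ext.
Qed.

Lemma circle_function_Derive_n f n : circle_function f -> circle_function (Derive_n f n).
Proof. intros Hf. induction n as [|n IH]; [exact Hf|now apply circle_function_Derive]. Qed.

Lemma circle_function_lin f g c : circle_function f -> circle_function g ->
  circle_function (fun x => f x + c * g x).
Proof. intros [Hf Pf] [Hg Pg]. split; [now apply smooth_lin|]. intros x. now rewrite Pf, Pg. Qed.

Lemma circle_function_mult f g : circle_function f -> circle_function g ->
  circle_function (fun x => f x * g x).
Proof. intros [Hf Pf] [Hg Pg]. split; [now apply smooth_mult|]. intros x. now rewrite Pf, Pg. Qed.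

Lemma circle_function_const c : circle_function (fun _ => c).
Proof. split; [apply smooth_const|easy]. Qed.

Lemma circle_function_ext f g : (forall x, g x = f x) -> circle_function f -> circle_function g.
Proof. intros E [Hf Pf]. split; [now apply (smooth_ext f)|]. intros x. now rewrite !E. Qed.

Lemma circle_function_shift f p : circle_function f -> circle_function (fun x => f (x + p)).
Proof.
intros [Hf Pf]. split.
- intros [|n] x; [exact I|].
  apply (ex_derive_ext (fun x => Derive_n f n (x + p))).
  + intros y. symmetry. apply Derive_n_comp_trans.
  + apply (ex_derive_comp (K := R_AbsRing) (V := R1) (Derive_n f n)); [apply (Hf (S n))|auto_derive; auto].
- intros x. rewrite <- (Pf (x + p)). f_equal. ring.
Qed.

Lemma Derive_n_lin f g c n x : smooth f -> smooth g ->
  Derive_n (fun x => f x + c * g x) n x = Derive_n f n x + c * Derive_n g n x.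
Proof.
intros Hf Hg. revert x. induction n as [|n IH]; intros x; [reflexivity|].
simpl. rewrite (Derive_ext _ _ _ IH), Derive_plus, Derive_scal; [reflexivity|apply (Hf (S n))|].
apply ex_derive_scal, (Hg (S n)).
Qed.

Lemma circle_function_is_derive f x : circle_function f -> is_derive f x (Derive f x).
Proof. intros [Hf _]. now apply Derive_correct, smooth_ex_derive. Qed.

Lemma circle_function_continuous f x : circle_function f -> continuous f x.
Proof. intros [Hf _]. now apply smooth_continuous. Qed.

Lemma circle_function_by_parts f g : circle_function f -> circle_function g ->
  circle_int (fun x => Derive f x * g x) = - circle_int (fun x => f x * Derive g x).
Proof.
intros Hf Hg. apply circle_int_by_parts.
- apply Hf.
- apply Hg.
- intros; now apply circle_function_is_derive.
- intros; now apply circle_function_is_derive.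
- intros; now apply circle_function_continuous, circle_function_Derive.
- intros; now apply circle_function_continuous, circle_function_Derive.
Qed.

(** The derivative is constant, and its mean value over a period is zero. *)
Lemma second_derivative_zero f : circle_function f -> (forall x, Derive_n f 2 x = 0) ->
  forall x y, f x = f y.
Proof.
intros Hf E.
assert (H1 := circle_function_Derive f Hf).
assert (E1 : forall x, Derive f x = Derive f 0).
{ intros x. apply derive_0_const. intros z. rewrite <- (E z).
  change (Derive_n f 2 z) with (Derive (Derive f) z). now apply circle_function_is_derive. }
apply derive_0_const. intros z.
assert (E0 : Derive f 0 = 0).
{ apply (periodic_derive_const f); [apply Hf|]. intros x. rewrite <- (E1 x). now apply circle_function_is_derive. }
rewrite <- E0, <- (E1 z). now apply circle_function_is_derive.
Qed.

(** The right hand side is minus the derivative of [F = v v_xx + v_x^2 / 2], so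
    one integration gives [w_x = m - F]. The constant [m] has to be the mean of
    [F]: this is what makes a second, periodic, primitive exist. *)
Lemma HS_velocity_exists v : circle_function v -> exists w, HS_velocity v w.
Proof.
intros Hv.
set (F := fun x => v x * Derive_n v 2 x + / 2 * (Derive v x * Derive v x)).
assert (HF : circle_function F).
{ apply circle_function_lin; apply circle_function_mult; auto; try now apply circle_function_Derive.
  now apply circle_function_Derive_n. }
generalize PI_RGT_0; intros Hpi.
set (m := circle_int F / (2 * PI)).
set (G := fun x => m + -1 * F x).
assert (HG : circle_function G) by (apply circle_function_lin; [apply circle_function_const|exact HF]).
assert (CG : forall x, continuous G x) by (intros; now apply circle_function_continuous).
assert (IG : circle_int G = 0).
{ unfold G. rewrite circle_int_plus.
  - rewrite circle_int_scal by (intros; now apply circle_function_continuous).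
    unfold circle_int at 1. rewrite RInt_const. change ((2 * PI - 0) * m + -1 * circle_int F = 0).
    unfold m. field. lra.
  - intros; apply continuous_const.
  - intros. apply circle_function_continuous.
    apply (circle_function_ext (fun x => 0 + -1 * F x)); [intros; ring|].
    apply circle_function_lin; [apply circle_function_const|exact HF]. }
exists (fun x => RInt G 0 x).
assert (D : forall x, is_derive (fun x => RInt G 0 x) x (G x)).
{ intros x. apply (is_derive_RInt (V := R1) G _ 0); [|apply CG].
  apply filter_forall. intros y. apply (RInt_correct (V := R_CompleteNormedModule)). now apply ex_RInt_cont. }
split; [split|].
- apply (smooth_of_derive _ G D). apply HG.
- intros x. rewrite <- (RInt_Chasles (V := R_CompleteNormedModule) G 0 x (x + 2 * PI)); try now apply ex_RInt_cont.
  rewrite circle_int_shift, IG; [apply (plus_zero_r (G := R_AbelianGroup))|apply HG|exact CG].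
- intros x. change (Derive (Derive (fun x => RInt G 0 x)) x = - 2 * Derive v x * Derive_n v 2 x - v x * Derive_n v 3 x).
  rewrite (Derive_ext _ G) by (intros; apply is_derive_unique, D).
  apply is_derive_unique.
  pose proof (circle_function_is_derive v x Hv) as D0.
  pose proof (circle_function_is_derive _ x (circle_function_Derive v Hv)) as D1.
  pose proof (circle_function_is_derive _ x (circle_function_Derive_n v 2 Hv)) as D2.
  change (Derive (Derive v) x) with (Derive_n v 2 x) in D1.
  change (Derive (Derive_n v 2) x) with (Derive_n v 3 x) in D2.
  assert (A : forall f0 f1 f2 : R -> R, forall l0 l1 l2 : R, is_derive f0 x l0 -> is_derive f1 x l1 -> is_derive f2 x l2 ->
     is_derive (fun x => m + -1 * (f0 x * f2 x + / 2 * (f1 x * f1 x))) x (- (l0 * f2 x + f0 x * l2 + f1 x * l1))).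
  { intros f0 f1 f2 l0 l1 l2 H0 H1 H2. auto_derive; [repeat split; eexists; eassumption|].
    replace (Derive (fun x => f0 x) x) with l0 by (symmetry; now apply is_derive_unique).
    replace (Derive (fun x => f1 x) x) with l1 by (symmetry; now apply is_derive_unique).
    replace (Derive (fun x => f2 x) x) with l2 by (symmetry; now apply is_derive_unique).
    field. }
  pose proof (A _ _ _ _ _ _ D0 D1 D2) as K.
  replace (- 2 * Derive v x * Derive_n v 2 x - v x * Derive_n v 3 x) with
    (- (Derive v x * Derive_n v 2 x + v x * Derive_n v 3 x + Derive v x * Derive_n v 2 x)) by ring.
  exact K.
Qed.

Lemma HS_class_velocity_unique v w w' : HS_class_velocity v w -> HS_class_velocity v w' ->
  tangent_to_class v (fun x => w' x - w x).
Proof.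
intros [w0 [[H0 E0] [c [d E]]]] [w1 [[H1 E1] [c' [d' E']]]].
assert (K : forall x, w1 x + -1 * w0 x = w1 0 + -1 * w0 0).
{ intros x. apply (second_derivative_zero (fun x => w1 x + -1 * w0 x)); [now apply circle_function_lin|].
  intros y. rewrite Derive_n_lin by (apply H1 || apply H0). rewrite E0, E1. ring. }
exists (w1 0 + -1 * w0 0 + c' - c), (d' - d). intros x.
specialize (K x). specialize (E x). specialize (E' x). lra.
Qed.

Lemma Derive_n_class v v' p q n x : smooth v -> (forall x, v' x = v (x + p) + q) ->
  Derive_n v' (S n) x = Derive_n v (S n) (x + p).
Proof.
intros Hv E.
assert (E1 : forall y, Derive_n v' 1 y = Derive v (y + p)).
{ intros y. simpl. rewrite (Derive_ext v' _ _ E), Derive_plus, Derive_const, Rplus_0_r.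
  - apply (Derive_n_comp_trans v 1 y p).
  - apply (ex_derive_comp (K := R_AbsRing) (V := R1) v); [now apply smooth_ex_derive|auto_derive; auto].
  - apply ex_derive_const. }
replace (S n) with (n + 1)%nat by lia.
rewrite <- (Derive_n_comp v'), (Derive_n_ext _ _ n x E1), (Derive_n_comp_trans (Derive v)).
exact (Derive_n_comp v n 1 (x + p)).
Qed.

(** Adding [q] to [v] adds [- q v_xxx] to the right hand side, hence [- q v_x] to
    the prescribed velocity, and this is tangent to the class. *)
Lemma HS_class_velocity_transport v w v' w' : circle_function v ->
  same_class_velocity v w v' w' -> HS_class_velocity v w -> HS_class_velocity v' w'.
Proof.
intros Hv [p [q [Ev [c [d Ew]]]]] [w0 [[H0 E0] [c0 [d0 Ew0]]]].
assert (Hv' : circle_function v').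
{ apply (circle_function_ext (fun x => v (x + p) + q * 1)).
  - intros x. rewrite Ev. ring.
  - apply circle_function_lin; [now apply circle_function_shift|apply circle_function_const]. }
assert (E1 : forall x, Derive v' x = Derive v (x + p)) by (intros; apply (Derive_n_class v v' p q 0); [apply Hv|exact Ev]).
assert (S0 : circle_function (fun x => w0 (x + p))) by now apply circle_function_shift.
assert (S1 := circle_function_Derive v' Hv').
exists (fun x => w0 (x + p) + (- q) * Derive v' x). split.
- split; [now apply circle_function_lin|].
  intros x. rewrite Derive_n_lin by (apply S0 || apply S1).
  rewrite (Derive_n_comp_trans w0), E0.
  change (Derive_n (Derive v') 2 x) with (Derive_n v' 3 x).
  rewrite E1, Ev, !(Derive_n_class v v' p q) by (apply Hv || exact Ev). ring.
- exists (c + c0), (d + d0 + q). intros x. specialize (Ew x). specialize (Ew0 (x + p)). simpl in *.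
  rewrite <- E1 in Ew0. lra.
Qed.

Lemma same_class_velocity_sym v w v' w' : smooth v ->
  same_class_velocity v w v' w' -> same_class_velocity v' w' v w.
Proof.
intros Hv [p [q [Ev [c [d Ew]]]]]. exists (- p), (- q). split.
- intros x. rewrite Ev. replace (x + - p + p) with x by ring. ring.
- exists (- c), (- d). intros x. specialize (Ew (x + - p)). simpl in Ew.
  rewrite (Derive_n_class v v' p q 0 (x + - p) Hv Ev : Derive v' (x + - p) = Derive v (x + - p + p)) in Ew.
  replace (x + - p + p) with x in Ew by ring. lra.
Qed.

Lemma same_class_velocity_circle v w v' w' : circle_function v -> same_class_velocity v w v' w' ->
  circle_function v'.
Proof.
intros Hv [p [q [Ev _]]].
apply (circle_function_ext (fun x => v (x + p) + q * 1)).
- intros x. rewrite Ev. ring.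
- apply circle_function_lin; [now apply circle_function_shift|apply circle_function_const].
Qed.

Lemma HS_class_velocity_iff v w v' w' : circle_function v -> same_class_velocity v w v' w' ->
  (HS_class_velocity v w <-> HS_class_velocity v' w').
Proof.
intros Hv Hs. split.
- now apply HS_class_velocity_transport.
- apply HS_class_velocity_transport.
  + exact (same_class_velocity_circle v w v' w' Hv Hs).
  + apply same_class_velocity_sym; [apply Hv|exact Hs].
Qed.

Section Curve.

Variables (alpha beta : Rbar) (v : R -> R -> R).
Hypothesis Hv : smooth_circle_curve alpha beta v.
Let T := time_interval alpha beta.
Definition curve_family (v : R -> R -> R) (z : R * R) : R := v (fst z) (snd z).
Let vh := curve_family v.

Lemma curve_fam : circle_family (P := R1) T vh.
Proof. split; [apply Hv|]. intros t x Ht. apply (proj2 Hv t Ht x). Qed.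

Lemma fam_circle_function (F : R * R -> R) t : circle_family (P := R1) T F -> T t ->
  circle_function (fun x => F (t, x)).
Proof.
intros HF Ht. split.
- apply smooth_iff. apply (circle_family_slice (P := R1) T); auto. apply open_time_interval.
- now apply (circle_family_periodic (P := R1) T).
Qed.

Lemma curve_circle_function t : T t -> circle_function (v t).
Proof. intros Ht. exact (fam_circle_function vh t curve_fam Ht). Qed.

Lemma curve_velocity_circle_function t : T t -> circle_function (fun x => Derive (fun s => v s x) t).
Proof.
intros Ht. apply (fam_circle_function (D1 vh) t); [|exact Ht].
apply fam_D1; [apply open_time_interval|exact curve_fam].
Qed.

Lemma curve_Derive_2 t x : T t ->
  is_derive (fun s => Derive_n (v s) 2 x) t (Derive_n (fun x => Derive (fun s => v s x) t) 2 x).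
Proof.
intros Ht. pose proof (open_time_interval alpha beta) as HT. fold T in HT.
pose proof curve_fam as HF. pose proof (fam_D2 T HT _ HF) as HF2.
assert (E : D1 (D2 (D2 vh)) (t, x) = D2 (D2 (D1 vh)) (t, x)).
{ rewrite (fam_D1_D2 T HT (D2 vh) (t, x) HF2 Ht).
  apply (D2_ext (cyl T)).
  - now apply (open_cyl (P := R1)).
  - intros z Hz. now apply (fam_D1_D2 T HT).
  - exact Ht. }
change (is_derive (fun s => D2 (D2 vh) (s, x)) t (D2 (D2 (D1 vh)) (t, x))).
rewrite <- E. apply (fam_is_D1 T); [|exact Ht]. now apply fam_D2.
Qed.

(** The time derivatives of the shifts only produce the tangent directions
    [p' v_x + q']. *)
Lemma curve_shift_velocity (p q : R -> R) t :
  smooth_on_interval alpha beta p -> smooth_on_interval alpha beta q -> T t ->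
  same_class_velocity (v t) (fun x => Derive (fun s => v s x) t)
    (fun x => v t (x + p t) + q t) (fun x => Derive (fun s => v s (x + p s) + q s) t).
Proof.
intros Hp Hq Ht. exists (p t), (q t). split; [reflexivity|].
exists (Derive q t), (Derive p t). intros x.
assert (Dp : is_derive p t (Derive p t)) by (apply Derive_correct, (Hp 1%nat t Ht)).
assert (Dq : is_derive q t (Derive q t)) by (apply Derive_correct, (Hq 1%nat t Ht)).
assert (Dx : is_derive (fun s => x + p s) t (Derive p t)).
{ auto_derive; [eexists; exact Dp|]. rewrite Rmult_1_l. reflexivity. }
pose proof (open_time_interval alpha beta) as HT. fold T in HT.
pose proof (is_derive_curve (cyl T) (open_cyl (P := R1) T HT) vh (fun s => s) (fun s => x + p s) t 1 (Derive p t)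
  (proj1 curve_fam) Ht (is_derive_id (K := R_AbsRing) t) Dx) as D.
pose proof (is_derive_plus (V := R1) _ _ _ _ _ D Dq) as D'.
change (Derive (fun s => v s (x + p s) + q s) t - D1 vh (t, x + p t) =
  Derive q t + Derive p t * Derive (fun x => v t (x + p t) + q t) x).
replace (Derive (fun s => v s (x + p s) + q s) t) with (D1 vh (t, x + p t) * 1 + D2 vh (t, x + p t) * Derive p t + Derive q t)
  by (symmetry; apply is_derive_unique; exact D').
change (D1 vh (t, x + p t) * 1 + D2 vh (t, x + p t) * Derive p t + Derive q t - D1 vh (t, x + p t) =
  Derive q t + Derive p t * Derive (fun x => v t (x + p t) + q t) x).
assert (E : Derive (fun x => v t (x + p t) + q t) x = D2 vh (t, x + p t)).
{ apply (Derive_n_class (v t) (fun x => v t (x + p t) + q t) (p t) (q t) 0); [|reflexivity].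
  now apply curve_circle_function. }
rewrite E. ring.
Qed.

End Curve.

(** * The Euler equation *)

Lemma circle_int_comb f g a : circle_function f -> circle_function g ->
  circle_int (fun x => f x + a * g x) = circle_int f + a * circle_int g.
Proof.
intros Hf Hg. rewrite circle_int_plus, circle_int_scal; auto; intros.
- now apply circle_function_continuous.
- now apply circle_function_continuous.
- apply (continuous_scal_r (V := R1) a g). now apply circle_function_continuous.
Qed.

(** Integration by parts moves all derivatives away from the test field. *)
Lemma is_ad_star_formula y b u a : circle_function y -> circle_function u ->
  is_ad_star (y, b) (u, a)
    (fun x => Derive u x * y x + 2 * (u x * Derive y x) + - a * Derive_n y 3 x, 0).
Proof.
intros Hy Hu.
pose proof (circle_function_Derive u Hu) as Hu1.
pose proof (circle_function_Derive y Hy) as Hy1.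
pose proof (circle_function_Derive_n y 2 Hy) as Hy2.
pose proof (circle_function_Derive_n y 3 Hy) as Hy3.
split.
- apply circle_function_lin; [|exact Hy3].
  apply circle_function_lin; now apply circle_function_mult.
- intros [w c] Hw. unfold in_vir in Hw. simpl in Hw.
  pose proof (circle_function_Derive w Hw) as Hw1.
  pose proof (circle_function_Derive_n w 2 Hw) as Hw2.
  pose proof (circle_function_Derive_n w 3 Hw) as Hw3.
  assert (M : forall f g, circle_function f -> circle_function g -> circle_function (fun x => f x * g x)) by exact circle_function_mult.
  assert (B3 : circle_int (fun x => y x * Derive_n w 3 x) = - circle_int (fun x => Derive_n y 3 x * w x)).
  { assert (K1 := circle_function_by_parts y (Derive_n w 2) Hy Hw2).
    assert (K2 := circle_function_by_parts (Derive y) (Derive w) Hy1 Hw1).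
    assert (K3 := circle_function_by_parts (Derive_n y 2) w Hy2 Hw).
    change (Derive (Derive_n w 2)) with (Derive_n w 3) in K1.
    change (Derive (Derive_n y 2)) with (Derive_n y 3) in K3.
    change (Derive (Derive w)) with (Derive_n w 2) in K2.
    change (Derive (Derive y)) with (Derive_n y 2) in K2. lra. }
  assert (Huy : circle_function (fun x => u x * y x)) by now apply M.
  assert (B1 := circle_function_by_parts (fun x => u x * y x) w Huy Hw).
  assert (E1 : forall x, Derive (fun x => u x * y x) x = Derive u x * y x + u x * Derive y x).
  { intros x. apply Derive_mult; apply smooth_ex_derive; [apply Hu|apply Hy]. }
  change (circle_int (fun x => (Derive u x * y x + 2 * (u x * Derive y x) + - a * Derive_n y 3 x) * w x) + 0 * c =
    circle_int (fun x => u x * (- y x * Derive w x + Derive y x * w x)) + a * circle_int (fun x => y x * Derive_n w 3 x)).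
  transitivity (circle_int (fun x => (Derive (fun x => u x * y x) x * w x + 1 * (u x * Derive y x * w x)) + - a * (Derive_n y 3 x * w x)) + 0 * c).
  { f_equal. apply circle_int_ext. intros x. rewrite E1. ring. }
  rewrite (circle_int_comb (fun x => Derive (fun x => u x * y x) x * w x + 1 * (u x * Derive y x * w x)) (fun x => Derive_n y 3 x * w x));
    [|apply circle_function_lin; apply M; auto; now apply circle_function_Derive|now apply M].
  rewrite (circle_int_comb (fun x => Derive (fun x => u x * y x) x * w x) (fun x => u x * Derive y x * w x));
    [|apply M; auto; now apply circle_function_Derive|apply M; auto].
  rewrite B1.
  rewrite B3.
  rewrite (circle_int_ext (fun x => u x * (- y x * Derive w x + Derive y x * w x)) (fun x => u x * Derive y x * w x + -1 * (u x * y x * Derive w x))) by (intros; ring).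
  rewrite (circle_int_comb (fun x => u x * Derive y x * w x)); [|apply M; auto|apply M; auto].
  ring.
Qed.

Lemma is_ad_star_unique X m n n' : is_ad_star X m n -> is_ad_star X m n' ->
  (forall x, fst n x = fst n' x) /\ snd n = snd n'.
Proof.
intros [Hn E] [Hn' E']. destruct n as [f a], n' as [f' a'].
unfold in_vir in Hn, Hn'. simpl in Hn, Hn'. simpl.
assert (K : forall Y, in_vir Y -> vir_pairing (f, a) Y = vir_pairing (f', a') Y) by (intros; rewrite E, E'; auto).
assert (Z : forall f, circle_int (fun x => f x * 0) = 0).
{ intros h. rewrite (circle_int_ext _ (fun _ => 0)) by (intros; ring).
  unfold circle_int. rewrite RInt_const. apply Rmult_0_r. }
assert (Ea : a = a').
{ specialize (K (fun _ => 0, 1) (circle_function_const 0)). simpl in K. rewrite !Z in K. lra. }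
split; [|exact Ea].
set (h := fun x => f x + -1 * f' x).
assert (Hh : circle_function h) by now apply circle_function_lin.
specialize (K (h, 0) Hh). simpl in K.
assert (E0 : circle_int (fun x => h x * h x) = 0).
{ rewrite (circle_int_ext _ (fun x => f x * h x + -1 * (f' x * h x))) by (intros; unfold h; ring).
  rewrite circle_int_comb by now apply circle_function_mult. lra. }
intros x. generalize (circle_sq_zero h (proj2 Hh) (fun x => circle_function_continuous h x Hh) E0 x).
unfold h. lra.
Qed.

(** With [u = - v_xx] the Euler equation at any preimage [y = v + k] of [u] reads
    [v_txx = - 2 v_x v_xx - v v_xxx + (d - k - b) v_xxx]. Both the choice of the
    preimage and the central charge [b] are absorbed in the coefficient of
    [v_xxx], that is, in the addition of a multiple of [v_x] to [v_t]. *)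
Lemma euler_iff_HS alpha beta v b : smooth_circle_curve alpha beta v ->
  (euler_on_L_mod_K alpha beta (fun t => inertia (v t, b t)) <->
      HS_class_solution alpha beta v /\
      (forall t, time_interval alpha beta t -> is_derive b t 0)).
Proof.
intros Hv.
assert (Hu : forall f, circle_function f -> circle_function (fun x => - Derive_n f 2 x)).
{ intros f Hf. apply (circle_function_ext (fun x => 0 + -1 * Derive_n f 2 x)); [intros; ring|].
  apply circle_function_lin; [apply circle_function_const|now apply circle_function_Derive_n]. }
assert (Du : forall f x, circle_function f -> Derive (fun x => - Derive_n f 2 x) x = - Derive_n f 3 x).
{ intros f x Hf. rewrite Derive_opp. reflexivity. }
split.
- intros H.
  assert (K : forall t, time_interval alpha beta t ->
    HS_class_velocity (v t) (fun x => Derive (fun s => v s x) t) /\ is_derive b t 0).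
  { intros t Ht. destruct (H t Ht) as [[y b'] [n [d [Hy [Ey [Hn [Dn Db]]]]]]].
    unfold in_vir in Hy. simpl in Hy.
    pose proof (curve_circle_function alpha beta v Hv t Ht) as Hvt.
    pose proof (curve_velocity_circle_function alpha beta v Hv t Ht) as Hwt.
    assert (Eb : b' = b t) by exact (f_equal snd Ey).
    assert (E2 : forall x, Derive_n y 2 x = Derive_n (v t) 2 x).
    { intros x. generalize (f_equal (fun P => fst P x) Ey). simpl. lra. }
    assert (Ek : forall x, y x + -1 * v t x = y 0 + -1 * v t 0).
    { intros x. apply (second_derivative_zero (fun x => y x + -1 * v t x)); [now apply circle_function_lin|].
      intros z. rewrite Derive_n_lin by (apply Hy || apply Hvt). rewrite E2. ring. }
    set (k := y 0 + -1 * v t 0) in Ek.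
    assert (Ek' : forall x, y x = v t (x + 0) + k) by (intros x; rewrite Rplus_0_r; specialize (Ek x); lra).
    assert (F := is_ad_star_formula y b' (fun x => - Derive_n (v t) 2 x) (b t) Hy (Hu _ Hvt)).
    destruct (is_ad_star_unique _ _ _ _ Hn F) as [En En2]. simpl in En2.
    split.
    - exists (fun x => Derive (fun s => v s x) t + - (d - k - b t) * Derive (v t) x). split; [split|].
      + apply circle_function_lin; [exact Hwt|now apply circle_function_Derive].
      + intros x. rewrite Derive_n_lin; [|apply Hwt|now apply smooth_Derive, Hvt].
        pose proof (curve_Derive_2 alpha beta v Hv t x Ht) as D2.
        pose proof (is_derive_opp (V := R1) _ _ _ D2) as D2'.
        pose proof (is_derive_unique _ _ _ (Dn x)) as U1.
        pose proof (is_derive_unique _ _ _ D2') as U2.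
        assert (U : - Derive_n (fun x => Derive (fun s => v s x) t) 2 x =
          - fst n x + d * Derive (fun x => - Derive_n (v t) 2 x) x) by exact (eq_trans (eq_sym U2) U1).
        rewrite En in U. cbv beta iota delta [fst] in U.
        rewrite !Du in U by exact Hvt.
        change (Derive_n (Derive (v t)) 2 x) with (Derive_n (v t) 3 x).
        assert (Ey3 : Derive_n y 3 x = Derive_n (v t) 3 x).
        { rewrite (Derive_n_class (v t) y 0 k 2) by (apply Hvt || exact Ek'). now rewrite Rplus_0_r. }
        assert (Ey1 : Derive y x = Derive (v t) x).
        { rewrite <- (Rplus_0_r x) at 2. apply (Derive_n_class (v t) y 0 k 0); [apply Hvt|exact Ek']. }
        rewrite Ey3, Ey1, Ek', Rplus_0_r in U. lra.
      + exists 0, (d - k - b t). intros x. ring.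
    - rewrite En2, Ropp_0 in Db. exact Db. }
  split; intros t Ht; now apply K.
- intros [H Hb] t Ht.
  pose proof (curve_circle_function alpha beta v Hv t Ht) as Hvt.
  pose proof (curve_velocity_circle_function alpha beta v Hv t Ht) as Hwt.
  destruct (H t Ht) as [w0 [[H0 E0] [c [d Ew]]]].
  exists (v t, b t).
  exists (fun x => Derive (fun x => - Derive_n (v t) 2 x) x * v t x + 2 * (- Derive_n (v t) 2 x * Derive (v t) x) + - b t * Derive_n (v t) 3 x, 0).
  exists (d + b t).
  split; [exact Hvt|]. split; [reflexivity|]. split; [now apply is_ad_star_formula; [|apply Hu]|].
  split.
  + intros x. pose proof (curve_Derive_2 alpha beta v Hv t x Ht) as D2.
    pose proof (is_derive_opp (V := R1) _ _ _ D2) as D2'.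
    change (is_derive (fun s => - Derive_n (v s) 2 x) t
     (- (Derive (fun x => - Derive_n (v t) 2 x) x * v t x + 2 * (- Derive_n (v t) 2 x * Derive (v t) x) + - b t * Derive_n (v t) 3 x) +
      (d + b t) * Derive (fun x => - Derive_n (v t) 2 x) x)).
    rewrite Du by exact Hvt.
    assert (E : Derive_n (fun x => Derive (fun s => v s x) t) 2 x =
       - 2 * Derive (v t) x * Derive_n (v t) 2 x - v t x * Derive_n (v t) 3 x + d * Derive_n (v t) 3 x).
    { rewrite <- E0.
      rewrite (Derive_n_ext _ (fun x => (w0 x + c * 1) + d * Derive (v t) x)).
      2:{ intros z. specialize (Ew z). simpl in Ew. lra. }
      rewrite Derive_n_lin, Derive_n_lin.
      - rewrite (Derive_n_const 1 1 x). change (Derive_n (Derive (v t)) 2 x) with (Derive_n (v t) 3 x).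
        simpl. ring.
      - apply H0.
      - apply smooth_const.
      - apply smooth_lin; [apply H0|apply smooth_const].
      - apply smooth_Derive, Hvt. }
    match type of D2' with is_derive _ _ ?l => match goal with |- is_derive _ _ ?r => replace r with l; [exact D2'|] end end.
    rewrite E. unfold opp; simpl. ring.
  + simpl. rewrite Ropp_0. exact (Hb t Ht).
Qed.

(** Decides membership of sums, products and derivatives of known families. *)
Ltac fam_tac :=
  match goal with
  | H : circle_family _ ?F |- circle_family _ ?F => exact H
  | |- circle_family (P := ?P) ?J (fun z => @?F z + @?G z) => apply (circle_family_plus (P := P) J ltac:(assumption) F G); fam_tac
  | |- circle_family (P := ?P) ?J (fun z => @?F z * @?G z) => apply (circle_family_mult (P := P) J ltac:(assumption) F G); fam_tac
  | |- circle_family (P := ?P) ?J (fun z => ?c) => apply (circle_family_const (P := P) J ltac:(assumption) c)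
  | |- circle_family (P := ?P) ?J (fun z => D1 ?F z) => change (circle_family (P := P) J (D1 F)); fam_tac
  | |- circle_family (P := ?P) ?J (fun z => D2 ?F z) => change (circle_family (P := P) J (D2 F)); fam_tac
  | |- circle_family ?J (D1 ?F) => apply (fam_D1 J ltac:(assumption) F); fam_tac
  | |- circle_family ?J (D2 ?F) => apply (fam_D2 J ltac:(assumption) F); fam_tac
  | |- circle_family (P := ?P) ?J (fun z => ?F z) => change (circle_family (P := P) J F); fam_tac
  | _ => idtac
  end.

Lemma Rminus_scal (a b : R) : a - b = a + -1 * b.
Proof. ring. Qed.

Section FamInt.

Variable J : R -> Prop.
Hypothesis HJ : open J.
Notation fam := (circle_family (P := R1) J).

Lemma fam_int_plus (F G : R * R -> R) t : fam F -> fam G -> J t ->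
  circle_int (fun y => F (t, y) + G (t, y)) = circle_int (fun y => F (t, y)) + circle_int (fun y => G (t, y)).
Proof.
intros HF HG Ht. apply circle_int_plus; intros; now apply (circle_family_continuous (P := R1) J).
Qed.

Lemma fam_int_scal c (F : R * R -> R) t : fam F -> J t ->
  circle_int (fun y => c * F (t, y)) = c * circle_int (fun y => F (t, y)).
Proof.
intros HF Ht. apply circle_int_scal; intros; now apply (circle_family_continuous (P := R1) J).
Qed.

Lemma fam_is_D1_mult (F G : R * R -> R) t y : fam F -> fam G -> J t ->
  D1 (fun z => F z * G z) (t, y) = D1 F (t, y) * G (t, y) + F (t, y) * D1 G (t, y).
Proof.
intros HF HG Ht. apply is_derive_unique.
apply (is_derive_mult (K := R_AbsRing) (fun s => F (s, y)) (fun s => G (s, y))).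
- now apply (fam_is_D1 J).
- now apply (fam_is_D1 J).
- exact Rmult_comm.
Qed.

End FamInt.

(** * The first variation of the energy *)

(** The integrand of the derivative of the energy, for the variation [xi] of
    [L = ln phi_y] and [al] of the central coordinate. *)
Definition variation_density (g : R -> pre_Vir) (xi : R * R -> R) (al : R -> R) (t : R) : R :=
  circle_int (fun y => density g (t, y) *
    (D1 (log_density g) (t, y) * D1 xi (t, y) +
     / 2 * (D1 (log_density g) (t, y) * D1 (log_density g) (t, y)) * xi (t, y))) +
  central_velocity g t * (Derive al t -
    circle_int (fun y => D1 xi (t, y) * D2 (log_density g) (t, y) +
                         D1 (log_density g) (t, y) * D2 xi (t, y))).

(** The conjugate momenta paired with the variation. *)
Definition boundary_term (g : R -> pre_Vir) (xi : R * R -> R) (al : R -> R) (t : R) : R :=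
  circle_int (fun y => density g (t, y) * D1 (log_density g) (t, y) * xi (t, y)) +
  central_velocity g t * (al t - circle_int (fun y => D2 (log_density g) (t, y) * xi (t, y))).

(** The Euler--Lagrange expression [L_tt + L_t^2 / 2 - 2 b L_ty / rho] of the
    energy. Variations of [L] preserve the total length, so a geodesic only has
    to make it independent of [y]. *)
Definition residual (g : R -> pre_Vir) (z : R * R) : R :=
  D1 (D1 (log_density g)) z + / 2 * (D1 (log_density g) z * D1 (log_density g) z) +
  -2 * (central_velocity g (fst z) * (D1 (D2 (log_density g)) z * / density g z)).

Section ByParts.

Variables (J : R -> Prop) (g : R -> pre_Vir).
Hypothesis HJ : open J.
Hypothesis Hg : forall t, J t -> diffeo (fst (g t)).
Hypothesis Hs : smooth_on (V := R2) (cyl J) (flow g).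
Hypothesis Ha : smooth_on (V := R1) J (fun s => snd (g s)).
Notation fam := (circle_family (P := R1) J).
Variables (xi : R * R -> R) (al : R -> R).
Hypothesis Hxi : fam xi.
Hypothesis Hal : smooth_on (V := R1) J al.

Let L := log_density g.
Let rho := density g.
Let HL : fam L := log_density_fam J g HJ Hg Hs.
Let Hrho : fam rho := density_fam J g HJ Hg Hs.

Lemma smooth_central_velocity : smooth_on (V := R1) J (central_velocity g).
Proof.
apply (smooth_alg_smooth (V := R1)); [exact HJ|].
apply (sa_smooth (V := R1) J (fun t => Derive (fun s => snd (g s)) t + -1 * circle_int (fun y => D1 L (t, y) * D2 L (t, y)))).
- apply (smooth_alg_smooth (V := R1)); [exact HJ|].
  apply (sa_plus (V := R1)).
  + apply (smooth_on_alg (V := R1)). now apply (smooth_on_Derive J).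
  + apply (sa_mult (V := R1)); [apply (sa_const (V := R1))|].
    apply (smooth_on_alg (V := R1)).
    apply (fam_int_smooth J HJ (fun z => D1 L z * D2 L z)). fam_tac.
- intros t _. apply Rminus_scal.
Qed.

Lemma density_inv_fam : fam (fun z => / rho z).
Proof.
apply (circle_family_inv (P := R1)); [exact HJ|exact Hrho|].
intros t y Ht. apply Rgt_not_eq. now apply (density_pos J).
Qed.

Lemma residual_fam : fam (residual g).
Proof.
unfold residual. fold L rho.
pose proof density_inv_fam as Hi.
assert (Hb : fam (fun z => central_velocity g (fst z))).
{ apply (circle_family_param (P := R1)); [exact HJ|exact smooth_central_velocity]. }
fam_tac.
Qed.

(** Integration by parts in time, in differential form; doing it for each [t]
    avoids exchanging the integrals in [t] and [y]. The term [D1 L * D2 xi] is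
    integrated by parts in [y], which doubles the coefficient of [L_ty]. *)
Lemma is_derive_boundary_term t : J t ->
  is_derive (boundary_term g xi al) t
    (variation_density g xi al t +
     (circle_int (fun y => rho (t, y) * residual g (t, y) * xi (t, y)) +
      Derive (central_velocity g) t *
        (al t - circle_int (fun y => D2 L (t, y) * xi (t, y))))).
Proof.
intros Ht.
set (I1 := circle_int (fun y => rho (t, y) * D1 L (t, y) * D1 L (t, y) * xi (t, y))).
set (I2 := circle_int (fun y => rho (t, y) * D1 (D1 L) (t, y) * xi (t, y))).
set (I3 := circle_int (fun y => rho (t, y) * D1 L (t, y) * D1 xi (t, y))).
set (I4 := circle_int (fun y => D2 (D1 L) (t, y) * xi (t, y))).
set (I5 := circle_int (fun y => D2 L (t, y) * D1 xi (t, y))).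
set (I6 := circle_int (fun y => D1 L (t, y) * D2 xi (t, y))).
set (b := central_velocity g t).
assert (E6 : I4 = - I6) by (apply (fam_by_parts J HJ (D1 L) xi); [fam_tac|exact Hxi|exact Ht]).
assert (Er : forall y, D1 rho (t, y) = rho (t, y) * D1 L (t, y)) by (intros; now apply (D1_density J)).
assert (Nr : forall y, rho (t, y) <> 0) by (intros; apply Rgt_not_eq; now apply (density_pos J)).
assert (Ev : variation_density g xi al t = I3 + / 2 * I1 + b * (Derive al t - (I5 + I6))).
{ unfold variation_density. fold b. f_equal; [|f_equal; f_equal].
  - unfold I3, I1. rewrite <- (fam_int_scal J HJ (/ 2) (fun z => rho z * D1 L z * D1 L z * xi z)); [|fam_tac|exact Ht].
    rewrite <- (fam_int_plus J HJ (fun z => rho z * D1 L z * D1 xi z) (fun z => / 2 * (rho z * D1 L z * D1 L z * xi z))); [|fam_tac|fam_tac|exact Ht].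
    apply circle_int_ext. intros y. unfold rho, L. ring.
  - unfold I5, I6. rewrite <- (fam_int_plus J HJ (fun z => D2 L z * D1 xi z) (fun z => D1 L z * D2 xi z)); [|fam_tac|fam_tac|exact Ht].
    apply circle_int_ext. intros y. unfold L. ring. }
assert (Eres : circle_int (fun y => rho (t, y) * residual g (t, y) * xi (t, y)) = I2 + / 2 * I1 + (-2 * b) * I4).
{ unfold I1, I2, I4. rewrite <- (fam_int_scal J HJ (/ 2) (fun z => rho z * D1 L z * D1 L z * xi z)); [|fam_tac|exact Ht].
  rewrite <- (fam_int_scal J HJ (-2 * b) (fun z => D2 (D1 L) z * xi z)); [|fam_tac|exact Ht].
  rewrite <- (fam_int_plus J HJ (fun z => rho z * D1 (D1 L) z * xi z) (fun z => / 2 * (rho z * D1 L z * D1 L z * xi z))); [|fam_tac|fam_tac|exact Ht].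
  rewrite <- (fam_int_plus J HJ (fun z => rho z * D1 (D1 L) z * xi z + / 2 * (rho z * D1 L z * D1 L z * xi z)) (fun z => -2 * b * (D2 (D1 L) z * xi z))); [|fam_tac|fam_tac|exact Ht].
  apply circle_int_ext. intros y. unfold residual. fold L rho.
  rewrite (fam_D1_D2 J HJ L (t, y) HL Ht). simpl. fold b. field. apply Nr. }
assert (Da : is_derive (fun s => circle_int (fun y => rho (s, y) * D1 L (s, y) * xi (s, y))) t (I1 + I2 + I3)).
{ replace (I1 + I2 + I3) with (circle_int (fun y => D1 (fun z => rho z * D1 L z * xi z) (t, y))).
  - apply (fam_int_is_derive J HJ (fun z => rho z * D1 L z * xi z)); [fam_tac|exact Ht].
  - unfold I1, I2, I3.
    rewrite <- (fam_int_plus J HJ (fun z => rho z * D1 L z * D1 L z * xi z) (fun z => rho z * D1 (D1 L) z * xi z)); [|fam_tac|fam_tac|exact Ht].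
    rewrite <- (fam_int_plus J HJ (fun z => rho z * D1 L z * D1 L z * xi z + rho z * D1 (D1 L) z * xi z) (fun z => rho z * D1 L z * D1 xi z)); [|fam_tac|fam_tac|exact Ht].
    apply circle_int_ext. intros y.
    rewrite (fam_is_D1_mult J (fun z => rho z * D1 L z) xi); [|fam_tac|exact Hxi|exact Ht].
    rewrite (fam_is_D1_mult J rho (D1 L)); [|exact Hrho|fam_tac|exact Ht].
    rewrite Er. ring. }
assert (Db : is_derive (fun s => circle_int (fun y => D2 L (s, y) * xi (s, y))) t (I4 + I5)).
{ replace (I4 + I5) with (circle_int (fun y => D1 (fun z => D2 L z * xi z) (t, y))).
  - apply (fam_int_is_derive J HJ (fun z => D2 L z * xi z)); [fam_tac|exact Ht].
  - unfold I4, I5.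
    rewrite <- (fam_int_plus J HJ (fun z => D2 (D1 L) z * xi z) (fun z => D2 L z * D1 xi z)); [|fam_tac|fam_tac|exact Ht].
    apply circle_int_ext. intros y.
    rewrite (fam_is_D1_mult J (D2 L) xi); [|fam_tac|exact Hxi|exact Ht].
    now rewrite (fam_D1_D2 J HJ L (t, y) HL Ht). }
assert (Dc : is_derive (central_velocity g) t (Derive (central_velocity g) t)).
{ apply Derive_correct. apply (smooth_on_ex_derive J); [exact smooth_central_velocity|exact Ht]. }
assert (Dd : is_derive al t (Derive al t)) by (apply Derive_correct; now apply (smooth_on_ex_derive J)).
rewrite Ev, Eres.
pose proof (is_derive_minus (V := R1) _ _ _ _ _ Dd Db) as D3.
pose proof (is_derive_mult (K := R_AbsRing) _ _ _ _ _ Dc D3 Rmult_comm) as D4.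
pose proof (is_derive_plus (V := R1) _ _ _ _ _ Da D4) as D5.
match type of D5 with is_derive _ _ ?l => match goal with |- is_derive _ _ ?r => replace r with l; [exact D5|] end end.
change ((I1 + I2 + I3) + (Derive (central_velocity g) t * (al t - circle_int (fun y => D2 L (t, y) * xi (t, y))) + b * (Derive al t - (I4 + I5))) =
 I3 + / 2 * I1 + b * (Derive al t - (I5 + I6)) + (I2 + / 2 * I1 + -2 * b * I4 + Derive (central_velocity g) t * (al t - circle_int (fun y => D2 L (t, y) * xi (t, y))))).
rewrite E6. field.
Qed.

Lemma smooth_boundary_term : smooth_on (V := R1) J (boundary_term g xi al).
Proof.
apply (smooth_alg_smooth (V := R1)); [exact HJ|].
apply (sa_plus (V := R1)).
- apply (smooth_on_alg (V := R1)).
  apply (fam_int_smooth J HJ (fun z => rho z * D1 L z * xi z)). fam_tac.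
- apply (sa_mult (V := R1)); [apply (smooth_on_alg (V := R1)); exact smooth_central_velocity|].
  apply (sa_smooth (V := R1) J (fun t => al t + -1 * circle_int (fun y => D2 L (t, y) * xi (t, y)))); [|intros; apply Rminus_scal].
  apply (smooth_alg_smooth (V := R1)); [exact HJ|].
  apply (sa_plus (V := R1)); [now apply (smooth_on_alg (V := R1))|].
  apply (sa_mult (V := R1)); [apply (sa_const (V := R1))|].
  apply (smooth_on_alg (V := R1)).
  apply (fam_int_smooth J HJ (fun z => D2 L z * xi z)). fam_tac.
Qed.

End ByParts.

(** * Differentiating the energy of a family of curves *)

Definition log_density_variation (gamma : R -> R -> pre_Vir) (z : R * R) : R :=
  Derive (fun s => log_density (gamma s) z) 0.

Definition central_variation (gamma : R -> R -> pre_Vir) (t : R) : R :=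
  Derive (fun s => snd (gamma s t)) 0.

Section FirstVariation.

Variables (eps t0 t1 : R) (gamma : R -> R -> pre_Vir).
Hypothesis Heps : 0 < eps.
Hypothesis Ht01 : t0 < t1.
Hypothesis Hgamma : smooth_Vir_family eps t0 t1 gamma.

Let J t := t0 - eps < t < t1 + eps.
Let Dom (p : R * R) := Rabs (fst p) < eps /\ t0 - eps < snd p < t1 + eps.
Notation fam3 := (circle_family (P := R2) Dom).

Let Phi (z : R * R * R) := fst (gamma (fst (fst z)) (snd (fst z))) (snd z).
Let rho := P3 Phi.
Let L z := ln (rho z).
Let a (p : R * R) := snd (gamma (fst p) (snd p)).
Let xi := log_density_variation gamma.
Let al := central_variation gamma.

Lemma open_time_domain : open J.
Proof. apply (open_and (fun t : R => t0 - eps < t) (fun t : R => t < t1 + eps)); [apply open_gt|apply open_lt]. Qed.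

Lemma open_family_domain : open (T := R2) Dom.
Proof.
apply (open_and (T := R2) (fun p : R * R => Rabs (fst p) < eps) (fun p : R * R => J (snd p))).
- apply (open_comp (T := R2) (fun p : R * R => Rabs (fst p)) (fun r => r < eps)); [|apply open_lt].
  intros p _. apply (continuous_comp (U := R2) fst Rabs); [apply (continuous_fst (U := R_UniformSpace))|apply continuous_Rabs].
- apply (open_comp (T := R2) snd J); [|apply open_time_domain].
  intros p _. apply (continuous_snd (U := R_UniformSpace)).
Qed.

Let HD := open_family_domain.
Let HcD : open (T := R3) (cyl Dom) := open_cyl (P := R2) Dom HD.

Lemma family_diffeo s t : Rabs s < eps -> J t -> diffeo (fst (gamma s t)).
Proof. intros Hs Ht. now apply Hgamma. Qed.

Lemma family_flow_smooth : smooth_on (V := R3) (cyl Dom) Phi.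
Proof. apply Hgamma. Qed.

Lemma family_central_smooth : smooth_on (V := R2) Dom a.
Proof. apply Hgamma. Qed.

Lemma flow_slice_smooth s : Rabs s < eps -> smooth_on (V := R2) (cyl J) (flow (gamma s)).
Proof.
intros Hs. apply (smooth_on_sub (V := R2) (fun z => cyl Dom (s, fst z, snd z))); [now intros|].
apply (smooth_on_slice3 (cyl Dom) HcD Phi s), family_flow_smooth.
Qed.

Lemma central_slice_smooth s : Rabs s < eps -> smooth_on (V := R1) J (fun t => snd (gamma s t)).
Proof.
intros Hs. apply (smooth_on_sub (V := R1) (fun t => Dom (s, t))); [now intros|].
apply (smooth_on_slice (V := R1) (W := R1) Dom a s HD), family_central_smooth.
Qed.

Lemma central_ex_derive s t : Rabs s < eps -> J t -> ex_derive (fun t => snd (gamma s t)) t.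
Proof. intros Hs Ht. apply (smooth_on_ex_derive J); [now apply central_slice_smooth|exact Ht]. Qed.

Lemma family_density_pos p y : Dom p -> 0 < rho (p, y).
Proof. intros [H1 H2]. apply (family_diffeo _ _ H1 H2). Qed.

Lemma family_density_fam : fam3 rho.
Proof.
split; [now apply (smooth_on_P3 (cyl Dom)), family_flow_smooth|].
intros [s t] x [H1 H2].
exact (proj2 (density_fam J (gamma s) open_time_domain (fun t => family_diffeo s t H1) (flow_slice_smooth s H1)) t x H2).
Qed.

Lemma family_log_density_fam : fam3 L.
Proof.
apply (circle_family_ln (P := R2)); [exact HD|exact family_density_fam|]. intros; now apply family_density_pos.
Qed.

Lemma fam3_P1 F : fam3 F -> fam3 (P1 F).
Proof.
intros HF. apply (circle_family_ext (P := R2) Dom HD (ddir (V := R3) (1, 0, 0) F)); [intros; apply P1_ddir|].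
now apply (circle_family_ddir (P := R2)).
Qed.

Lemma fam3_P2 F : fam3 F -> fam3 (P2 F).
Proof.
intros HF. apply (circle_family_ext (P := R2) Dom HD (ddir (V := R3) (0, 1, 0) F)); [intros; apply P2_ddir|].
now apply (circle_family_ddir (P := R2)).
Qed.

Lemma fam3_P3 F : fam3 F -> fam3 (P3 F).
Proof.
intros HF. apply (circle_family_ext (P := R2) Dom HD (ddir (V := R3) (0, 0, 1) F)); [intros; apply P3_ddir|].
now apply (circle_family_ddir (P := R2)).
Qed.

Lemma fam3_int_is_derive F s t : fam3 F -> Dom (s, t) ->
  is_derive (fun s => circle_int (fun y => F (s, t, y))) s (circle_int (fun y => P1 F (s, t, y))).
Proof.
intros [HF _] Ht.
assert (H0 : 0 <= 2 * PI) by (generalize PI_RGT_0; lra).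
pose proof (is_derive_RInt_line (V := R2) (cyl Dom) 0 (2 * PI) HcD H0 F (s, t) (1, 0) HF (fun y _ => Ht)) as K.
unfold circle_int.
rewrite (RInt_ext _ (fun y => ddir (V := R3) (1, 0, 0) F (s, t, y))) by (intros; apply P1_ddir).
set (G := fun r : R => RInt (fun y => F (s + r, t, y)) 0 (2 * PI)).
assert (K' : is_derive G 0 (RInt (fun y => ddir (V := R3) (1, 0, 0) F (s, t, y)) 0 (2 * PI))).
{ revert K. apply is_derive_ext. intros r. apply RInt_ext. intros y _. now rewrite line_D1. }
apply (is_derive_ext (fun r => G (r - s))).
{ intros r. apply RInt_ext. intros y _. now rewrite Rplus_minus. }
assert (E : is_derive (fun r : R => r - s) s 1) by (auto_derive; auto; ring).
rewrite <- (scal_one (V := R1) (RInt _ _ _)).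
apply (is_derive_comp_R G (fun r => r - s)); [|exact E].
rewrite Rminus_diag. exact K'.
Qed.

Lemma Rabs_0_eps : Rabs 0 < eps.
Proof. now rewrite Rabs_R0. Qed.

Lemma Dom0 t : J t -> Dom (0, t).
Proof. intros Ht. split; [exact Rabs_0_eps|exact Ht]. Qed.

Lemma fam3_slice0 F : fam3 F -> circle_family (P := R1) J (fun z => F (0, fst z, snd z)).
Proof.
intros [HF PF]. split.
- apply (smooth_on_sub (V := R2) (fun z => cyl Dom (0, fst z, snd z))).
  { intros z Hz. apply Dom0, Hz. }
  apply (smooth_on_slice3 (cyl Dom) HcD F 0), HF.
- intros t x Ht. apply (PF (0, t) x). now apply Dom0.
Qed.

Lemma log_density_variation_fam : circle_family (P := R1) J xi.
Proof. apply (fam3_slice0 (P1 L)). apply fam3_P1, family_log_density_fam. Qed.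

Lemma central_variation_smooth : smooth_on (V := R1) J al.
Proof.
apply (smooth_on_sub (V := R1) (fun t => Dom (0, t))); [exact Dom0|].
apply (smooth_on_slice (V := R1) (W := R1) Dom (D1 a) 0 HD), (smooth_on_D1 Dom HD), family_central_smooth.
Qed.

Lemma family_density_variation t y : J t -> P1 rho (0, t, y) = rho (0, t, y) * xi (t, y).
Proof.
intros Ht. pose proof (Dom0 t Ht) as H0. pose proof (family_density_pos (0, t) y H0) as Hp.
assert (E : P1 L (0, t, y) = / rho (0, t, y) * P1 rho (0, t, y)).
{ apply is_derive_unique. rewrite Rmult_comm.
  apply (is_derive_comp_R ln (fun s => rho (s, t, y))).
  - now apply is_derive_ln.
  - now apply (is_derive_P1 (cyl Dom)); [apply family_density_fam|]. }
change (xi (t, y)) with (P1 L (0, t, y)). rewrite E. field. lra.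
Qed.

(** The length of the circle does not depend on the deformation parameter. *)
Lemma log_density_variation_mean_zero t : J t -> circle_int (fun y => density (gamma 0) (t, y) * xi (t, y)) = 0.
Proof.
intros Ht.
rewrite <- (circle_int_ext (fun y => P1 rho (0, t, y))) by (intros; now apply family_density_variation).
rewrite <- (is_derive_unique _ _ _ (fam3_int_is_derive rho 0 t family_density_fam (Dom0 t Ht))).
rewrite (Derive_ext_loc _ (fun _ => 2 * PI)); [apply Derive_const|].
assert (Hl : locally (0 : R) (fun s => Rabs s < eps)).
{ exists (mkposreal eps Heps). intros s Hs. change (Rabs (s - 0) < eps) in Hs. now rewrite Rminus_0_r in Hs. }
revert Hl. apply filter_imp. intros s Hs.
exact (circle_int_density J (gamma s) open_time_domain (fun t => family_diffeo s t Hs) (flow_slice_smooth s Hs) t Ht).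
Qed.

Let BB (p : R * R) : R := D2 a p + -1 * circle_int (fun y => P2 L (p, y) * P3 L (p, y)).
Let ee (p : R * R) : R := circle_int (fun y => rho (p, y) * (P2 L (p, y) * P2 L (p, y))) + BB p * BB p.

Lemma central_velocity_alg : smooth_alg (V := R2) Dom BB.
Proof.
apply (sa_plus (V := R2)).
- apply (smooth_on_alg (V := R2)). apply (smooth_on_D2 Dom HD). exact family_central_smooth.
- apply (sa_mult (V := R2)); [apply (sa_const (V := R2))|]. apply (smooth_on_alg (V := R2)).
  apply (circle_family_int (P := R2) Dom HD (fun z => P2 L z * P3 L z)).
  apply (circle_family_mult (P := R2)); [exact HD|apply fam3_P2, family_log_density_fam|apply fam3_P3, family_log_density_fam].
Qed.

Lemma energy_density_smooth : smooth_on (V := R2) Dom (fun p => / 2 * ee p).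
Proof.
apply (smooth_alg_smooth (V := R2)); [exact HD|].
apply (sa_mult (V := R2)); [apply (sa_const (V := R2))|].
apply (sa_plus (V := R2)).
- apply (smooth_on_alg (V := R2)).
  apply (circle_family_int (P := R2) Dom HD (fun z => rho z * (P2 L z * P2 L z))).
  apply (circle_family_mult (P := R2)); [exact HD|exact family_density_fam|].
  apply (circle_family_mult (P := R2)); [exact HD|apply fam3_P2, family_log_density_fam|apply fam3_P2, family_log_density_fam].
- apply (sa_mult (V := R2)); exact central_velocity_alg.
Qed.

Lemma energy_density_eq s t : Rabs s < eps -> J t ->
  H1dot (right_velocity (gamma s) t) (right_velocity (gamma s) t) = ee (s, t).
Proof.
intros Hs Ht.
rewrite (H1dot_right_velocity J (gamma s) open_time_domain (fun t => family_diffeo s t Hs) (flow_slice_smooth s Hs)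
  (fun t => central_ex_derive s t Hs) t Ht).
assert (E : central_velocity (gamma s) t = BB (s, t)) by apply Rminus_scal.
now rewrite E.
Qed.

Lemma derive_energy_density t : J t -> D1 (fun p => / 2 * ee p) (0, t) = variation_density (gamma 0) xi al t.
Proof.
intros Ht. pose proof (Dom0 t Ht) as H0.
pose proof family_log_density_fam as HL. pose proof family_density_fam as Hr.
pose proof (fam3_P1 _ HL) as HL1. pose proof (fam3_P2 _ HL) as HL2. pose proof (fam3_P3 _ HL) as HL3.
assert (HM : forall F G, fam3 F -> fam3 G -> fam3 (fun z => F z * G z)).
{ intros. now apply (circle_family_mult (P := R2)). }
assert (DM : forall F G y, fam3 F -> fam3 G ->
  P1 (fun z => F z * G z) (0, t, y) = P1 F (0, t, y) * G (0, t, y) + F (0, t, y) * P1 G (0, t, y)).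
{ intros F G y HF HG. apply is_derive_unique.
  apply (is_derive_mult (K := R_AbsRing) (fun s => F (s, t, y)) (fun s => G (s, t, y))).
  - now apply (is_derive_P1 (cyl Dom)); [apply HF|].
  - now apply (is_derive_P1 (cyl Dom)); [apply HG|].
  - exact Rmult_comm. }
assert (C : forall F y, fam3 F -> continuous (fun y => F (0, t, y)) y).
{ intros F y HF. now apply (circle_family_continuous (P := R2) Dom HD F (0, t)). }
set (A1 := fun z => rho z * (P2 L z * P2 L z)).
set (A2 := fun z => P2 L z * P3 L z).
assert (HA1 : fam3 A1) by (apply HM; [exact Hr|now apply HM]).
assert (HA2 : fam3 A2) by now apply HM.
pose proof (fam3_int_is_derive A1 0 t HA1 H0) as DA1.
pose proof (fam3_int_is_derive A2 0 t HA2 H0) as DA2.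
assert (Da : is_derive (fun s => D2 a (s, t)) 0 (Derive al t)).
{ change (Derive al t) with (D2 (D1 a) (0, t)). rewrite <- (D1_D2 Dom HD a (0, t) family_central_smooth H0).
  apply (is_derive_D1 Dom); [|exact H0]. apply (smooth_on_D2 Dom HD). exact family_central_smooth. }
set (b := central_velocity (gamma 0) t).
assert (Eb : BB (0, t) = b) by (symmetry; apply Rminus_scal).
assert (X1 : / 2 * circle_int (fun y => P1 A1 (0, t, y)) = circle_int (fun y => density (gamma 0) (t, y) *
    (D1 (log_density (gamma 0)) (t, y) * D1 xi (t, y) +
     / 2 * (D1 (log_density (gamma 0)) (t, y) * D1 (log_density (gamma 0)) (t, y)) * xi (t, y)))).
{ rewrite <- circle_int_scal by (intros; apply (C (P1 A1)); now apply fam3_P1).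
  apply circle_int_ext. intros y. unfold A1.
  rewrite DM, DM by auto. rewrite family_density_variation by exact Ht.
  rewrite (P1_P2 (cyl Dom) HcD L (0, t, y) (proj1 HL) H0).
  change (P2 (P1 L) (0, t, y)) with (D1 xi (t, y)).
  change (P2 L (0, t, y)) with (D1 (log_density (gamma 0)) (t, y)).
  change (rho (0, t, y)) with (density (gamma 0) (t, y)). field. }
assert (X2 : circle_int (fun y => P1 A2 (0, t, y)) = circle_int (fun y => D1 xi (t, y) * D2 (log_density (gamma 0)) (t, y) +
                         D1 (log_density (gamma 0)) (t, y) * D2 xi (t, y))).
{ apply circle_int_ext. intros y. unfold A2. rewrite DM by auto.
  rewrite (P1_P2 (cyl Dom) HcD L (0, t, y) (proj1 HL) H0).
  rewrite (P1_P3 (cyl Dom) HcD L (0, t, y) (proj1 HL) H0). reflexivity. }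
unfold variation_density. fold b. rewrite <- X1, <- X2.
apply is_derive_unique. simpl.
assert (G : forall (f1 f2 f3 : R -> R) l1 l2 l3, is_derive f1 0 l1 -> is_derive f2 0 l2 -> is_derive f3 0 l3 ->
  is_derive (fun s => / 2 * (f1 s + (f3 s + -1 * f2 s) * (f3 s + -1 * f2 s))) 0
   (/ 2 * l1 + (f3 0 + -1 * f2 0) * (l3 - l2))).
{ intros f1 f2 f3 l1 l2 l3 D1' D2' D3'. auto_derive.
  - repeat split; eexists; eassumption.
  - replace (Derive (fun x => f1 x) 0) with l1 by (symmetry; now apply is_derive_unique).
    replace (Derive (fun x => f2 x) 0) with l2 by (symmetry; now apply is_derive_unique).
    replace (Derive (fun x => f3 x) 0) with l3 by (symmetry; now apply is_derive_unique).
    field. }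
rewrite <- Eb. exact (G _ _ _ _ _ _ DA1 DA2 Da).
Qed.

Lemma first_variation :
  is_derive (fun s => energy (gamma s) t0 t1) 0 (RInt (variation_density (gamma 0) xi al) t0 t1).
Proof.
assert (HJt : forall t, t0 <= t <= t1 -> J t) by (unfold J; intros; lra).
rewrite (RInt_ext _ (fun t => D1 (fun p => / 2 * ee p) (0, t))).
2:{ intros t Ht. rewrite Rmin_left, Rmax_right in Ht by lra. symmetry. apply derive_energy_density. apply HJt. lra. }
apply (is_derive_ext_loc (fun s => RInt (fun t => / 2 * ee (s, t)) t0 t1)).
- exists (mkposreal eps Heps). intros s Hs. change (Rabs (s - 0) < eps) in Hs. rewrite Rminus_0_r in Hs.
  apply RInt_ext. intros t Ht. rewrite Rmin_left, Rmax_right in Ht by lra.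
  rewrite energy_density_eq; [reflexivity|exact Hs|apply HJt; lra].
- apply (RInt_is_derive_D1 Dom (fun p => / 2 * ee p)); [exact HD|lra|exact energy_density_smooth|].
  intros t Ht. apply Dom0. now apply HJt.
Qed.

Lemma first_variation_by_parts :
  RInt (variation_density (gamma 0) xi al) t0 t1 =
  boundary_term (gamma 0) xi al t1 - boundary_term (gamma 0) xi al t0 -
  RInt (fun t => circle_int (fun y => density (gamma 0) (t, y) * residual (gamma 0) (t, y) * xi (t, y)) +
      Derive (central_velocity (gamma 0)) t *
        (al t - circle_int (fun y => D2 (log_density (gamma 0)) (t, y) * xi (t, y)))) t0 t1.
Proof.
set (g := gamma 0).
assert (Hg : forall t, J t -> diffeo (fst (g t))) by (intros; apply family_diffeo; [exact Rabs_0_eps|assumption]).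
pose proof (flow_slice_smooth 0 Rabs_0_eps) as Hs. fold g in Hs.
pose proof (central_slice_smooth 0 Rabs_0_eps) as Ha. fold g in Ha.
pose proof open_time_domain as HJ. pose proof log_density_variation_fam as Hxi. pose proof central_variation_smooth as Hal.
pose proof (log_density_fam J g HJ Hg Hs) as HL.
pose proof (density_fam J g HJ Hg Hs) as Hr.
pose proof (residual_fam J g HJ Hg Hs Ha) as HR.
set (Rt := fun t => circle_int (fun y => density g (t, y) * residual g (t, y) * xi (t, y)) +
      Derive (central_velocity g) t *
        (al t - circle_int (fun y => D2 (log_density g) (t, y) * xi (t, y)))).
assert (HRt : smooth_on (V := R1) J Rt).
{ apply (smooth_alg_smooth (V := R1)); [exact HJ|].
  apply (sa_plus (V := R1)).
  - apply (smooth_on_alg (V := R1)).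
    apply (fam_int_smooth J HJ (fun z => density g z * residual g z * xi z)). fam_tac.
  - apply (sa_mult (V := R1)).
    + apply (smooth_on_alg (V := R1)). apply (smooth_on_Derive J); [exact HJ|].
      now apply smooth_central_velocity.
    + apply (sa_smooth (V := R1) J (fun t => al t + -1 * circle_int (fun y => D2 (log_density g) (t, y) * xi (t, y)))); [|intros; apply Rminus_scal].
      apply (smooth_alg_smooth (V := R1)); [exact HJ|].
      apply (sa_plus (V := R1)); [now apply (smooth_on_alg (V := R1))|].
      apply (sa_mult (V := R1)); [apply (sa_const (V := R1))|].
      apply (smooth_on_alg (V := R1)).
      apply (fam_int_smooth J HJ (fun z => D2 (log_density g) z * xi z)). fam_tac. }
pose proof (smooth_boundary_term J g HJ Hg Hs Ha xi al Hxi Hal) as Hb.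
pose proof (is_derive_boundary_term J g HJ Hg Hs Ha xi al Hxi Hal) as Db.
assert (HJt : forall t, Rmin t0 t1 <= t <= Rmax t0 t1 -> J t).
{ intros t. rewrite Rmin_left, Rmax_right by lra. unfold J. lra. }
assert (Eb : RInt (Derive (boundary_term g xi al)) t0 t1 = boundary_term g xi al t1 - boundary_term g xi al t0).
{ apply RInt_Derive.
  - intros t Ht. apply (smooth_on_ex_derive J); auto.
  - intros t Ht. apply (smooth_on_continuous (V := R1) J); [|now apply HJt].
    now apply (smooth_on_Derive J). }
rewrite <- Eb. fold Rt.
rewrite (RInt_ext (variation_density g xi al) (fun t => minus (Derive (boundary_term g xi al) t) (Rt t))).
2:{ intros t Ht. assert (Jt : J t) by (apply HJt; lra).
  rewrite (is_derive_unique _ _ _ (Db t Jt)).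
  change (variation_density g xi al t = variation_density g xi al t + Rt t - Rt t). ring. }
apply (RInt_minus (V := R_CompleteNormedModule)); apply (ex_RInt_continuous (V := R_CompleteNormedModule)); intros t Ht.
- apply (smooth_on_continuous (V := R1) J); [|now apply HJt].
  now apply (smooth_on_Derive J).
- apply (smooth_on_continuous (V := R1) J); [exact HRt|now apply HJt].
Qed.

End FirstVariation.

Lemma same_coset_Derive g h y : diffeo (fst g) -> same_right_coset g h ->
  Derive (fst h) y = Derive (fst g) y.
Proof.
intros Hg Hh. apply same_right_coset_iff in Hh; [|exact Hg]. destruct Hh as [[theta E] _].
rewrite (Derive_ext _ _ y E), Derive_plus, Derive_const; [apply Rplus_0_r| |apply ex_derive_const].
eexists. now apply diffeo_is_derive.
Qed.

(** Left translation by rotations, even depending on time in a way that is not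
    smooth, does not change [phi_x]; hence it changes none of the quantities in
    the first variation. *)
Section SameCosets.

Variables (J : R -> Prop) (g h : R -> pre_Vir).
Hypothesis HJ : open J.
Hypothesis Hg : forall t, J t -> diffeo (fst (g t)).
Hypothesis Hgh : forall t, J t -> same_right_coset (g t) (h t).

Let HcJ : open (T := R2) (cyl J) := open_cyl (P := R1) J HJ.

Lemma same_density z : cyl J z -> density h z = density g z.
Proof. destruct z as [t y]. intros Ht. exact (same_coset_Derive (g t) (h t) y (Hg t Ht) (Hgh t Ht)). Qed.

Lemma same_log_density z : cyl J z -> log_density h z = log_density g z.
Proof. intros Hz. unfold log_density. now rewrite same_density. Qed.

Lemma same_D1_log_density z : cyl J z -> D1 (log_density h) z = D1 (log_density g) z.
Proof. apply (D1_ext (cyl J) HcJ). exact same_log_density. Qed.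

Lemma same_D2_log_density z : cyl J z -> D2 (log_density h) z = D2 (log_density g) z.
Proof. apply (D2_ext (cyl J) HcJ). exact same_log_density. Qed.

Lemma same_central_velocity t : J t -> central_velocity h t = central_velocity g t.
Proof.
intros Ht. unfold central_velocity. f_equal.
- apply Derive_ext_loc. generalize (HJ t Ht). apply filter_imp. intros s Hs.
  apply same_right_coset_iff with (h := h s); [now apply Hg|now apply Hgh].
- apply circle_int_ext. intros y. now rewrite same_D1_log_density, same_D2_log_density.
Qed.

Lemma same_residual z : cyl J z -> residual h z = residual g z.
Proof.
intros Hz. unfold residual.
rewrite (D1_ext (cyl J) HcJ (D1 (log_density h)) (D1 (log_density g)) z same_D1_log_density Hz).
rewrite (D1_ext (cyl J) HcJ (D2 (log_density h)) (D2 (log_density g)) z same_D2_log_density Hz).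
rewrite same_D1_log_density, same_central_velocity, same_density by exact Hz. reflexivity.
Qed.

End SameCosets.

(** * From Lagrangian to Eulerian coordinates *)

(** Its derivative in [x] is the difference of the two sides of the
    Hunter--Saxton equation, up to a multiple [c v_xxx]. *)
Definition HS_form (vh : R * R -> R) (c : R -> R) (z : R * R) : R :=
  D1 (D2 vh) z + D2 (D2 vh) z * (vh z + c (fst z)) + / 2 * (D2 vh z * D2 vh z).

Section Eulerian.

Variables (J : R -> Prop) (g : R -> pre_Vir) (vh : R * R -> R) (q : R -> R).
Hypothesis HJ : open J.
Hypothesis Hvh : circle_family (P := R1) J vh.

Lemma is_derive_HS_form c t x : J t -> is_derive (fun y => HS_form vh c (t, y)) x
  (D2 (D2 (D1 vh)) (t, x) + 2 * D2 vh (t, x) * D2 (D2 vh) (t, x) + (vh (t, x) + c t) * D2 (D2 (D2 vh)) (t, x)).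
Proof.
intros Ht.
pose proof (fam_D2 J HJ vh Hvh) as H2. pose proof (fam_D2 J HJ _ H2) as H22.
pose proof (fam_D1 J HJ _ H2) as H12.
pose proof (fam_is_D2 J vh t x Hvh Ht) as d0.
pose proof (fam_is_D2 J _ t x H2 Ht) as d1.
pose proof (fam_is_D2 J _ t x H22 Ht) as d2.
pose proof (fam_is_D2 J _ t x H12 Ht) as d3.
assert (E : D2 (D1 (D2 vh)) (t, x) = D2 (D2 (D1 vh)) (t, x)).
{ apply (D2_ext (cyl J)); [now apply (open_cyl (P := R1))| |exact Ht].
  intros z Hz. now apply (fam_D1_D2 J HJ). }
rewrite <- E.
assert (A : forall (f0 f1 f2 f3 : R -> R) (l0 l1 l2 l3 k : R),
  is_derive f0 x l0 -> is_derive f1 x l1 -> is_derive f2 x l2 -> is_derive f3 x l3 ->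
  is_derive (fun y => f3 y + f2 y * (f0 y + k) + / 2 * (f1 y * f1 y)) x
    (l3 + (f1 x * l1 + f2 x * l0) + (f0 x + k) * l2)).
{ intros f0 f1 f2 f3 l0 l1 l2 l3 k h0 h1 h2 h3. auto_derive; [repeat split; eexists; eassumption|].
  replace (Derive (fun x => f0 x) x) with l0 by (symmetry; now apply is_derive_unique).
  replace (Derive (fun x => f1 x) x) with l1 by (symmetry; now apply is_derive_unique).
  replace (Derive (fun x => f2 x) x) with l2 by (symmetry; now apply is_derive_unique).
  replace (Derive (fun x => f3 x) x) with l3 by (symmetry; now apply is_derive_unique).
  field. }
pose proof (A _ _ _ _ _ _ _ _ (c t) d0 d1 d2 d3) as K.
match type of K with is_derive _ _ ?l => match goal with |- is_derive _ _ ?r => replace r with l; [exact K|] end end.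
cbv beta. change (AbsRing.sort R_AbsRing) with R. ring.
Qed.

Hypothesis Hg : forall t, J t -> diffeo (fst (g t)).
Hypothesis Hs : smooth_on (V := R2) (cyl J) (flow g).
Hypothesis Hvel : forall t y, J t -> D1 (flow g) (t, y) = vh (t, flow g (t, y)) + q t.

Let L := log_density g.
Let rho := density g.
Let HcJ : open (T := R2) (cyl J) := open_cyl (P := R1) J HJ.

Lemma D1_log_density_eulerian t y : J t -> D1 L (t, y) = D2 vh (t, flow g (t, y)).
Proof.
intros Ht. unfold L. rewrite (D1_log_density J g HJ Hg Hs t y Ht), (D1_density_velocity J g HJ Hs t y Ht).
assert (E : D2 (D1 (flow g)) (t, y) = D2 vh (t, flow g (t, y)) * rho (t, y)).
{ apply is_derive_unique. simpl.
  apply (is_derive_ext (fun s => vh (t, flow g (t, s)) + q t)).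
  { intros s. symmetry. now apply Hvel. }
  rewrite <- (Rplus_0_r (_ * _)).
  apply (is_derive_plus (V := R1)); [|apply (is_derive_const (V := R1))].
  rewrite Rmult_comm.
  apply (is_derive_comp_R (fun x => vh (t, x)) (fun s => flow g (t, s))).
  - now apply (fam_is_D2 J).
  - now apply (is_derive_D2 (cyl J)). }
rewrite E. unfold Rdiv. rewrite Rmult_assoc, Rinv_r; [apply Rmult_1_r|].
apply Rgt_not_eq. now apply (density_pos J).
Qed.

(** The Euler--Lagrange expression in Eulerian coordinates: since
    [L_t = v_x o phi], the chain rule gives [L_tt = (v_tx + (v + q) v_xx) o phi]
    and [L_ty / rho = v_xx o phi]. *)
Lemma residual_eulerian t y : J t -> residual g (t, y) =
  HS_form vh (fun t => q t + -2 * central_velocity g t) (t, flow g (t, y)).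
Proof.
intros Ht.
pose proof (fam_D2 J HJ vh Hvh) as H2.
pose proof (log_density_fam J g HJ Hg Hs) as HL.
assert (E1 : D1 (D1 L) (t, y) = D1 (D2 vh) (t, flow g (t, y)) * 1 + D2 (D2 vh) (t, flow g (t, y)) * D1 (flow g) (t, y)).
{ apply is_derive_unique. simpl.
  apply (is_derive_ext_loc (fun s => D2 vh (s, flow g (s, y)))).
  { generalize (HJ t Ht). apply filter_imp. intros s Hs'. symmetry. now apply D1_log_density_eulerian. }
  apply (is_derive_curve (cyl J) HcJ (D2 vh) (fun s => s) (fun s => flow g (s, y))).
  - apply H2.
  - exact Ht.
  - apply (is_derive_id (K := R_AbsRing)).
  - now apply (is_derive_D1 (cyl J)). }
assert (E2 : D1 (D2 L) (t, y) = D2 (D2 vh) (t, flow g (t, y)) * rho (t, y)).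
{ rewrite (fam_D1_D2 J HJ L (t, y) HL Ht). apply is_derive_unique. simpl.
  apply (is_derive_ext (fun s => D2 vh (t, flow g (t, s)))).
  { intros s. symmetry. now apply D1_log_density_eulerian. }
  rewrite Rmult_comm.
  apply (is_derive_comp_R (fun x => D2 vh (t, x)) (fun s => flow g (t, s))).
  - now apply (fam_is_D2 J).
  - now apply (is_derive_D2 (cyl J)). }
unfold residual, HS_form. fold L rho.
rewrite E1, E2, D1_log_density_eulerian, Hvel by exact Ht. simpl. field.
apply Rgt_not_eq. now apply (density_pos J).
Qed.

End Eulerian.

(** * The velocity of a curve in the group *)

Section GroupCurve.

Variables (alpha beta : Rbar) (g : R -> pre_Vir).
Hypothesis Hg : smooth_Vir_curve alpha beta g.
Notation T := (time_interval alpha beta).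

Lemma curve_diffeo t : T t -> diffeo (fst (g t)).
Proof. apply Hg. Qed.

Lemma curve_flow_smooth : smooth_on (V := R2) (cyl T) (flow g).
Proof. apply Hg. Qed.

Lemma curve_central_smooth : smooth_on (V := R1) T (fun t => snd (g t)).
Proof. apply smooth_on_interval_iff, Hg. Qed.

Lemma has_right_velocity_lagrangian v b t : has_right_velocity alpha beta g v b -> T t ->
  (forall y, D1 (flow g) (t, y) = v t (flow g (t, y))) /\ central_velocity g t = b t.
Proof.
intros Hv Ht. destruct (Hv t Ht) as [H1 H2]. split.
- intros y. rewrite <- H1, right_velocity_fst. do 2 f_equal.
  symmetry. apply (diffeo_inv_l _ (curve_diffeo t Ht)).
- rewrite <- H2. symmetry. apply (right_velocity_snd T).
  + apply open_time_interval.
  + exact curve_diffeo.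
  + exact curve_flow_smooth.
  + intros s Hs. apply (smooth_on_ex_derive T); [exact curve_central_smooth|exact Hs].
  + exact Ht.
Qed.

End GroupCurve.

(** * Solutions lift to geodesics *)

(** The coset at time [t] is fixed, hence the variation fields vanish there. *)
Lemma boundary_term_fixed eps t0 t1 gamma g t : 0 < eps ->
  smooth_Vir_family eps t0 t1 gamma -> t0 - eps < t < t1 + eps -> diffeo (fst g) ->
  (forall s, Rabs s < eps -> same_right_coset g (gamma s t)) ->
  boundary_term (gamma 0) (log_density_variation gamma) (central_variation gamma) t = 0.
Proof.
intros He Hf Ht Hg Hs.
assert (Hl : locally (0 : R) (fun s => Rabs s < eps)).
{ exists (mkposreal eps He). intros s Hs'. change (Rabs (s - 0) < eps) in Hs'. now rewrite Rminus_0_r in Hs'. }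
assert (Ex : forall y, log_density_variation gamma (t, y) = 0).
{ intros y. unfold log_density_variation.
  rewrite (Derive_ext_loc _ (fun _ => ln (Derive (fst g) y))); [apply Derive_const|].
  revert Hl. apply filter_imp. intros s Hs'.
  exact (f_equal ln (same_coset_Derive g (gamma s t) y Hg (Hs s Hs'))). }
assert (Ea : central_variation gamma t = 0).
{ unfold central_variation.
  rewrite (Derive_ext_loc _ (fun _ => snd g)); [apply Derive_const|].
  revert Hl. apply filter_imp. intros s Hs'.
  apply (same_right_coset_iff g (gamma s t) Hg), Hs, Hs'. }
assert (Z : forall F : R -> R, circle_int (fun y => F y * log_density_variation gamma (t, y)) = 0).
{ intros F. rewrite (circle_int_ext _ (fun _ => 0)) by (intros; rewrite Ex; ring).
  unfold circle_int. rewrite RInt_const. apply Rmult_0_r. }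
unfold boundary_term. rewrite !Z, Ea. ring.
Qed.

(** If the Euler--Lagrange expression is [lambda t] and the central velocity is
    constant, then the first variation reduces to [lambda t] times the mean of a
    variation of [ln phi_y] against [phi_y], which is zero. *)
Lemma lifts_geodesic_of_residual alpha beta g (lambda : R -> R) b :
  smooth_Vir_curve alpha beta g ->
  (forall t, time_interval alpha beta t -> central_velocity g t = b) ->
  (forall t y, time_interval alpha beta t -> residual g (t, y) = lambda t) ->
  lifts_geodesic alpha beta g.
Proof.
intros Hg Hb Hr t0 t1 T0 T1 Ht eps gamma He Hf Hcos Hend.
assert (TT : forall t, t0 <= t <= t1 -> time_interval alpha beta t).
{ intros t [H0 H1]. split.
  - apply Rbar_lt_le_trans with t0; [apply T0|exact H0].
  - apply Rbar_le_lt_trans with t1; [exact H1|apply T1]. }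
pose proof (first_variation eps t0 t1 gamma He Ht Hf) as FV.
rewrite (first_variation_by_parts eps t0 t1 gamma He Ht Hf) in FV.
rewrite (boundary_term_fixed eps t0 t1 gamma (g t0) t0) in FV; auto; [|lra|now apply (curve_diffeo alpha beta)|intros s Hs; now apply Hend].
rewrite (boundary_term_fixed eps t0 t1 gamma (g t1) t1) in FV; auto; [|lra|now apply (curve_diffeo alpha beta)|intros s Hs; now apply Hend].
set (J := fun t => t0 < t < t1).
assert (HJ : open J) by (apply (open_and (fun t : R => t0 < t) (fun t : R => t < t1)); [apply open_gt|apply open_lt]).
assert (Hd : forall t, J t -> diffeo (fst (g t))).
{ intros t Jt. apply (curve_diffeo alpha beta g Hg). apply TT. unfold J in Jt. lra. }
assert (Hc : forall t, J t -> same_right_coset (g t) (gamma 0 t)).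
{ intros t Jt. apply Hcos. unfold J in Jt. lra. }
match type of FV with is_derive _ _ ?l => replace l with 0 in FV; [exact FV|] end.
match goal with |- 0 = _ - RInt ?f _ _ => rewrite (RInt_ext f (fun _ => 0)) end.
{ assert (Z : forall r : R, 0 = 0 - 0 - r * 0) by (intros; ring).
  rewrite RInt_const. exact (Z (t1 - t0)). }
intros t Jt. rewrite Rmin_left, Rmax_right in Jt by lra. change (J t) in Jt.
assert (Tt : time_interval alpha beta t) by (apply TT; unfold J in Jt; lra).
assert (Eb : Derive (central_velocity (gamma 0)) t = 0).
{ rewrite (Derive_ext_loc _ (fun _ => b)); [apply Derive_const|].
  generalize (HJ t Jt). apply filter_imp. intros s Js.
  rewrite (same_central_velocity J g (gamma 0) HJ Hd Hc s Js). apply Hb. apply TT. unfold J in Js. lra. }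
rewrite Eb, Rmult_0_l, Rplus_0_r.
rewrite (circle_int_ext _ (fun y => lambda t * (density (gamma 0) (t, y) * log_density_variation gamma (t, y)))).
2:{ intros y. rewrite (same_residual J g (gamma 0) HJ Hd Hc (t, y) Jt), Hr by exact Tt. ring. }
assert (Jt' : t0 - eps < t < t1 + eps) by (unfold J in Jt; lra).
rewrite circle_int_scal.
- rewrite (log_density_variation_mean_zero eps t0 t1 gamma He Hf t Jt'). apply Rmult_0_r.
- intros y.
  apply (circle_family_continuous (P := R1) (fun t => t0 - eps < t < t1 + eps)
     (open_time_domain eps t0 t1) (fun z => density (gamma 0) z * log_density_variation gamma z)); [|exact Jt'].
  + apply (circle_family_mult (P := R1)); [apply (open_time_domain eps t0 t1)| |].
    * apply density_fam; [apply (open_time_domain eps t0 t1)| |].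
      -- intros s Js. apply (family_diffeo eps t0 t1 gamma Hf); [rewrite Rabs_R0; exact He|exact Js].
      -- apply (flow_slice_smooth eps t0 t1 gamma Hf). rewrite Rabs_R0; exact He.
    * apply (log_density_variation_fam eps t0 t1 gamma He Hf).
Qed.

(** For each [t] some coefficient [d] exists by definition, and the point is that
    it can be chosen smoothly in [t]. Pairing the equation with [v_xxx] determines
    it, unless [v t] is constant. But the energy, the integral of [v_x^2], is
    conserved, so [v t] is constant either for all [t], and then [d = 0] will do,
    or for no [t]. *)
Lemma HS_coefficient alpha beta v : smooth_circle_curve alpha beta v ->
  HS_class_solution alpha beta v ->
  exists d : R -> R, smooth_on_interval alpha beta d /\
    forall t x, time_interval alpha beta t ->
    Derive_n (fun x => Derive (fun s => v s x) t) 2 x =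
      - 2 * Derive (v t) x * Derive_n (v t) 2 x - v t x * Derive_n (v t) 3 x + d t * Derive_n (v t) 3 x.
Proof.
intros Hv Hsol.
set (T := time_interval alpha beta).
pose proof (open_time_interval alpha beta : open T) as HT.
set (vh := curve_family v).
pose proof (curve_fam alpha beta v Hv : circle_family (P := R1) T vh) as HF.
assert (Hpt : forall t, T t -> exists d, forall x,
    Derive_n (fun x => Derive (fun s => v s x) t) 2 x =
      - 2 * Derive (v t) x * Derive_n (v t) 2 x - v t x * Derive_n (v t) 3 x + d * Derive_n (v t) 3 x).
{ intros t Ht. destruct (Hsol t Ht) as [w0 [[H0 E0] [c [d Ew]]]]. exists d. intros x.
  pose proof (curve_circle_function alpha beta v Hv t Ht) as Hvt.
  rewrite <- E0.
  rewrite (Derive_n_ext _ (fun x => (w0 x + c * 1) + d * Derive (v t) x)).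
  2:{ intros z. specialize (Ew z). simpl in Ew. lra. }
  rewrite Derive_n_lin, Derive_n_lin.
  - rewrite (Derive_n_const 1 1 x). change (Derive_n (Derive (v t)) 2 x) with (Derive_n (v t) 3 x). ring.
  - apply H0.
  - apply smooth_const.
  - apply smooth_lin; [apply H0|apply smooth_const].
  - apply smooth_Derive, Hvt. }
set (e := fun t => circle_int (fun x => D2 vh (t, x) * D2 vh (t, x))).
pose proof (fam_D2 T HT _ HF) as HF2. pose proof (fam_D2 T HT _ HF2) as HF22.
pose proof (fam_D2 T HT _ HF22) as HF222.
pose proof (fam_D1 T HT _ HF) as HF1.
(* pairing the equation with [v] leaves an exact derivative *)
assert (De : forall t, T t -> is_derive e t 0).
{ intros t Ht. destruct (Hpt t Ht) as [d Ed].
  replace 0 with (circle_int (fun x => D1 (fun z => D2 vh z * D2 vh z) (t, x))).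
  { apply (fam_int_is_derive T HT (fun z => D2 vh z * D2 vh z)); [|exact Ht].
    now apply (circle_family_mult (P := R1)). }
  pose proof (curve_circle_function alpha beta v Hv t Ht) as Hvt.
  pose proof (circle_function_Derive_n _ 1 Hvt) as Hv1. pose proof (circle_function_Derive_n _ 2 Hvt) as Hv2.
  pose proof (circle_function_Derive_n _ 3 Hvt) as Hv3.
  pose proof (curve_velocity_circle_function alpha beta v Hv t Ht) as Hw.
  set (w := fun x => Derive (fun s => v s x) t) in *.
  set (u := v t) in *.
  pose proof (circle_function_Derive_n _ 1 Hw) as Hw1.
  assert (E : forall x, D1 (fun z => D2 vh z * D2 vh z) (t, x) = 0 + 2 * (Derive w x * Derive u x)).
  { intros x. rewrite (fam_is_D1_mult T (D2 vh) (D2 vh) t x HF2 HF2 Ht).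
    rewrite (fam_D1_D2 T HT vh (t, x) HF Ht).
    change (Derive w x * Derive u x + Derive u x * Derive w x = 0 + 2 * (Derive w x * Derive u x)). ring. }
  rewrite (circle_int_ext _ _ E).
  rewrite (circle_int_comb (fun _ => 0) (fun x => Derive w x * Derive u x) 2 (circle_function_const 0) (circle_function_mult _ _ Hw1 Hv1)).
  assert (B1 := circle_function_by_parts (Derive w) u Hw1 Hvt).
  assert (B2 := circle_function_by_parts (fun x => u x * u x) (Derive_n u 2) (circle_function_mult _ _ Hvt Hvt) Hv2).
  assert (B3 := circle_function_by_parts u (Derive_n u 2) Hvt Hv2).
  assert (B4 := circle_function_by_parts (Derive u) (Derive u) Hv1 Hv1).
  change (Derive (Derive u)) with (Derive_n u 2) in B4.
  change (Derive (Derive_n u 2)) with (Derive_n u 3) in B2, B3.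
  rewrite (circle_int_ext (fun x => Derive u x * Derive_n u 2 x) (fun x => Derive_n u 2 x * Derive u x)) in B4 by (intros; ring).
  rewrite (circle_int_ext (fun x => Derive u x * Derive_n u 2 x) (fun x => Derive_n u 2 x * Derive u x)) in B3 by (intros; ring).
  assert (E1 : circle_int (fun x => Derive (Derive w) x * u x) =
     circle_int (fun x => (- (1) * (Derive (fun x => u x * u x) x * Derive_n u 2 x) + (-1) * (u x * u x * Derive_n u 3 x)) + d * (u x * Derive_n u 3 x))).
  { apply circle_int_ext. intros x. change (Derive (Derive w) x) with (Derive_n w 2 x).
    rewrite Ed. rewrite Derive_mult by (apply smooth_ex_derive, Hvt). ring. }
  assert (M1 : circle_function (fun x => Derive (fun x => u x * u x) x * Derive_n u 2 x)).
  { apply circle_function_mult; [|exact Hv2]. apply circle_function_Derive. now apply circle_function_mult. }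
  assert (M2 : circle_function (fun x => u x * u x * Derive_n u 3 x)).
  { apply circle_function_mult; [now apply circle_function_mult|exact Hv3]. }
  assert (M3 : circle_function (fun x => u x * Derive_n u 3 x)) by now apply circle_function_mult.
  assert (M1' : circle_function (fun x => - (1) * (Derive (fun x => u x * u x) x * Derive_n u 2 x))).
  { apply (circle_function_ext (fun x => 0 + -1 * (Derive (fun x => u x * u x) x * Derive_n u 2 x))); [intros; ring|].
    apply circle_function_lin; [apply circle_function_const|exact M1]. }
  rewrite (circle_int_comb (fun x => - (1) * (Derive (fun x => u x * u x) x * Derive_n u 2 x) + (-1) * (u x * u x * Derive_n u 3 x)) (fun x => u x * Derive_n u 3 x)) in E1; [|now apply circle_function_lin|exact M3].
  rewrite (circle_int_comb (fun x => - (1) * (Derive (fun x => u x * u x) x * Derive_n u 2 x)) (fun x => u x * u x * Derive_n u 3 x)) in E1 by assumption.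
  rewrite circle_int_scal in E1 by (intros; now apply circle_function_continuous).
  assert (Z0 : circle_int (fun _ => 0) = 0) by (unfold circle_int; rewrite RInt_const; apply Rmult_0_r).
  rewrite Z0. 
  assert (Z3 : circle_int (fun x => u x * Derive_n u 3 x) = 0) by lra.
  rewrite Z3 in E1. lra. }
assert (Ee : forall t s, T t -> T s -> e t = e s).
{ assert (Ho : forall t s, T t -> T s -> t < s -> e t = e s).
  { intros t s [Ht _] [_ Hs] Hts. apply (eq_is_derive e); [|exact Hts]. intros r Hr. apply De. split.
    - apply Rbar_lt_le_trans with t; [exact Ht|apply Hr].
    - apply Rbar_le_lt_trans with s; [apply Hr|exact Hs]. }
  intros t s Ht Hs. destruct (Rtotal_order t s) as [H|[->|H]]; [now apply Ho|reflexivity|symmetry; now apply Ho]. }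
assert (Cf : forall F, circle_family (P := R1) T F -> forall t x, T t -> continuous (fun x => F (t, x)) x).
{ intros F HFF t x Ht. now apply (circle_family_continuous (P := R1) T). }
destruct (Classical_Prop.classic (exists t, T t /\ e t = 0)) as [[ts [Hts Ets]]|N].
-   exists (fun _ => 0). split; [apply smooth_on_interval_iff; apply (smooth_alg_smooth (V := R1)); [exact HT|apply (sa_const (V := R1))]|].
  intros t x Ht. destruct (Hpt t Ht) as [d Ed]. rewrite Ed.
  assert (Z : forall x, Derive (v t) x = 0).
  { apply (circle_sq_zero (fun x => D2 vh (t, x))).
    - now apply (circle_family_periodic (P := R1) T).
    - intros y. now apply Cf.
    - change (e t = 0). rewrite <- Ets. now apply Ee. }
  assert (Z2 : forall x, Derive_n (v t) 2 x = 0).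
  { intros y. change (Derive (Derive (v t)) y = 0). rewrite (Derive_ext _ _ y Z). apply Derive_const. }
  assert (Z3 : Derive_n (v t) 3 x = 0).
  { change (Derive (Derive_n (v t) 2) x = 0). rewrite (Derive_ext _ _ x Z2). apply Derive_const. }
  rewrite Z3. ring.
- set (Dn := fun t => circle_int (fun x => D2 (D2 (D2 vh)) (t, x) * D2 (D2 (D2 vh)) (t, x))).
  set (G := fun z => D2 (D2 (D1 vh)) z + 2 * (D2 vh z * D2 (D2 vh) z) + vh z * D2 (D2 (D2 vh)) z).
  set (Nn := fun t => circle_int (fun x => G (t, x) * D2 (D2 (D2 vh)) (t, x))).
  assert (HG : circle_family (P := R1) T G) by (unfold G; fam_tac).
  assert (NZ : forall t, T t -> Dn t <> 0).
  { intros t Ht E. apply N. exists t. split; [exact Ht|].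
    pose proof (curve_circle_function alpha beta v Hv t Ht) as Hvt.
    assert (Z3 : forall x, Derive_n (v t) 3 x = 0).
    { apply (circle_sq_zero (fun x => D2 (D2 (D2 vh)) (t, x))).
      - now apply (circle_family_periodic (P := R1) T).
      - intros y. now apply Cf.
      - exact E. }
    pose proof (circle_function_Derive _ Hvt) as Hv1.
    assert (Z1 : forall x, Derive (v t) x = Derive (v t) 0).
    { intros x. apply (second_derivative_zero (Derive (v t)) Hv1). exact Z3. }
    assert (Z0 : Derive (v t) 0 = 0).
    { apply (periodic_derive_const (v t)); [apply Hvt|]. intros x. rewrite <- (Z1 x). now apply circle_function_is_derive. }
    unfold e. rewrite (circle_int_ext _ (fun _ => 0)).
    - unfold circle_int. rewrite RInt_const. apply Rmult_0_r.
    - intros x. change (Derive (v t) x * Derive (v t) x = 0). rewrite Z1, Z0. ring. }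
  exists (fun t => Nn t * / Dn t). split.
  + apply smooth_on_interval_iff. apply (smooth_alg_smooth (V := R1)); [exact HT|].
    apply (sa_mult (V := R1)).
    * apply (smooth_on_alg (V := R1)).
      apply (fam_int_smooth T HT (fun z => G z * D2 (D2 (D2 vh)) z)). fam_tac.
    * apply (sa_inv (V := R1)); [|exact NZ].
      apply (smooth_on_alg (V := R1)).
      apply (fam_int_smooth T HT (fun z => D2 (D2 (D2 vh)) z * D2 (D2 (D2 vh)) z)). fam_tac.
  + intros t x Ht. destruct (Hpt t Ht) as [d Ed].
    assert (EN : Nn t = d * Dn t).
    { unfold Nn, Dn. rewrite <- circle_int_scal.
      - apply circle_int_ext. intros y. unfold G.
        change (D2 (D2 (D1 vh)) (t, y)) with (Derive_n (fun x => Derive (fun s => v s x) t) 2 y).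
        rewrite Ed.
        change (D2 vh (t, y)) with (Derive (v t) y). change (D2 (D2 vh) (t, y)) with (Derive_n (v t) 2 y).
        change (D2 (D2 (D2 vh)) (t, y)) with (Derive_n (v t) 3 y). change (vh (t, y)) with (v t y). ring.
      - intros y. apply (continuous_mult_R (fun x => D2 (D2 (D2 vh)) (t, x)) (fun x => D2 (D2 (D2 vh)) (t, x))); now apply Cf. }
    replace (Nn t * / Dn t) with d by (rewrite EN; field; now apply NZ). apply Ed.
Qed.

(** The geodesic equation for the velocity [v + q] and the central velocity [b]
    carries the term [(q - 2 b) v_xxx]; the choice [q = 2 b - d] matches it with
    the equation satisfied by [v], and no shift of the space variable is
    required. *)
Lemma solutions_lift alpha beta v b : smooth_circle_curve alpha beta v ->
  HS_class_solution alpha beta v ->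
  exists p q : R -> R,
    smooth_on_interval alpha beta p /\ smooth_on_interval alpha beta q /\
    forall g : R -> pre_Vir, smooth_Vir_curve alpha beta g ->
      has_right_velocity alpha beta g (fun t x => v t (x + p t) + q t) (fun _ => b) ->
      lifts_geodesic alpha beta g.
Proof.
intros Hv Hsol. destruct (HS_coefficient alpha beta v Hv Hsol) as [d [Hd Ed]].
set (T := time_interval alpha beta).
pose proof (open_time_interval alpha beta : open T) as HT.
set (q := fun t => 2 * b + -1 * d t).
exists (fun _ => 0), q. split; [|split].
- apply smooth_on_interval_iff. apply (smooth_alg_smooth (V := R1)); [exact HT|apply (sa_const (V := R1))].
- apply smooth_on_interval_iff. apply (smooth_alg_smooth (V := R1)); [exact HT|].
  apply (sa_plus (V := R1)); [apply (sa_const (V := R1))|].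
  apply (sa_mult (V := R1)); [apply (sa_const (V := R1))|].
  apply (smooth_on_alg (V := R1)). now apply smooth_on_interval_iff.
- intros g Hg Hvel.
  set (vh := curve_family v).
  pose proof (curve_fam alpha beta v Hv : circle_family (P := R1) T vh) as HF.
  assert (Hb : forall t, T t -> central_velocity g t = b).
  { intros t Ht. now apply (has_right_velocity_lagrangian alpha beta g Hg _ _ t Hvel Ht). }
  set (c := fun t => q t + -2 * central_velocity g t).
  apply (lifts_geodesic_of_residual alpha beta g (fun t => HS_form vh c (t, 0)) b Hg Hb).
  intros t y Ht.
  rewrite (residual_eulerian T g vh q HT HF (curve_diffeo alpha beta g Hg) (curve_flow_smooth alpha beta g Hg)).
  + fold c. apply (derive_0_const (fun x => HS_form vh c (t, x))). intros x.
    pose proof (is_derive_HS_form T vh HT HF c t x Ht) as D.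
    match type of D with is_derive _ _ ?l => replace l with 0 in D; [exact D|] end.
    change (D2 (D2 (D1 vh)) (t, x)) with (Derive_n (fun x => Derive (fun s => v s x) t) 2 x).
    rewrite Ed by exact Ht. unfold c. rewrite Hb by exact Ht.
    change (D2 vh (t, x)) with (Derive (v t) x). change (D2 (D2 vh) (t, x)) with (Derive_n (v t) 2 x).
    change (D2 (D2 (D2 vh)) (t, x)) with (Derive_n (v t) 3 x). change (vh (t, x)) with (v t x).
    unfold q. ring.
  + intros s z Hs. destruct (has_right_velocity_lagrangian alpha beta g Hg _ _ s Hvel Hs) as [H _].
    rewrite H. rewrite Rplus_0_r. reflexivity.
  + exact Ht.
Qed.

(** * Geodesics satisfy the equation *)

Lemma periodic_iter f n x : periodic f -> f (x + 2 * PI * INR n) = f x.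
Proof.
intros Pf. induction n as [|n IH].
- simpl. now rewrite Rmult_0_r, Rplus_0_r.
- rewrite S_INR. replace (x + 2 * PI * (INR n + 1)) with (x + 2 * PI * INR n + 2 * PI) by ring.
  now rewrite Pf.
Qed.

Lemma period_representative x : exists y, 0 <= y <= 2 * PI /\ forall f, periodic f -> f x = f y.
Proof.
generalize PI_RGT_0; intros Hpi. assert (H2 : 0 < 2 * PI) by lra.
assert (K : forall x, 0 <= x -> exists y, 0 <= y <= 2 * PI /\ forall f, periodic f -> f x = f y).
{ clear x. intros x Hx.
  destruct (nfloor_ex (x / (2 * PI))) as [n [Hn1 Hn2]]; [apply Rdiv_le_0_compat; lra|].
  exists (x - 2 * PI * INR n). split.
  - apply (Rmult_le_compat_l (2 * PI)) in Hn1; [|lra]. apply (Rmult_lt_compat_l (2 * PI)) in Hn2; [|lra].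
    replace (2 * PI * (x / (2 * PI))) with x in Hn1, Hn2 by (field; lra). lra.
  - intros f Pf. rewrite <- (periodic_iter f n (x - 2 * PI * INR n) Pf). f_equal. ring. }
destruct (nfloor_ex (Rabs x / (2 * PI))) as [n [_ Hn]]; [apply Rdiv_le_0_compat; [apply Rabs_pos|exact H2]|].
destruct (K (x + 2 * PI * INR (S n))) as [y [Hy Ey]].
- apply (Rmult_lt_compat_l (2 * PI)) in Hn; [|exact H2].
  replace (2 * PI * (Rabs x / (2 * PI))) with (Rabs x) in Hn by (field; lra).
  rewrite S_INR. generalize (Rle_abs (- x)). rewrite Rabs_Ropp. lra.
- exists y. split; [exact Hy|]. intros f Pf. rewrite <- (Ey f Pf). symmetry. now apply periodic_iter.
Qed.

(** Variations are defined on a neighbourhood of the time interval. *)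
Lemma time_interval_margin alpha beta t0 t1 : time_interval alpha beta t0 -> time_interval alpha beta t1 ->
  exists d, 0 < d /\ forall t, t0 - d <= t <= t1 + d -> time_interval alpha beta t.
Proof.
intros H0 H1.
destruct (open_time_interval alpha beta t0 H0) as [d0 D0].
destruct (open_time_interval alpha beta t1 H1) as [d1 D1'].
set (d := Rmin d0 d1 / 2).
assert (Hm : 0 < Rmin d0 d1) by (apply Rmin_glb_lt; [apply d0|apply d1]).
assert (Hd0 : d < d0) by (unfold d; generalize (Rmin_l d0 d1); lra).
assert (Hd1 : d < d1) by (unfold d; generalize (Rmin_r d0 d1); lra).
assert (Hd : 0 < d) by (unfold d; lra).
assert (A : time_interval alpha beta (t0 - d)).
{ apply D0. change (Rabs (t0 - d - t0) < d0). apply Rabs_def1; lra. }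
assert (B : time_interval alpha beta (t1 + d)).
{ apply D1'. change (Rabs (t1 + d - t1) < d1). apply Rabs_def1; lra. }
exists d. split; [exact Hd|]. intros t [Ha Hb]. split.
- apply Rbar_lt_le_trans with (t0 - d); [apply A|exact Ha].
- apply Rbar_le_lt_trans with (t1 + d); [exact Hb|apply B].
Qed.

Section Geodesic.

Variables (alpha beta : Rbar) (g : R -> pre_Vir).
Hypothesis Hg : smooth_Vir_curve alpha beta g.
Let T := time_interval alpha beta.
Notation fam := (circle_family (P := R1) T).

Let HT : open T := open_time_interval alpha beta.
Let Hd := curve_diffeo alpha beta g Hg.
Let Hs := curve_flow_smooth alpha beta g Hg.
Let Ha := curve_central_smooth alpha beta g Hg.
Let L := log_density g.
Let rho := density g.
Let B := central_velocity g.
Let HL : fam L := log_density_fam T g HT Hd Hs.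
Let Hrho : fam rho := density_fam T g HT Hd Hs.
Let Hri : fam (fun z => / rho z) := density_inv_fam T g HT Hd Hs.
Let HR : fam (residual g) := residual_fam T g HT Hd Hs Ha.
Let HB : smooth_on (V := R1) T B := smooth_central_velocity T g HT Hd Hs Ha.

Variables t0 t1 : R.
Hypothesis T0 : T t0.
Hypothesis T1 : T t1.
Hypothesis Ht : t0 < t1.

Definition test_field (z : R * R) : R := -1 * D2 (residual g) z.
Definition test_central (t : R) : R :=
  Derive B t + circle_int (fun y => D2 L (t, y) * (D2 test_field (t, y) * / rho (t, y))).
Definition cutoff (t : R) : R := (t - t0) * (t1 - t).

(** A variation against the gradient of the energy, cut off at the endpoints:
    [test_field] is [- H_y] where [H] is the Euler--Lagrange expression, because
    the variation of [ln phi_y] that it induces is its space derivative over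
    [phi_y]. The integral in [test_central] cancels the contribution of
    [test_field] to the factor of [Derive B], leaving [(Derive B)^2]. *)
Definition test_family (s t : R) : pre_Vir :=
  (fun y => fst (g t) y + s * (cutoff t * test_field (t, y)),
   snd (g t) + s * (cutoff t * test_central t)).

Lemma test_field_fam : fam test_field.
Proof. unfold test_field. fam_tac. Qed.

Lemma test_central_smooth : smooth_on (V := R1) T test_central.
Proof.
apply (smooth_alg_smooth (V := R1)); [exact HT|].
apply (sa_plus (V := R1)).
- apply (smooth_on_alg (V := R1)). now apply (smooth_on_Derive T).
- apply (smooth_on_alg (V := R1)).
  apply (fam_int_smooth T HT (fun z => D2 L z * (D2 test_field z * / rho z))).
  pose proof test_field_fam. fam_tac.
Qed.

Lemma cutoff_smooth : smooth cutoff.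
Proof.
apply smooth_mult.
- apply (smooth_of_derive _ (fun _ => 1)); [|apply smooth_const].
  intros x. auto_derive; auto; ring.
- apply (smooth_of_derive _ (fun _ => -1)); [|apply smooth_const].
  intros x. auto_derive; auto; ring.
Qed.

Let T2 (p : R * R) := T (snd p).

Lemma open_T2 : open (T := R2) T2.
Proof.
apply (open_comp (T := R2) snd T); [|exact HT].
intros p _. apply (continuous_snd (U := R_UniformSpace)).
Qed.

Lemma pull_time f : smooth_on (V := R1) T f -> smooth_on (V := R2) T2 (fun p => f (snd p)).
Proof.
apply (smooth_on_snd (V := R1) (W := R1) T f HT).
Qed.

Lemma pull_s : smooth_on (V := R2) T2 (fun p => fst p).
Proof.
apply (smooth_on_sub (V := R2) (fun _ => True)); [now intros|].
apply (smooth_on_fst (V := R1) (W := R1) (fun _ => True) (fun s => s)); [apply open_true|].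
apply smooth_iff. apply (smooth_of_derive _ (fun _ => 1)); [|apply smooth_const].
intros x. apply (is_derive_id (K := R_AbsRing)).
Qed.

Lemma pull_space F : smooth_on (V := R2) (cyl T) F -> smooth_on (V := R3) (cyl T2) (fun z => F (snd (fst z), snd z)).
Proof.
intros HF.
apply (smooth_on_affine (V := R3) (W := R2) (cyl T) F (fun z : R * R * R => (snd (fst z), snd z)) (fun z : R * R * R => (snd (fst z), snd z))).
- now apply (open_cyl (P := R1)).
- intros z. apply (continuous_pair (T := R3) (A := R1) (B := R1) (fun z : R * R * R => snd (fst z)) snd).
  + apply (continuous_comp (U := R3) (V := R2) fst snd); [apply (continuous_fst (U := R2))|apply (continuous_snd (U := R1))].
  + apply (continuous_snd (U := R2)).
- reflexivity.
- exact HF.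
Qed.

Lemma cutoff_T : smooth_on (V := R1) T cutoff.
Proof.
apply (smooth_on_sub (V := R1) (fun _ => True)); [now intros|].
apply smooth_iff, cutoff_smooth.
Qed.

Lemma amplitude_alg : smooth_alg (V := R3) (cyl T2) (fun z => fst (fst z) * cutoff (snd (fst z))).
Proof.
apply (smooth_on_alg (V := R3)).
apply (circle_family_param (P := R2) T2 open_T2 (fun p => fst p * cutoff (snd p))).
apply (smooth_alg_smooth (V := R2)); [exact open_T2|].
apply (sa_mult (V := R2)); apply (smooth_on_alg (V := R2)); [exact pull_s|].
apply pull_time, cutoff_T.
Qed.

Lemma perturbation_smooth F G : smooth_on (V := R2) (cyl T) F -> smooth_on (V := R2) (cyl T) G ->
  smooth_on (V := R3) (cyl T2) (fun z => F (snd (fst z), snd z) + fst (fst z) * (cutoff (snd (fst z)) * G (snd (fst z), snd z))).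
Proof.
intros HF HG. pose proof (open_cyl (P := R2) T2 open_T2) as HcT2.
apply (smooth_on_ext (V := R3) _ (fun z => F (snd (fst z), snd z) + (fst (fst z) * cutoff (snd (fst z))) * G (snd (fst z), snd z))); [exact HcT2|intros z _; ring|].
apply (smooth_alg_smooth (V := R3)); [exact HcT2|].
apply (sa_plus (V := R3)); [apply (smooth_on_alg (V := R3)); now apply pull_space|].
apply (sa_mult (V := R3)); [exact amplitude_alg|apply (smooth_on_alg (V := R3)); now apply pull_space].
Qed.

Lemma test_family_is_derive s t y : T t ->
  is_derive (fst (test_family s t)) y (rho (t, y) + s * (cutoff t * D2 test_field (t, y))).
Proof.
intros Tt.
apply (is_derive_plus (V := R1) (fst (g t))).
- apply diffeo_is_derive. now apply Hd.
- apply is_derive_scal, is_derive_scal. apply (fam_is_D2 T); [exact test_field_fam|exact Tt].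
Qed.

(** Only the positivity of the space derivative restricts [s]; the tube lemma
    over space and then over time makes the restriction uniform. *)
Lemma test_family_admissible : exists eps, 0 < eps /\
  (forall t, t0 - eps < t < t1 + eps -> T t) /\ smooth_Vir_family eps t0 t1 test_family.
Proof.
destruct (time_interval_margin alpha beta t0 t1 T0 T1) as [d [Hd0 Hd1]].
set (F := fun z : R * R * R => rho (snd (fst z), snd z) + fst (fst z) * (cutoff (snd (fst z)) * D2 test_field (snd (fst z), snd z))).
assert (HF : smooth_on (V := R3) (cyl T2) F).
{ apply perturbation_smooth; [apply Hrho|]. apply (fam_D2 T HT _ test_field_fam). }
assert (P : locally (0 : R) (fun s => forall t, t0 - d <= t <= t1 + d ->
    (fun p : R2 => forall y, 0 <= y <= 2 * PI -> 0 < F (p, y)) (s, t))).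
{ apply (tube (V := R_UniformSpace) (fun p : R2 => forall y, 0 <= y <= 2 * PI -> 0 < F (p, y))).
  intros t Htd. apply (tube (V := R2) (fun z : R3 => 0 < F z)). intros y _.
  assert (C : continuous (T := R3) F (0, t, y)).
  { apply (smooth_on_continuous (V := R3) (cyl T2)); [exact HF|]. exact (Hd1 t Htd). }
  apply C. apply (open_gt 0). unfold F. simpl. rewrite Rmult_0_l, Rplus_0_r.
  apply (density_pos T g Hd). exact (Hd1 t Htd). }
destruct P as [e He].
set (eps := Rmin e d).
assert (Hee : eps <= e) by apply Rmin_l.
assert (Hed : eps <= d) by apply Rmin_r.
assert (Heps : 0 < eps) by (apply Rmin_glb_lt; [apply e|exact Hd0]).
assert (HTe : forall t, t0 - eps < t < t1 + eps -> T t) by (intros; apply Hd1; lra).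
exists eps. split; [exact Heps|]. split; [exact HTe|]. split; [|split].
- intros s t [Hs' Ht']. pose proof (HTe t Ht') as Tt. split; [|split].
  + apply (smooth_ext (fun y => fst (g t) y + (s * cutoff t) * test_field (t, y))); [intros; simpl; ring|].
    apply smooth_lin; [apply Hd, Tt|].
    apply (fam_circle_function alpha beta test_field t test_field_fam Tt).
  + intros x.
    change (fst (g t) (x + 2 * PI) + s * (cutoff t * test_field (t, x + 2 * PI)) =
      fst (g t) x + s * (cutoff t * test_field (t, x)) + 2 * PI).
    rewrite (proj1 (proj2 (Hd t Tt))), (proj2 test_field_fam t x Tt : test_field (t, x + 2 * PI) = test_field (t, x)). ring.
  + intros x. rewrite (is_derive_unique _ _ _ (test_family_is_derive s t x Tt)).
    destruct (period_representative x) as [y [Hy Ey]].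
    assert (E : rho (t, x) + s * (cutoff t * D2 test_field (t, x)) = F (s, t, y)).
    { apply (Ey (fun x => rho (t, x) + s * (cutoff t * D2 test_field (t, x)))).
      intros z. now rewrite (proj2 Hrho t z Tt : rho (t, z + 2 * PI) = rho (t, z)),
        (proj2 (fam_D2 T HT _ test_field_fam) t z Tt : D2 test_field (t, z + 2 * PI) = D2 test_field (t, z)). }
    apply (Rlt_le_trans _ (F (s, t, y))); [|right; exact (eq_sym E)].
    apply (He s); [|lra|exact Hy]. change (Rabs (s - 0) < e). rewrite Rminus_0_r. lra.
- apply (smooth_on_sub (V := R3) (cyl T2)); [intros z [_ Hz]; exact (HTe _ Hz)|].
  apply (perturbation_smooth (flow g) test_field); [exact Hs|apply test_field_fam].
- apply (smooth_on_sub (V := R2) T2); [intros z [_ Hz]; exact (HTe _ Hz)|].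
  apply (smooth_alg_smooth (V := R2)); [exact open_T2|].
  apply (sa_plus (V := R2)); [apply (smooth_on_alg (V := R2)), (pull_time (fun t => snd (g t))), Ha|].
  apply (sa_mult (V := R2)); [apply (smooth_on_alg (V := R2)), pull_s|].
  apply (sa_mult (V := R2)); apply (smooth_on_alg (V := R2)); [apply pull_time, cutoff_T|].
  apply pull_time, test_central_smooth.
Qed.

Lemma test_family_fixed s t : T t -> s * cutoff t = 0 -> same_right_coset (g t) (test_family s t).
Proof.
intros Tt E. apply same_right_coset_iff; [now apply Hd|]. split.
- exists 0. intros x. simpl. rewrite <- Rmult_assoc, E. ring.
- simpl. rewrite <- Rmult_assoc, E. ring.
Qed.

Lemma test_family_variation t y : T t ->
  log_density_variation test_family (t, y) = cutoff t * (D2 test_field (t, y) * / rho (t, y)).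
Proof.
intros Tt. unfold log_density_variation.
rewrite (Derive_ext _ (fun s => ln (rho (t, y) + s * (cutoff t * D2 test_field (t, y))))).
2:{ intros s. apply (f_equal ln). apply is_derive_unique. now apply test_family_is_derive. }
pose proof (density_pos T g Hd t y Tt) as Hp. fold rho in Hp.
apply is_derive_unique. auto_derive; [lra|]. field. lra.
Qed.

Lemma test_family_central_variation t : central_variation test_family t = cutoff t * test_central t.
Proof.
unfold central_variation. simpl. apply is_derive_unique. auto_derive; auto. ring.
Qed.

Hypothesis Hgeo : lifts_geodesic alpha beta g.

(** For the test family the derivative of the energy is minus the integral of
    [cutoff] times [int H_y^2 + (Derive B)^2], where [H] is the Euler--Lagrange
    expression. It vanishes on a geodesic, and the integrand is nonnegative. *)
Lemma geodesic_gradient_zero t : t0 < t < t1 ->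
  Derive B t = 0 /\ forall y, D2 (residual g) (t, y) = 0.
Proof.
intros Htt.
destruct test_family_admissible as [eps [He [HTe Hf]]].
assert (HJt : forall t, t0 <= t <= t1 -> T t) by (intros; apply HTe; lra).
assert (C0 : cutoff t0 = 0) by (unfold cutoff; ring).
assert (C1 : cutoff t1 = 0) by (unfold cutoff; ring).
assert (Hcos : forall t, t0 <= t <= t1 -> same_right_coset (g t) (test_family 0 t)).
{ intros r Hr. apply test_family_fixed; [now apply HJt|ring]. }
assert (F0 : forall s, same_right_coset (g t0) (test_family s t0)).
{ intros s. apply test_family_fixed; [exact T0|rewrite C0; ring]. }
assert (F1 : forall s, same_right_coset (g t1) (test_family s t1)).
{ intros s. apply test_family_fixed; [exact T1|rewrite C1; ring]. }
pose proof (Hgeo t0 t1 T0 T1 Ht eps test_family He Hf Hcos (fun s _ => conj (F0 s) (F1 s))) as G0.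
pose proof (first_variation eps t0 t1 test_family He Ht Hf) as FV.
rewrite (first_variation_by_parts eps t0 t1 test_family He Ht Hf) in FV.
rewrite (boundary_term_fixed eps t0 t1 test_family (g t0) t0 He Hf ltac:(lra) (Hd t0 T0) (fun s _ => F0 s)) in FV.
rewrite (boundary_term_fixed eps t0 t1 test_family (g t1) t1 He Hf ltac:(lra) (Hd t1 T1) (fun s _ => F1 s)) in FV.
set (J := fun t => t0 < t < t1).
assert (HJ : open J) by (apply (open_and (fun t : R => t0 < t) (fun t : R => t < t1)); [apply open_gt|apply open_lt]).
assert (HdJ : forall t, J t -> diffeo (fst (g t))) by (intros r Jr; apply Hd, HJt; unfold J in Jr; lra).
assert (HcJ : forall t, J t -> same_right_coset (g t) (test_family 0 t)) by (intros r Jr; apply Hcos; unfold J in Jr; lra).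
set (Q := fun t => cutoff t * (circle_int (fun y => D2 (residual g) (t, y) * D2 (residual g) (t, y)) + Derive B t * Derive B t)).
pose proof test_field_fam as Htf.
assert (HQ : RInt Q t0 t1 = 0).
{ pose proof (is_derive_unique _ _ _ FV) as U1. rewrite (is_derive_unique _ _ _ G0) in U1.
  match type of U1 with 0 = _ - RInt ?f _ _ => assert (EQ : RInt f t0 t1 = RInt Q t0 t1); [|rewrite EQ in U1; lra] end.
  apply RInt_ext. intros r Jr. rewrite Rmin_left, Rmax_right in Jr by lra. change (J r) in Jr.
  assert (Tr : T r) by (apply HJt; unfold J in Jr; lra).
  assert (EB : Derive (central_velocity (test_family 0)) r = Derive B r).
  { apply Derive_ext_loc. generalize (HJ r Jr). apply filter_imp. intros s Js.
    exact (same_central_velocity J g (test_family 0) HJ HdJ HcJ s Js). }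
  rewrite EB, test_family_central_variation.
  rewrite (circle_int_ext _ (fun y => cutoff r * (D2 test_field (r, y) * residual g (r, y)))).
  2:{ intros y. rewrite (same_residual J g (test_family 0) HJ HdJ HcJ (r, y) Jr).
    rewrite (same_density J g (test_family 0) HdJ HcJ (r, y) Jr), test_family_variation by exact Tr.
    fold rho. field. apply Rgt_not_eq. now apply (density_pos T g Hd). }
  rewrite (circle_int_ext (fun y => D2 (log_density (test_family 0)) (r, y) * _)
     (fun y => cutoff r * (D2 L (r, y) * (D2 test_field (r, y) * / rho (r, y))))).
  2:{ intros y. rewrite (same_D2_log_density J g (test_family 0) HJ HdJ HcJ (r, y) Jr), test_family_variation by exact Tr.
    fold L. ring. }
  rewrite (fam_int_scal T HT (cutoff r) (fun z => D2 test_field z * residual g z)); [|fam_tac|exact Tr].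
  rewrite (fam_int_scal T HT (cutoff r) (fun z => D2 L z * (D2 test_field z * / rho z))); [|fam_tac|exact Tr].
  rewrite (fam_by_parts T HT test_field (residual g) r Htf HR Tr).
  rewrite (circle_int_ext (fun y => test_field (r, y) * _) (fun y => -1 * (D2 (residual g) (r, y) * D2 (residual g) (r, y)))) by (intros; unfold test_field; ring).
  rewrite (fam_int_scal T HT (-1) (fun z => D2 (residual g) z * D2 (residual g) z)); [|fam_tac|exact Tr].
  unfold Q, test_central. match goal with |- ?l = ?r => change (@eq R l r) end. ring. }
assert (HQs : smooth_on (V := R1) T Q).
{ apply (smooth_alg_smooth (V := R1)); [exact HT|].
  assert (HDB : smooth_alg (V := R1) T (Derive B)).
  { apply (smooth_on_alg (V := R1)). now apply (smooth_on_Derive T). }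
  apply (sa_mult (V := R1)); [apply (smooth_on_alg (V := R1)), cutoff_T|].
  apply (sa_plus (V := R1)); [|now apply (sa_mult (V := R1))].
  apply (smooth_on_alg (V := R1)).
  apply (fam_int_smooth T HT (fun z => D2 (residual g) z * D2 (residual g) z)). fam_tac. }
assert (Cc : forall r x, T r -> continuous (fun y => D2 (residual g) (r, y)) x).
{ intros r x Tr. apply (circle_family_continuous (P := R1) T HT (D2 (residual g)) r); [fam_tac|exact Tr]. }
assert (Pi : forall r, T r -> 0 <= circle_int (fun y => D2 (residual g) (r, y) * D2 (residual g) (r, y))).
{ intros r Tr. apply RInt_ge_0.
  - generalize PI_RGT_0; lra.
  - apply ex_RInt_cont. intros x. apply (continuous_mult_R); now apply Cc.
  - intros. apply Rle_0_sqr. }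
assert (Z : Q t = 0).
{ apply (RInt_nonneg_zero Q t0 t1); [| |exact HQ|exact Htt].
  - intros r Hr. apply (smooth_on_continuous (V := R1) T); [exact HQs|now apply HJt].
  - intros r Hr. apply Rmult_le_pos.
    + unfold cutoff. apply Rmult_le_pos; lra.
    + apply Rplus_le_le_0_compat; [apply Pi, HJt; lra|apply Rle_0_sqr]. }
assert (Tt : T t) by (apply HJt; lra).
apply Rmult_integral in Z. destruct Z as [Z|Z].
{ exfalso. assert (0 < cutoff t) by (unfold cutoff; apply Rmult_lt_0_compat; lra). lra. }
pose proof (Pi t Tt) as P1. pose proof (Rle_0_sqr (Derive B t)) as P2. unfold Rsqr in P2.
split.
- apply Rsqr_0_uniq. unfold Rsqr. lra.
- apply (circle_sq_zero (fun y => D2 (residual g) (t, y))).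
  + intros x. apply (proj2 (fam_D2 T HT _ HR) t x Tt).
  + intros x. now apply Cc.
  + lra.
Qed.

End Geodesic.

(** Near each time the Euler--Lagrange expression is independent of [y]; as every
    point of the circle is the position of a particle, the primitive [HS_form] of
    the Hunter--Saxton equation is then independent of [x]. *)
Lemma geodesic_HS alpha beta g v b : smooth_Vir_curve alpha beta g ->
  smooth_circle_curve alpha beta v -> has_right_velocity alpha beta g v b ->
  lifts_geodesic alpha beta g ->
  HS_class_solution alpha beta v /\ (forall t, time_interval alpha beta t -> is_derive b t 0).
Proof.
intros Hg Hv Hvel Hgeo.
set (T := time_interval alpha beta).
pose proof (open_time_interval alpha beta : open T) as HT.
assert (K : forall t, T t -> Derive (central_velocity g) t = 0 /\ forall y, D2 (residual g) (t, y) = 0).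
{ intros t Tt. destruct (time_interval_margin alpha beta t t Tt Tt) as [d [Hd0 Hd1]].
  apply (geodesic_gradient_zero alpha beta g Hg (t - d) (t + d)); try assumption; try (apply Hd1; lra); lra. }
set (vh := curve_family v).
pose proof (curve_fam alpha beta v Hv : circle_family (P := R1) T vh) as HF.
pose proof (curve_diffeo alpha beta g Hg) as Hd.
pose proof (curve_flow_smooth alpha beta g Hg) as Hs.
pose proof (curve_central_smooth alpha beta g Hg) as Ha.
split; intros t Tt.
- destruct (K t Tt) as [_ Kt].
  pose proof (curve_circle_function alpha beta v Hv t Tt) as Hvt.
  pose proof (curve_velocity_circle_function alpha beta v Hv t Tt) as Hwt.
  set (c := fun t => 0 + -2 * central_velocity g t).
  assert (E : forall y, residual g (t, y) = HS_form vh c (t, flow g (t, y))).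
  { intros y. apply (residual_eulerian T g vh (fun _ => 0) HT HF Hd Hs); [|exact Tt].
    intros s z Ts. rewrite Rplus_0_r. now apply (has_right_velocity_lagrangian alpha beta g Hg v b). }
  assert (Er : forall y, residual g (t, y) = residual g (t, 0)).
  { intros y. apply (derive_0_const (fun y => residual g (t, y))). intros x. rewrite <- (Kt x).
    apply (fam_is_D2 T); [|exact Tt]. now apply residual_fam. }
  assert (Ef : forall x, HS_form vh c (t, x) = residual g (t, 0)).
  { intros x. destruct (diffeo_surjective _ (Hd t Tt) x) as [y <-].
    rewrite <- (Er y), E. reflexivity. }
  assert (Z : forall x, Derive_n (fun x => Derive (fun s => v s x) t) 2 x +
     2 * Derive (v t) x * Derive_n (v t) 2 x + (v t x + c t) * Derive_n (v t) 3 x = 0).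
  { intros x. pose proof (is_derive_HS_form T vh HT HF c t x Tt) as D.
    assert (D0 : is_derive (fun x => HS_form vh c (t, x)) x 0).
    { apply (is_derive_ext (fun _ => residual g (t, 0))); [intros; symmetry; apply Ef|].
      apply (is_derive_const (V := R1)). }
    exact (eq_trans (eq_sym (is_derive_unique _ _ _ D)) (is_derive_unique _ _ _ D0)). }
  exists (fun x => Derive (fun s => v s x) t + c t * Derive (v t) x). split; [split|].
  + apply circle_function_lin; [exact Hwt|now apply circle_function_Derive].
  + intros x. rewrite Derive_n_lin; [|apply Hwt|now apply smooth_Derive, Hvt].
    change (Derive_n (Derive (v t)) 2 x) with (Derive_n (v t) 3 x).
    specialize (Z x). lra.
  + exists 0, (- c t). intros x. ring.
- apply (is_derive_ext_loc (central_velocity g)).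
  + generalize (HT t Tt). apply filter_imp. intros s Ts.
    now apply (has_right_velocity_lagrangian alpha beta g Hg v b).
  + rewrite <- (proj1 (K t Tt)). apply Derive_correct.
    apply (smooth_on_ex_derive T); [|exact Tt]. now apply (smooth_central_velocity T).
Qed.

(** * The equation on classes and the geodesics of the homogeneous space *)

Theorem theorem4p7 :
  (* on classes, the velocity prescribed by the equation exists, is unique,
     and depends only on the class *)
  (forall v : R -> R, circle_function v ->
     (exists w, circle_function w /\ HS_class_velocity v w) /\
     (forall w w', HS_class_velocity v w -> HS_class_velocity v w' ->
        tangent_to_class v (fun x => w' x - w x)) /\
     (forall w v' w', same_class_velocity v w v' w' ->
        (HS_class_velocity v w <-> HS_class_velocity v' w')))
  /\
  (* evolution of classes, with time-dependent shifts *)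
  (forall (alpha beta : Rbar) (v : R -> R -> R) (p q : R -> R),
     smooth_circle_curve alpha beta v ->
     smooth_on_interval alpha beta p ->
     smooth_on_interval alpha beta q ->
     (HS_class_solution alpha beta v <->
      HS_class_solution alpha beta (fun t x => v t (x + p t) + q t)))
  /\
  (* it is the Euler equation on L / K *)
  (forall (alpha beta : Rbar) (v : R -> R -> R) (b : R -> R),
     smooth_circle_curve alpha beta v ->
     (euler_on_L_mod_K alpha beta (fun t => inertia (v t, b t)) <->
      HS_class_solution alpha beta v /\
      (forall t, time_interval alpha beta t -> is_derive b t 0)))
  /\
  (* it is satisfied by the velocities of the geodesics of Vir / Rot *)
  (forall (alpha beta : Rbar) (g : R -> pre_Vir) (v : R -> R -> R) (b : R -> R),
     smooth_Vir_curve alpha beta g ->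
     smooth_circle_curve alpha beta v ->
     has_right_velocity alpha beta g v b ->
     lifts_geodesic alpha beta g ->
     euler_on_L_mod_K alpha beta (fun t => inertia (v t, b t)) /\
     HS_class_solution alpha beta v /\
     (forall t, time_interval alpha beta t -> is_derive b t 0))
  /\
  (* conversely, every solution has representatives whose integral curves in
     Vir lift geodesics *)
  (forall (alpha beta : Rbar) (v : R -> R -> R) (b : R),
     smooth_circle_curve alpha beta v ->
     HS_class_solution alpha beta v ->
     exists p q : R -> R,
       smooth_on_interval alpha beta p /\
       smooth_on_interval alpha beta q /\
       forall g : R -> pre_Vir,
         smooth_Vir_curve alpha beta g ->
         has_right_velocity alpha beta g
           (fun t x => v t (x + p t) + q t) (fun _ => b) ->
         lifts_geodesic alpha beta g).
Proof.
split; [|split; [|split; [|split]]].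
- intros v Hv. split; [|split].
  + destruct (HS_velocity_exists v Hv) as [w Hw]. exists w. split; [apply Hw|].
    exists w. split; [exact Hw|]. exists 0, 0. intros x. ring.
  + apply HS_class_velocity_unique.
  + intros w v' w'. now apply HS_class_velocity_iff.
- intros alpha beta v p q Hv Hp Hq.
  assert (K : forall t, time_interval alpha beta t ->
    HS_class_velocity (v t) (fun x => Derive (fun s => v s x) t) <->
    HS_class_velocity (fun x => v t (x + p t) + q t) (fun x => Derive (fun s => v s (x + p s) + q s) t)).
  { intros t Ht. exact (HS_class_velocity_iff _ _ _ _ (curve_circle_function alpha beta v Hv t Ht)
      (curve_shift_velocity alpha beta v Hv p q t Hp Hq Ht)). }
  split; intros H t Ht.
  + exact (proj1 (K t Ht) (H t Ht)).
  + exact (proj2 (K t Ht) (H t Ht)).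
- exact euler_iff_HS.
- intros alpha beta g v b Hg Hv Hvel Hgeo.
  destruct (geodesic_HS alpha beta g v b Hg Hv Hvel Hgeo) as [HS Hb].
  split; [|split; assumption]. now apply euler_iff_HS.
- exact solutions_lift.
Qed.
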